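(* Let $f:\mathbb{R}^d\times\mathbb{R}^d\times\mathbb{R}^m\to[0,+\infty)$ be a Borel function satisfying the periodicity and growth assumptions listed in the context, let $\delta\in(0,+\infty)$, and assume in addition that $f(x,\xi,\cdot)$ is convex for every $x,\xi\in\mathbb{R}^d$. Let $$f^\delta_{\rm hom}(M)=\lim_{R\to+\infty}\frac1{R^{d-1}}\inf_{v\in\mathcal{D}^1_M(Q_R)}(\delta\vee1)\int_{\mathbb{R}^d}\int_{(Q_R\times I)_{1,\delta}(\xi)}f\big(x,\xi,v(x_\alpha+\xi_\alpha,x_d+\delta\xi_d)-v(x)\big)\,dx\,d\xi.$$ Then, for every $M\in\mathbb{R}^{m\times(d-1)}$, $$f^\delta_{\rm hom}(M)=\inf_{u\in\mathcal{D}^\#_M(Q_1)}(\delta\vee1)\int_{\mathbb{R}^d}\int_{Q_1\times I_\delta(\xi_d)}f\big(x,\xi,u(x_\alpha+\xi_\alpha,x_d+\delta\xi_d)-u(x)\big)\,dx\,d\xi.$$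
   Context: Fix integers $d\ge2$, $m\ge1$ and $p\in(1,\infty)$. For $x\in\mathbb{R}^d$ write $x=(x_\alpha,x_d)$, $x_\alpha\in\mathbb{R}^{d-1}$. $I=(-1,1)$, $B_r=\{y\in\mathbb{R}^{d-1}:|y|<r\}$, $C_r=B_r\times(-r,r)$, $Q_R=(0,R)^{d-1}$, $a\vee b=\max\{a,b\}$. $(Q_R\times I)_{1,\delta}(\xi)=\{x\in Q_R\times I:(x_\alpha+\xi_\alpha,x_d+\delta\xi_d)\in Q_R\times I\}$ and $I_\delta(\xi_d)=\{t\in I:t+\delta\xi_d\in I\}$. Assumptions on $f$: $f(y,\xi,z)$ is $(0,1)^{d-1}$-periodic in $y_\alpha$, and for some constants $c_2>c_1>0$ and measurable $\psi,\rho:\mathbb{R}^d\to[0,+\infty)$, $$c_1(\psi(\xi)|z|^p-\rho(\xi))\le f(y,\xi,z)\le c_2(\psi(\xi)|z|^p+\rho(\xi)),$$ where: $\psi(\xi)\ge c_0$ for $\xi\in C_{r_0}$, for some $r_0,c_0>0$; $\int_{\mathbb{R}^d}(\psi(\xi)|\xi|^p+\rho(\xi))\,d\xi<+\infty$; $\sup_{|\xi_d|<2}\int_{\mathbb{R}^{d-1}}(\psi(\xi_\alpha,\xi_d)|(\xi_\alpha,\xi_d)|^p+\rho(\xi_\alpha,\xi_d))\,d\xi_\alpha<+\infty$; and for every $\eta>0$ there is $r_\eta>0$ with $\sup_{|\xi_d|<2}\int_{\mathbb{R}^{d-1}\setminus B_{r_\eta}}(\psi(\xi_\alpha,\xi_d)|(\xi_\alpha,\xi_d)|^p+\rho(\xi_\alpha,\xi_d))\,d\xi_\alpha<\eta$.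 Under these assumptions the limit defining $f^\delta_{\rm hom}(M)$ exists; it is the density of the $\Gamma$-limit as $\varepsilon=\delta\gamma\to0$ of the nonlocal thin-film energies with density $f(x_\alpha/\varepsilon,x_d/\gamma,\xi,z)$. For $M\in\mathbb{R}^{m\times(d-1)}$: $\mathcal{D}^1_M(Q_R)=\{u\in L^p_{\rm loc}(\mathbb{R}^d;\mathbb{R}^m):u(x)=Mx_\alpha\text{ for a.e. }x\text{ with }\mathrm{dist}(x_\alpha,\mathbb{R}^{d-1}\setminus Q_R)<1\}$, and $\mathcal{D}^\#_M(Q_1)=\{u\in L^p_{\rm loc}(\mathbb{R}^d;\mathbb{R}^m):u(x)-Mx_\alpha\text{ is }Q_1\text{-periodic in }x_\alpha\}$ (i.e. invariant under translations by vectors of $\mathbb{Z}^{d-1}\times\{0\}$). *)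

(* Defs.v *)
From HB Require Import structures.
From mathcomp Require Import all_boot all_order all_algebra.
From mathcomp Require Import all_classical all_reals all_analysis.

Set Implicit Arguments.
Unset Strict Implicit.
Unset Printing Implicit Defensive.

Import Order.TTheory GRing.Theory Num.Theory.
Import numFieldNormedType.Exports.

Local Open Scope classical_set_scope.
Local Open Scope ring_scope.
Local Open Scope ereal_scope.

(* The product sigma-algebra on column vectors: for T = R this is the Borel
   sigma-algebra of R^n. *)

Definition measure_cV_display : measure_display -> measure_display.
Proof. exact. Qed.

Section measurable_cV.
Context {d} {T : sigmaRingType d}.
Variable n : nat.

Let coors : 'I_n -> 'cV[T]_n -> T := fun i x => x i ord0.

Let cV_set0 : g_sigma_preimage coors set0.
Proof. exact: sigma_algebra0. Qed.

Let cV_setC A : g_sigma_preimage coors A -> g_sigma_preimage coors (~` A).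
Proof. exact: sigma_algebraC. Qed.

Let cV_bigcup (F : _^nat) : (forall i, g_sigma_preimage coors (F i)) ->
  g_sigma_preimage coors (\bigcup_i (F i)).
Proof. exact: sigma_algebra_bigcup. Qed.

HB.instance Definition _ := @isMeasurable.Build (measure_cV_display d)
  'cV[T]_n (g_sigma_preimage coors) cV_set0 cV_setC cV_bigcup.

End measurable_cV.

Lemma measurable_coor d (T : sigmaRingType d) n (i : 'I_n) :
  measurable_fun [set: 'cV[T]_n] (fun x => x i ord0).
Proof.
move=> _ Y mY; rewrite setTI; apply: sub_sigma_algebra => /=.
rewrite -bigcup_seq/=; exists i => /=; first by rewrite mem_index_enum.
by exists Y => //; rewrite setTI.
Qed.

Lemma measurable_fun_cVP d d' (S : measurableType d) (T : measurableType d')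
    n (f : S -> 'cV[T]_n) :
  (forall i, measurable_fun setT (fun s => f s i ord0)) ->
  measurable_fun setT f.
Proof.
move=> mf; suff pref : g_sigma_preimage (fun i s => f s i ord0) `<=` measurable.
  move=> _ A mA; apply: pref; rewrite setTI.
  pose F := image_set_system setT f (g_sigma_preimage (fun i s => f s i ord0)).
  suff : F A by rewrite /F /image_set_system /= setTI.
  apply: mA; split; first exact/sigma_algebra_image/smallest_sigma_algebra.
  move=> B; rewrite -bigcup_seq => -[i _ [C mC <-]].
  rewrite /F /image_set_system /= !setTI; apply: sub_sigma_algebra.
  rewrite -bigcup_seq; exists i => /=; first by rewrite mem_index_enum.
  by exists C => //; rewrite setTI.
apply: smallest_sub; first exact: sigma_algebra_measurable.
by rewrite -bigcup_seq; apply: bigcup_sub => i _ A [B mB <-]; exact: mf.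
Qed.

(* [lebesgue_measure] lives on the alias [measurableTypeR R]; this is the same
   measure seen on the measurable type R itself, so that it can be combined
   with the algebraic and topological structures of R. *)

Definition leb1 {R : realType} : set R -> \bar R := @lebesgue_measure R.

HB.instance Definition _ (R : realType) :=
  isMeasure.Build _ _ _ (@leb1 R)
    (@measure0 _ _ _ (@lebesgue_measure R))
    (@measure_ge0 _ _ _ (@lebesgue_measure R))
    (@measure_semi_sigma_additive _ _ _ (@lebesgue_measure R)).

HB.instance Definition _ (R : realType) :=
  @Measure_isSigmaFinite.Build _ _ _ (@leb1 R)
    (@sigma_finiteT _ _ _ (@lebesgue_measure R)).

(* The instance of the library for products of sigma-finite measures is
   shadowed there by the one for subprobabilities. *)
Lemma sigma_finite_prod d1 d2 (T1 : measurableType d1) (T2 : measurableType d2)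
    (R : realType) (m1 : {sigma_finite_measure set T1 -> \bar R})
    (m2 : {sigma_finite_measure set T2 -> \bar R}) :
  sigma_finite setT (m1 \x m2).
Proof.
have /sigma_finiteP[F [TF ndF Foo]] := sigma_finiteT m1.
have /sigma_finiteP[G [TG ndG Goo]] := sigma_finiteT m2.
exists (fun n => F n `*` G n).
  rewrite -setXTT TF TG predeqE => -[x y]; split.
    move=> [/= [n _ Fnx] [k _ Gky]]; exists (maxn n k) => //; split.
    - by move: x Fnx; exact/subsetPset/ndF/leq_maxl.
    - by move: y Gky; exact/subsetPset/ndG/leq_maxr.
  by move=> [n _ []/= ? ?]; split; exists n.
move=> k; have [? ?] := Foo k; have [? ?] := Goo k.
split; first exact: measurableX.
by rewrite product_measure1E// lte_mul_pinfty// ge0_fin_numE.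
Qed.

(* Lebesgue measure on R^n, by induction on n: the image of the product
   measure on R^n x R under the identification of R^n x R with R^(n+1). *)

Section lebesgue_cV.
Context {R : realType}.

Definition cons_cV n (p : 'cV[R]_n * R) : 'cV[R]_n.+1 :=
  col_mx (const_mx p.2 : 'cV[R]_1) p.1.

Definition uncons_cV n (v : 'cV[R]_n.+1) : 'cV[R]_n * R :=
  (dsubmx (v : 'cV[R]_(1 + n)), v ord0 ord0).

Lemma cons_cVK n : cancel (@cons_cV n) (@uncons_cV n).
Proof.
case=> a t; rewrite /uncons_cV /cons_cV col_mxKd /=; congr (_, _).
have -> : (ord0 : 'I_n.+1) = lshift n (ord0 : 'I_1) by exact/val_inj.
by rewrite (@col_mxEu _ 1 n) mxE.
Qed.

Lemma measurable_cons_cV n : measurable_fun setT (@cons_cV n).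
Proof.
apply: measurable_fun_cVP => i; case: (@splitP 1 n i) => j ij.
  have -> : i = lshift n j by exact/val_inj.
  rewrite (_ : (fun _ => _) = snd); first exact: measurable_snd.
  by apply/funext => s; rewrite /cons_cV (@col_mxEu _ 1 n) mxE.
have -> : i = rshift 1 j by exact/val_inj.
rewrite (_ : (fun _ => _) = (fun x : 'cV[R]_n => x j ord0) \o fst).
  by apply: measurableT_comp; [exact: measurable_coor|exact: measurable_fst].
by apply/funext => s; rewrite /cons_cV /= (@col_mxEd _ 1 n).
Qed.

Lemma measurable_uncons_cV n : measurable_fun setT (@uncons_cV n).
Proof.
apply: measurable_fun_pair; last exact: measurable_coor.
apply: measurable_fun_cVP => i.
rewrite (_ : (fun _ => _) = (fun v : 'cV[R]_n.+1 => v (rshift 1 i) ord0)).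
  exact: measurable_coor.
by apply/funext => v; rewrite mxE.
Qed.

Section step.
Variables (n : nat) (mu : {sigma_finite_measure set 'cV[R]_n -> \bar R}).

Definition leb_step : set 'cV[R]_n.+1 -> \bar R :=
  pushforward (mu \x leb1) (@cons_cV n).

Let leb_step0 : leb_step set0 = 0.
Proof. by rewrite /leb_step /pushforward preimage_set0 measure0. Qed.

Let leb_step_ge0 A : 0 <= leb_step A.
Proof. by rewrite /leb_step /pushforward measure_ge0. Qed.

Let leb_step_sigma_additive : semi_sigma_additive leb_step.
Proof.
move=> F mF tF mUF; rewrite /leb_step /pushforward preimage_bigcup.
apply: measure_semi_sigma_additive.
- by move=> k; rewrite -[X in measurable X]setTI; exact: measurable_cons_cV.
- apply/trivIsetP => /= i j _ _ ij; rewrite -preimage_setI.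
  by move/trivIsetP : tF => /(_ _ _ _ _ ij) ->//; rewrite preimage_set0.
- rewrite -preimage_bigcup -[X in measurable X]setTI.
  exact: measurable_cons_cV.
Qed.

HB.instance Definition _ := isMeasure.Build _ _ _
  leb_step leb_step0 leb_step_ge0 leb_step_sigma_additive.

Let leb_step_sigma_finite : sigma_finite setT leb_step.
Proof.
have [F FT Foo] := sigma_finite_prod mu leb1.
exists (fun k => @uncons_cV n @^-1` F k).
  by rewrite -preimage_bigcup -FT preimage_setT.
move=> k; have [mF Fk] := Foo k; split.
  by rewrite -[X in measurable X]setTI; exact: measurable_uncons_cV.
rewrite /leb_step /pushforward -comp_preimage.
by rewrite (_ : _ \o _ = idfun)//; apply/funext => x /=; rewrite cons_cVK.
Qed.

HB.instance Definition _ :=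
  @Measure_isSigmaFinite.Build _ _ _ leb_step leb_step_sigma_finite.

End step.

Fixpoint leb n : {sigma_finite_measure set 'cV[R]_n -> \bar R} :=
  match n with
  | 0%N => dirac (0%R : 'cV[R]_0)
  | n'.+1 => leb_step (leb n')
  end.

End lebesgue_cV.

(* R^d is represented as R^(d-1) x R, with x = (x_alpha, x_d) = (x.1, x.2). *)
Notation Rd R d := ('cV[R]_d.-1 * Real.sort R)%type (only parsing).

Section space.
Context {R : realType} {d : nat}.

Definition vol : set (Rd R d) -> \bar R := leb d.-1 \x leb1.

HB.instance Definition _ := Measure.on vol.

HB.instance Definition _ :=
  @Measure_isSigmaFinite.Build _ _ _ vol (sigma_finite_prod (leb d.-1) leb1).

(* Euclidean norms: the library norms on matrices and products are sup norms. *)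
Definition enorm n (y : 'cV[R]_n) : R := Num.sqrt (\sum_i y i ord0 ^+ 2).

Definition enormd (x : Rd R d) : R :=
  Num.sqrt (\sum_i x.1 i ord0 ^+ 2 + x.2 ^+ 2).

Definition eucl_dist n (y : 'cV[R]_n) (A : set 'cV[R]_n) : R :=
  inf [set enorm (y - z)%R | z in A].

Definition eball n (r : R) : set 'cV[R]_n := [set y | enorm y < r]%R.

Definition cyl (r : R) : set (Rd R d) := eball r `*` [set` `]- r, r[%R].

Definition cube n (L : R) : set 'cV[R]_n :=
  [set y | forall i, 0 < y i ord0 < L]%R.

Definition II : set R := [set` `]- 1, 1[%R].

Definition pshift (delta : R) (xi x : Rd R d) : Rd R d :=
  (x.1 + xi.1, x.2 + delta * xi.2)%R.

(* (Q_L x I)_{1,delta}(xi) *)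
Definition int1 (delta L : R) (xi : Rd R d) : set (Rd R d) :=
  [set x | (cube L `*` II) x /\ (cube L `*` II) (pshift delta xi x)].

Definition Idelta (delta t : R) : set R :=
  [set s | II s /\ II (s + delta * t)%R].

Section energies.
Context {m : nat}.

Definition Lploc (p : R) (u : Rd R d -> 'cV[R]_m) : Prop :=
  measurable_fun setT u /\
  forall K : set (Rd R d), compact K ->
    \int[vol]_(x in K) (enorm (u x) `^ p)%:E < +oo.

(* Elements of L^p_loc are represented by Borel functions, hence the "almost
   everywhere" in the two classes below: both are invariant under modification
   on a null set. *)
Definition D1 (p : R) (M : 'M[R]_(m, d.-1)) (L : R) : set (Rd R d -> 'cV[R]_m) :=
  [set u | Lploc p u /\
    {ae vol, forall x, (eucl_dist x.1 (~` cube L) < 1)%R -> u x = M *m x.1}].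

Definition Dper (p : R) (M : 'M[R]_(m, d.-1)) : set (Rd R d -> 'cV[R]_m) :=
  [set u | Lploc p u /\
    forall k : 'cV[int]_d.-1,
      let y (x : Rd R d) : Rd R d := (x.1 + map_mx intr k, x.2)%R in
      {ae vol, forall x, (u (y x) - M *m (y x).1 = u x - M *m x.1)%R}].

Definition energy (f : Rd R d -> Rd R d -> 'cV[R]_m -> R) (delta : R)
    (D : Rd R d -> set (Rd R d)) (v : Rd R d -> 'cV[R]_m) : \bar R :=
  (Num.max delta 1)%:E *
  \int[vol]_xi \int[vol]_(x in D xi) (f x xi (v (pshift delta xi x) - v x)%R)%:E.

Definition fhom_approx f (delta p : R) (M : 'M[R]_(m, d.-1)) (L : R) : \bar R :=
  (L ^- d.-1)%:E *
  ereal_inf [set energy f delta (int1 delta L) v | v in D1 p M L].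

(* [lim] is total: a statement about [fhom] is meaningful only together with
   the convergence of [fhom_approx]. *)
Definition fhom f (delta p : R) (M : 'M[R]_(m, d.-1)) : \bar R :=
  lim (fhom_approx f delta p M L @[L --> +oo%R]).

End energies.
End space.

(* Main.v *)
Require Import Defs.
From mathcomp Require Import all_boot all_order all_algebra.
From mathcomp Require Import all_classical all_reals all_analysis measurable_realfun.
From mathcomp Require Import ring lra.

Set Implicit Arguments.
Unset Strict Implicit.
Unset Printing Implicit Defensive.

Import Order.TTheory GRing.Theory Num.Theory.
Import numFieldNormedType.Exports.

Local Open Scope classical_set_scope.
Local Open Scope ring_scope.

(** Let [n = d - 1], and let [L] be the side of a large cube, [N - 1 < L <= N].
    Both sides of the formula are compared through the integer translations.
    By the periodicity of [f], the energy of [v] on the cube of side [L], divided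
    by [N ^ n], is the integral over one unit cell and over all the directions
    [xi] of the mean over the [N ^ n] integer vectors [k] of

      f (x, xi, v (x + k + xi) - v (x + k)),

    restricted to those [k] for which both ends of the pair are in the cube. For
    a fixed [xi] the proportion of the other [k] is at most [badfrac N xi], which
    is at most 1 and tends to 0 like [(1 + |xi|) / N] ([bad_fraction]). Since
    [theta xi = psi xi |xi| ^ p + rho xi] is integrable, dominated convergence
    makes every contribution of the boundary vanish in the limit.

    Upper bound ([truncated_energy_le]). A periodic competitor [M x + w] becomes
    admissible on the cube after multiplying [w] by a Lipschitz cut-off function
    that vanishes in the layer of width 1. Translated pairs away from the boundary
    see [M x + w] itself; for the others the energy density is bounded by an
    integrable function of [x] and [xi] that does not depend on [k].

    Lower bound ([lower_bound]). Given an admissible [v], its deviation from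
    [M x] is extended to an [N]-periodic function [W] ([wper]). Averaging the
    translates of [W] by the integer points of a period gives a 1-periodic
    function, hence a periodic competitor [uavg], and by Jensen's inequality its
    density is at most the mean of the densities of the translates. In the
    pairs that leave the cube the increment of [W] does not come from [v]. It is
    removed, and [convex_perturb] bounds the error by a small multiple of the
    energy plus a large multiple of [psi xi] times the power [p] of the mean of
    the removed increments. As they occupy a small proportion of the [k], this
    power is at most [badfrac N xi ^ (p - 1)] times the mean of the powers.
    There are no removed increments when [|xi| < 1], because of the layer of
    width 1. For the long directions, in which [psi] may vanish, the energy of
    the increments of [W] along [xi] is at most a constant times [|xi| ^ p]
    times the energy of its short increments ([incr_energy_growth]): [xi] is
    divided into about [|xi|] short steps, and each step is averaged over the
    intermediate points. Where [psi] is bounded below, the short increments are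
    controlled by the energy ([short_bound]). The total error contains the
    integral of [badfrac N ^ (p - 1) * theta], which tends to 0 since [p > 1]. *)

(** * Sums of absolute values, powers and Jensen's inequality *)

Section sum_norm.
Context {R : realType}.

(** The l1 norm: equivalent to the Euclidean norm, but a plain sum over the
    coordinates, so that the estimates below are coordinatewise. *)
Definition snorm m (z : 'cV[R]_m) : R := \sum_i `|z i ord0|.

Lemma snorm_ge0 m (z : 'cV[R]_m) : 0 <= snorm z.
Proof. exact: sumr_ge0. Qed.

Lemma snorm0 m : snorm (0 : 'cV[R]_m) = 0.
Proof. by rewrite /snorm big1// => i _; rewrite mxE normr0. Qed.

Lemma snormD m (y z : 'cV[R]_m) : snorm (y + z) <= snorm y + snorm z.
Proof.
rewrite /snorm -big_split/=; apply: ler_sum => i _; rewrite mxE.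
exact: ler_normD.
Qed.

Lemma snormZ m (a : R) (z : 'cV[R]_m) : snorm (a *: z) = `|a| * snorm z.
Proof.
by rewrite /snorm mulr_sumr; apply: eq_bigr => i _; rewrite mxE normrM.
Qed.

Lemma snormN m (z : 'cV[R]_m) : snorm (- z) = snorm z.
Proof. by rewrite -scaleN1r snormZ normrN1 mul1r. Qed.

Lemma snorm_le_addl m (a b : 'cV[R]_m) : snorm b <= snorm (a + b) + snorm a.
Proof. by rewrite -{1}(addKr a b) (le_trans (snormD _ _))// snormN addrC. Qed.

Lemma snorm_sum m I (s : seq I) (P : pred I) (F : I -> 'cV[R]_m) :
  snorm (\sum_(i <- s | P i) F i) <= \sum_(i <- s | P i) snorm (F i).
Proof.
elim/big_ind2 : _ => [|x1 x2 y1 y2 h1 h2|//]; first by rewrite snorm0.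
by rewrite (le_trans (snormD _ _))// lerD.
Qed.

Lemma snorm_ge m (z : 'cV[R]_m) i : `|z i ord0| <= snorm z.
Proof. by rewrite /snorm (bigD1 i)//= lerDl sumr_ge0. Qed.

Lemma snorm_mulmx k m (M : 'M[R]_(k, m)) (y : 'cV[R]_m) :
  snorm (M *m y) <= (\sum_i \sum_j `|M i j|) * snorm y.
Proof.
rewrite {1}/snorm mulr_suml; apply: ler_sum => i _.
rewrite mxE (le_trans (ler_norm_sum _ _ _))// mulr_suml; apply: ler_sum => j _.
by rewrite normrM ler_wpM2l// snorm_ge.
Qed.

Lemma sqr_sum_le m (F : 'I_m -> R) : (forall i, 0 <= F i) ->
  \sum_i F i ^+ 2 <= (\sum_i F i) ^+ 2.
Proof.
move=> F0; rewrite [leRHS]expr2 mulr_suml; apply: ler_sum => i _.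
by rewrite expr2 ler_wpM2l// (bigD1 i)//= lerDl sumr_ge0.
Qed.

Lemma enorm_ge0 m (z : 'cV[R]_m) : 0 <= enorm z.
Proof. exact: sqrtr_ge0. Qed.

Lemma enorm_le_snorm m (z : 'cV[R]_m) : enorm z <= snorm z.
Proof.
rewrite /enorm -[leRHS]ger0_norm ?snorm_ge0// -sqrtr_sqr.
rewrite ler_sqrt ?sqr_ge0// (le_trans _ (sqr_sum_le _))//.
by rewrite ler_sum// => i _; rewrite -normrX ger0_norm ?sqr_ge0.
Qed.

Lemma enorm_ge m (z : 'cV[R]_m) i : `|z i ord0| <= enorm z.
Proof.
rewrite -sqrtr_sqr ler_sqrt ?sumr_ge0// => [|j _]; last exact: sqr_ge0.
by rewrite (bigD1 i)//= lerDl sumr_ge0// => j _; exact: sqr_ge0.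
Qed.

Lemma snorm_le_enorm m (z : 'cV[R]_m) : snorm z <= m%:R * enorm z.
Proof.
rewrite (le_trans (ler_sum _ (fun i _ => enorm_ge z i)))//.
by rewrite sumr_const card_ord mulr_natl.
Qed.

Definition xnorm d (xi : Rd R d) : R := snorm xi.1 + `|xi.2|.

Lemma xnorm_ge0 d (xi : Rd R d) : 0 <= xnorm xi.
Proof. by rewrite addr_ge0// snorm_ge0. Qed.

Lemma xnorm_le_enormd d (xi : Rd R d) : xnorm xi <= (d.-1 + 1)%:R * enormd xi.
Proof.
have s0 : 0 <= \sum_i xi.1 i ord0 ^+ 2 by apply: sumr_ge0 => i _; exact: sqr_ge0.
rewrite natrD mulrDl lerD//.
  rewrite (le_trans (snorm_le_enorm _))// ler_wpM2l// ler_sqrt ?addr_ge0 ?sqr_ge0//.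
  by rewrite lerDl sqr_ge0.
by rewrite mul1r -sqrtr_sqr ler_sqrt ?addr_ge0 ?sqr_ge0// lerDr.
Qed.

Lemma snorm_le_xnorm d (xi : Rd R d) : snorm xi.1 <= xnorm xi.
Proof. by rewrite lerDl. Qed.

End sum_norm.

Section jensen.
Context {R : realType}.

(** Induction on the number of points: the mean of k + 1 points is the convex
    combination, with weight 1 / (k + 1), of one of them and the mean of the
    others. The domain [D] covers the power functions, convex only on the
    nonnegative reals. *)
Lemma uniform_jensen (E : lmodType R) (D : set E) (f : E -> R) :
  (forall t x y, 0 <= t <= 1 -> D x -> D y ->
     D (t *: x + (1 - t) *: y) /\
     f (t *: x + (1 - t) *: y) <= t * f x + (1 - t) * f y) ->
  forall I (z : I -> E) (s : seq I), (0 < size s)%N -> (forall i, D (z i)) ->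
    D ((size s)%:R^-1 *: \sum_(i <- s) z i) /\
    f ((size s)%:R^-1 *: \sum_(i <- s) z i)
      <= (size s)%:R^-1 * \sum_(i <- s) f (z i).
Proof.
move=> cf I z s + Dz; elim: s => [//|i [|j s] IH] _.
  by rewrite !big_seq1/= invr1 scale1r mul1r.
have {IH}[//|IH1 IH2] := IH.
set S := j :: s in IH1 IH2 *; set k := size S in IH1 IH2 *.
have k0 : (0 : R) < k%:R by rewrite ltr0n.
have k10 : (0 : R) < k.+1%:R by rewrite ltr0n.
rewrite -[size (i :: S)]/k.+1.
pose t : R := k.+1%:R^-1.
have t01 : 0 <= t <= 1.
  by rewrite invr_ge0 ler0n/= invf_le1// ler1n.
have t1 : 1 - t = k%:R / k.+1%:R.
  by rewrite /t -[k.+1%:R]natr1; field; rewrite natr1 gt_eqF.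
have tk : (1 - t) * k%:R^-1 = t.
  by rewrite t1 /t; field; rewrite addrC natr1 !gt_eqF.
have E1 : t *: (\sum_(l <- i :: S) z l) =
    t *: z i + (1 - t) *: (k%:R^-1 *: \sum_(l <- S) z l).
  by rewrite big_cons scalerDr scalerA tk.
have [h1 h2] := cf t _ _ t01 (Dz i) IH1.
rewrite -/t E1; split => //; rewrite (le_trans h2)//.
rewrite [in leRHS]big_cons mulrDr lerD2l.
by rewrite -{2}tk -mulrA ler_wpM2l// t1 divr_ge0// ltW.
Qed.

Lemma convex_functionE (E : lmodType R) (f : E -> R) :
  convex_function (setT : set E) f ->
  forall t x y, 0 <= t <= 1 ->
    f (t *: x + (1 - t) *: y) <= t * f x + (1 - t) * f y.
Proof.
move=> cf t x y /andP[t0 t1].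
have := cf (Itv01 t0 t1) x y; rewrite !inE => /(_ Logic.I Logic.I).
by rewrite /conv/=.
Qed.

Lemma jensen_avg (E : lmodType R) (f : E -> R) (I : finType) (z : I -> E) :
  convex_function (setT : set E) f -> (0 < #|I|)%N ->
  f (#|I|%:R^-1 *: \sum_i z i) <= #|I|%:R^-1 * \sum_i f (z i).
Proof.
move=> cf I0.
have := @uniform_jensen E setT f _ I z (index_enum I).
rewrite /index_enum -enumT -cardE => /(_ _ I0)[]//.
by move=> t x y t01 _ _; split => //; exact: convex_functionE.
Qed.

(** Jensen's inequality for the power [p], with the factor 1 / size moved to the
    right-hand side. *)
Lemma powR_sum_le (p : R) (I : Type) (s : seq I) (t : I -> R) :
  1 <= p -> (forall i, 0 <= t i) ->
  (\sum_(i <- s) t i) `^ p <= (size s)%:R `^ (p - 1) * \sum_(i <- s) t i `^ p.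
Proof.
move=> p1 t0; have p0 : p != 0 by rewrite gt_eqF// (lt_le_trans _ p1).
have [/eqP/nilP->|s0] := posnP (size s).
  by rewrite !big_nil mulr0 powR0.
have := @uniform_jensen R^o [set x | 0 <= x] (@powR R ^~ p) _ I t s s0 t0.
case => [a x y /andP[a0 a1] /= x0 y0|_ h].
  split; first by rewrite addr_ge0// mulr_ge0// subr_ge0.
  have xP : (x : R) \in `[0, +oo[%classic by rewrite inE/= in_itv/= andbT.
  have yP : (y : R) \in `[0, +oo[%classic by rewrite inE/= in_itv/= andbT.
  exact: (convex_powR p1 (Itv01 a0 a1) xP yP).
have k0 : (0 : R) < (size s)%:R by rewrite ltr0n.
have kV : (size s)%:R^-1 = (size s)%:R `^ (-1) :> R by rewrite powR_inv1// ltW.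
have kp : (size s)%:R^-1 `^ p = ((size s)%:R `^ p)^-1 :> R.
  by rewrite kV -powRrM mulN1r powRN.
have S0 : 0 <= \sum_(i <- s) t i by exact: sumr_ge0.
have kV0 : 0 <= (size s)%:R^-1 :> R by rewrite invr_ge0 ltW.
move: h; rewrite /GRing.scale/= powRM// kp ler_pdivrMl ?powR_gt0// mulrA.
by rewrite kV -powRD// (gt_eqF k0) implybT.
Qed.

Lemma powRD_le (p a b : R) : 1 <= p -> 0 <= a -> 0 <= b ->
  (a + b) `^ p <= 2 `^ p * (a `^ p + b `^ p).
Proof.
move=> p1 a0 b0.
have /= := @powR_sum_le p bool [:: true; false] (fun i => if i then a else b) p1.
rewrite !big_cons !big_nil !addr0 => /(_ _)/le_trans; apply.
  by case.
apply: ler_wpM2r; first by rewrite addr_ge0 ?powR_ge0.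
by apply: ler_powR; rewrite ?ler1n// gerBl.
Qed.

Lemma powRD3_le (p a b c : R) : 1 <= p -> 0 <= a -> 0 <= b -> 0 <= c ->
  (a + b + c) `^ p <= 4 `^ p * (a `^ p + b `^ p + c `^ p).
Proof.
move=> p1 a0 b0 c0.
have p0 : 0 <= p by rewrite (le_trans _ p1).
have h2 : 1 <= 2 `^ p :> R.
  have h : 1 <= 2 :> R by rewrite ler1n.
  by have := ler_powR h p0; rewrite powRr0.
have -> : (4 : R) = 2 * 2 by rewrite -natrM.
rewrite powRM//.
apply: (le_trans (powRD_le p1 (addr_ge0 a0 b0) c0)); rewrite -mulrA.
apply: ler_wpM2l; first exact: powR_ge0.
by rewrite [leRHS]mulrDr lerD ?powRD_le// ler_peMl ?powR_ge0.
Qed.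

Lemma le_powR (p a b : R) : 0 <= p -> 0 <= a -> a <= b -> a `^ p <= b `^ p.
Proof.
by move=> p0 a0 ab; rewrite ge0_ler_powR// nnegrE// (le_trans a0).
Qed.

End jensen.

(** * Measurability and translation invariance on column vectors *)

Section measurability.
Context {R : realType} d (T : measurableType d).

Lemma measurable_cV_coor m (F : T -> 'cV[R]_m) i :
  measurable_fun setT F -> measurable_fun setT (fun t => F t i ord0).
Proof.
by move=> mF; apply: (@measurableT_comp _ _ _ _ _ _ (fun z : 'cV[R]_m => z i ord0));
  [exact: measurable_coor|].
Qed.

Lemma measurable_fsum (I : Type) (s : seq I) (F : I -> T -> R) :
  (forall i, measurable_fun setT (F i)) ->
  measurable_fun setT (fun t => \sum_(i <- s) F i t).
Proof.
move=> mF; elim: s => [|i s IH].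
  by under eq_fun do rewrite big_nil; exact: measurable_cst.
by under eq_fun do rewrite big_cons; exact: measurable_funD.
Qed.

Lemma measurable_cVD m (F G : T -> 'cV[R]_m) :
  measurable_fun setT F -> measurable_fun setT G ->
  measurable_fun setT (fun t => F t + G t).
Proof.
move=> mF mG; apply: measurable_fun_cVP => i.
under eq_fun do rewrite mxE.
by apply: measurable_funD; exact: measurable_cV_coor.
Qed.

Lemma measurable_cVZ m (a : T -> R) (F : T -> 'cV[R]_m) :
  measurable_fun setT a -> measurable_fun setT F ->
  measurable_fun setT (fun t => a t *: F t).
Proof.
move=> ma mF; apply: measurable_fun_cVP => i.
under eq_fun do rewrite mxE.
by apply: measurable_funM => //; exact: measurable_cV_coor.
Qed.

Lemma measurable_cVB m (F G : T -> 'cV[R]_m) :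
  measurable_fun setT F -> measurable_fun setT G ->
  measurable_fun setT (fun t => F t - G t).
Proof.
move=> mF mG; apply: measurable_fun_cVP => i.
under eq_fun do rewrite !mxE.
by apply: measurable_funB; exact: measurable_cV_coor.
Qed.

Lemma measurable_cV_sum m (I : Type) (s : seq I) (F : I -> T -> 'cV[R]_m) :
  (forall i, measurable_fun setT (F i)) ->
  measurable_fun setT (fun t => \sum_(i <- s) F i t).
Proof.
move=> mF; apply: measurable_fun_cVP => i.
under eq_fun do rewrite summxE.
by apply: measurable_fsum => j; exact: measurable_cV_coor.
Qed.

Lemma measurable_mulmx k m (M : 'M[R]_(k, m)) (F : T -> 'cV[R]_m) :
  measurable_fun setT F -> measurable_fun setT (fun t => M *m F t).
Proof.
move=> mF; apply: measurable_fun_cVP => i.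
under eq_fun do rewrite mxE.
apply: measurable_fsum => j; apply: measurable_funM => //.
exact: measurable_cV_coor.
Qed.

Lemma measurable_snorm m (F : T -> 'cV[R]_m) :
  measurable_fun setT F -> measurable_fun setT (fun t => snorm (F t)).
Proof.
move=> mF; apply: measurable_fsum => j; apply: measurableT_comp => //.
exact: measurable_cV_coor.
Qed.

Lemma measurable_enorm m (F : T -> 'cV[R]_m) :
  measurable_fun setT F -> measurable_fun setT (fun t => enorm (F t)).
Proof.
move=> mF; rewrite /enorm.
have ms : measurable_fun setT (@Num.sqrt R).
  by apply: continuous_measurable_fun; exact: sqrt_continuous.
apply: (measurableT_comp ms).
apply: measurable_fsum => j; apply: measurable_funX.
exact: measurable_cV_coor.
Qed.

Lemma measurable_powRT (F : T -> R) (p : R) :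
  measurable_fun setT F -> measurable_fun setT (fun t => F t `^ p).
Proof. by move=> mF; apply: (measurableT_comp (measurable_powR p)). Qed.

Lemma measurable_indicT d' (T' : measurableType d') (F : T -> T') (A : set T') :
  measurable A ->
  measurable_fun setT F -> measurable_fun setT (fun t => \1_A (F t) : R).
Proof. by move=> mA mF; apply: (measurableT_comp _ mF); exact/measurable_indic. Qed.

End measurability.

Section translation.
Context {R : realType}.
Local Open Scope ereal_scope.

Lemma ge0_integral_invariant d (T : measurableType d) (mu : {measure set T -> \bar R})
    (phi : T -> T) : measurable_fun setT phi ->
  (forall A, measurable A -> mu (phi @^-1` A) = mu A) ->
  forall g : T -> \bar R, measurable_fun setT g -> (forall x, 0 <= g x) ->
  \int[mu]_x g (phi x) = \int[mu]_x g x.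
Proof.
move=> mphi inv g mg g0.
have := ge0_integral_pushforward mphi mu measurableT mg (fun x _ => g0 x).
rewrite preimage_setT => <-.
by apply: eq_measure_integral => //= A mA _; rewrite -[RHS]inv.
Qed.

Lemma measurable_integral2 d1 d2 (T1 : measurableType d1) (T2 : measurableType d2)
    (m2 : {sigma_finite_measure set T2 -> \bar R}) (f : T1 * T2 -> \bar R) :
  measurable_fun setT f -> (forall z, 0 <= f z) ->
  measurable_fun setT (fun x => \int[m2]_y f (x, y)).
Proof. by move=> mf f0; apply: measurable_fun_fubini_tonelli_F. Qed.

Lemma leb1_shift (a : R) (A : set R) : measurable A ->
  leb1 ((fun t => t + a)%R @^-1` A) = leb1 A.
Proof.
move=> mA.
have mphi : measurable_fun setT ((fun t => t + a)%R : R -> R).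
  exact: measurable_funD.
suff : pushforward lebesgue_measure ((fun t => t + a)%R : _ -> measurableTypeR R) A =
  lebesgue_measure A by [].
apply/esym/lebesgue_measure_unique => //= _ [[x y]] _ <-.
rewrite /pushforward.
have -> : (fun t => t + a)%R @^-1` `]x, y]%classic = `](x - a)%R, (y - a)%R]%classic.
  by apply/seteqP; split => t /=; rewrite !in_itv/= ltrBlDr lerBrDr.
rewrite !lebesgue_measure_itv/= !lte_fin ltrD2r.
by case: ifPn => // _; congr (_%:E); ring.
Qed.

Lemma measurable_fun_shift n (a : 'cV[R]_n) : measurable_fun setT (fun x : 'cV[R]_n => x + a)%R.
Proof. by apply: measurable_cVD => //; exact: measurable_cst. Qed.

Lemma integral_leb1_shift (a : R) (g : R -> \bar R) :
  measurable_fun setT g -> (forall x, 0 <= g x) ->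
  \int[leb1]_t g (t + a)%R = \int[leb1]_t g t.
Proof.
apply: ge0_integral_invariant; first exact: measurable_funD.
exact: leb1_shift.
Qed.

Lemma integral_leb_step n (g : 'cV[R]_n.+1 -> \bar R) :
  measurable_fun setT g -> (forall x, 0 <= g x) ->
  \int[leb n.+1]_x g x = \int[leb n]_x \int[leb1]_t g (cons_cV (x, t)).
Proof.
move=> mg g0.
rewrite [LHS](ge0_integral_pushforward (@measurable_cons_cV R n) (leb n \x leb1) measurableT mg (fun x _ => g0 x)).
rewrite preimage_setT fubini_tonelli1//.
  by apply: (measurableT_comp mg (@measurable_cons_cV R n)).
by move=> x; exact: g0.
Qed.

(** Induction on the dimension: a translation acts separately on the coordinate
    added by [leb_step] and on the others. *)
Lemma integral_leb_shift n (a : 'cV[R]_n) (g : 'cV[R]_n -> \bar R) :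
  measurable_fun setT g -> (forall x, 0 <= g x) ->
  \int[leb n]_x g (x + a)%R = \int[leb n]_x g x.
Proof.
elim: n a g => [|n IH] a g mg g0.
  by apply: eq_integral => x _; congr g; apply/matrixP => -[].
have mgc : measurable_fun setT (fun z => g (@cons_cV R n z)).
  exact: (measurableT_comp mg (@measurable_cons_cV R n)).
rewrite !integral_leb_step//; last first.
  exact: (measurableT_comp mg (@measurable_fun_shift n.+1 a)).
have e x t : (cons_cV (x, t) + a)%R =
    cons_cV ((x + (uncons_cV a).1)%R, (t + (uncons_cV a).2)%R).
  apply/matrixP => i j; rewrite (ord1 j) /cons_cV/= mxE; case: (@splitP 1 n i) => k ik.
    have -> : i = lshift n k by exact/val_inj.
    by rewrite !(@col_mxEu _ 1 n) !mxE; congr (_ + a _ _)%R; apply/val_inj; rewrite /= (ord1 k).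
  have -> : i = rshift 1 k by exact/val_inj.
  by rewrite !(@col_mxEd _ 1 n) !mxE.
transitivity (\int[leb n]_x \int[leb1]_t g (cons_cV ((x + (uncons_cV a).1)%R, t))).
  apply: eq_integral => x _.
  rewrite -[RHS](integral_leb1_shift (uncons_cV a).2)//.
    by apply: eq_integral => t _; rewrite e.
  exact: (measurableT_comp mgc (measurable_pair1 _)).
rewrite (IH (uncons_cV a).1 (fun x => \int[leb1]_t g (cons_cV (x, t))))//.
  by apply: (@measurable_integral2 _ _ _ _ leb1 _ mgc) => z.
by move=> x; exact: integral_ge0.
Qed.

End translation.

Section vol.
Context {R : realType} {d : nat}.
Local Open Scope ereal_scope.
Notation X := (Rd R d).

Lemma integral_volE (g : X -> \bar R) :
  measurable_fun setT g -> (forall x, 0 <= g x) ->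
  \int[vol]_x g x = \int[leb d.-1]_y \int[leb1]_t g (y, t).
Proof. by move=> mg g0; rewrite /vol fubini_tonelli1. Qed.

Lemma measurable_xD d' (T : measurableType d') (F G : T -> X) :
  measurable_fun setT F -> measurable_fun setT G ->
  measurable_fun setT (fun t => (F t + G t)%R : X).
Proof.
move=> mF mG; apply: measurable_fun_pair => /=.
  by apply: measurable_cVD; exact: measurableT_comp.
by apply: measurable_funD; exact: measurableT_comp.
Qed.

Lemma integral_vol_shift (a : X) (g : X -> \bar R) :
  measurable_fun setT g -> (forall x, 0 <= g x) ->
  \int[vol]_x g (x + a)%R = \int[vol]_x g x.
Proof.
move=> mg g0; rewrite !integral_volE//; last first.
  by apply: (measurableT_comp mg); apply: measurable_xD => //; exact: measurable_cst.
transitivity (\int[leb d.-1]_y \int[leb1]_t g ((y + a.1)%R, t)).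
  apply: eq_integral => y _.
  rewrite -[RHS](integral_leb1_shift a.2)//.
  exact: (measurableT_comp mg (measurable_pair1 _)).
rewrite (integral_leb_shift a.1 (g := fun y => \int[leb1]_t g (y, t)))//.
  exact: (@measurable_integral2 R _ _ _ _ leb1 g mg).
by move=> y; exact: integral_ge0.
Qed.

End vol.

(** * Integrals over tilings and of periodic functions *)

Section indic.
Context {R : realType} {T : Type}.
Implicit Types A : set T.

Lemma indic_in A x : A x -> \1_A x = 1 :> R.
Proof. by move=> Ax; rewrite indicE mem_set. Qed.

Lemma indic_out A x : ~ A x -> \1_A x = 0 :> R.
Proof. by move=> Ax; rewrite indicE memNset. Qed.

Lemma indic_ge0 A x : 0 <= \1_A x :> R.
Proof. by rewrite indicE ler0n. Qed.

Lemma indic_le1 A x : \1_A x <= 1 :> R.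
Proof. by rewrite indicE lern1 leq_b1. Qed.

End indic.

Lemma le_indic {R : realType} T T' (A : set T) (B : set T') x y : (A x -> B y) -> \1_A x <= \1_B y :> R.
Proof.
move=> AB; have [Ax|Ax] := pselect (A x); last by rewrite (indic_out Ax) indic_ge0.
by rewrite (indic_in Ax) (indic_in (AB Ax)).
Qed.

Section EFin_integral.
Context d (T : measurableType d) (R : realType) (mu : {measure set T -> \bar R}).
Implicit Types f g : T -> R.

Lemma ge0_integral_EFinD f g :
  measurable_fun setT f -> measurable_fun setT g ->
  (forall x, 0 <= f x) -> (forall x, 0 <= g x) ->
  (\int[mu]_x (f x + g x)%:E = \int[mu]_x (f x)%:E + \int[mu]_x (g x)%:E)%E.
Proof.
move=> mf mg f0 g0; rewrite -ge0_integralD//.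
- by move=> x _; rewrite lee_fin.
- exact/measurable_EFinP.
- by move=> x _; rewrite lee_fin.
- exact/measurable_EFinP.
Qed.

Lemma ge0_integral_EFin_sum (I : Type) (s : seq I) (F : I -> T -> R) :
  (forall i, measurable_fun setT (F i)) -> (forall i x, 0 <= F i x) ->
  (\int[mu]_x (\sum_(i <- s) F i x)%:E = \sum_(i <- s) \int[mu]_x (F i x)%:E)%E.
Proof.
move=> mF F0; under eq_integral do rewrite -sumEFin.
rewrite ge0_integral_sum//.
- by move=> i; exact/measurable_EFinP.
- by move=> i x _; rewrite lee_fin.
Qed.

Lemma ge0_integral_EFinZ f (c : R) :
  measurable_fun setT f -> (forall x, 0 <= f x) -> 0 <= c ->
  (\int[mu]_x (c * f x)%:E = c%:E * \int[mu]_x (f x)%:E)%E.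
Proof.
move=> mf f0 c0; under eq_integral do rewrite EFinM.
rewrite ge0_integralZl_EFin//.
- by move=> x _; rewrite lee_fin.
- exact/measurable_EFinP.
Qed.

Lemma ge0_le_integral_EFin f g :
  measurable_fun setT f -> measurable_fun setT g ->
  (forall x, 0 <= f x) -> (forall x, f x <= g x) ->
  (\int[mu]_x (f x)%:E <= \int[mu]_x (g x)%:E)%E.
Proof.
move=> mf mg f0 fg; apply: ge0_le_integral => //.
- by move=> x _; rewrite lee_fin.
- exact/measurable_EFinP.
- exact/measurable_EFinP.
- by move=> x _; rewrite lee_fin.
Qed.

Lemma integral_EFin_ge0 f : (forall x, 0 <= f x) ->
  (0 <= \int[mu]_x (f x)%:E)%E.
Proof. by move=> f0; apply: integral_ge0 => x _; rewrite lee_fin. Qed.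

Lemma integral_indicM (D : set T) f : measurable D ->
  (\int[mu]_(x in D) (f x)%:E = \int[mu]_x (\1_D x * f x)%:E)%E.
Proof.
move=> mD; rewrite integral_mkcond; apply: eq_integral => x _.
rewrite patchE indicE; case: ifPn => _; first by rewrite mul1r.
by rewrite mul0r.
Qed.

End EFin_integral.

Section boxes.
Context {R : realType}.

(** Half-open boxes tile the space exactly, whereas open cubes do so only up to
    null sets. *)
Definition Hc n (P : R) : set 'cV[R]_n := [set y | forall i, 0 <= y i ord0 < P].

Definition vecn q n (k : {ffun 'I_n -> 'I_q}) : 'cV[R]_n := \col_i (k i)%:R.

Lemma measurable_cVbox n (A : 'I_n -> set R) : (forall i, measurable (A i)) ->
  measurable [set y : 'cV[R]_n | forall i, A i (y i ord0)].
Proof.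
move=> mA.
have -> : [set y : 'cV[R]_n | forall i, A i (y i ord0)] =
    \bigcap_(i in setT) ((fun y : 'cV[R]_n => y i ord0) @^-1` A i).
  by apply/seteqP; split => [y Ay i _|y Ay i]; [exact: Ay|exact: (Ay i Logic.I)].
apply: fin_bigcap_measurable; first exact: finite_finset.
move=> i _; rewrite -[X in measurable X]setTI.
by apply: measurable_coor => //; exact: mA.
Qed.

Lemma measurable_Hc n (P : R) : measurable (@Hc n P).
Proof.
have := @measurable_cVbox n (fun=> [set` `[0, P[]) (fun=> measurable_itv _).
congr measurable; apply/seteqP; split => y /= h i; have := h i; rewrite in_itv//.
Qed.

Lemma measurable_cube n (P : R) : measurable (cube P : set 'cV[R]_n).
Proof.
have := @measurable_cVbox n (fun=> [set` `]0, P[]) (fun=> measurable_itv _).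
congr measurable; apply/seteqP; split => y /= h i; have := h i; rewrite in_itv//.
Qed.

Lemma cube_Hc n (P : R) : cube P `<=` @Hc n P.
Proof. by move=> y h i; have /andP[/ltW -> ->] := h i. Qed.

(** In each coordinate the only index for which the indicator does not vanish is
    the integer part of [y i ord0 / P]. *)
Lemma tile n q (P : R) (y : 'cV[R]_n) : 0 < P ->
  \sum_(k : {ffun 'I_n -> 'I_q}) \1_(Hc P) (y - P *: vecn k) =
  \1_(Hc (q%:R * P)) y :> R.
Proof.
move=> P0.
have Hk (k : {ffun 'I_n -> 'I_q}) : Hc P (y - P *: vecn k) ->
    forall i, (k i)%:R <= y i ord0 / P < (k i).+1%:R.
  move=> h i; have := h i; rewrite !mxE subr_ge0 ltrBlDl.
  rewrite ler_pdivlMr// ltr_pdivrMr// -natr1 mulrDl mul1r.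
  by rewrite ![_ * P]mulrC.
have [yH|yH] := pselect (Hc (q%:R * P) y); last first.
  rewrite [RHS]indic_out// big1// => k _; rewrite indic_out//.
  move=> /Hk h; apply: yH => i; have /andP[h1 h2] := h i; apply/andP; split.
    by rewrite -(pmulr_lge0 _ (_ : 0 < P^-1)) ?invr_gt0// (le_trans _ h1).
  by rewrite -ltr_pdivrMr// (lt_le_trans h2)// ler_nat.
rewrite [RHS]indic_in//.
have yP i : 0 <= y i ord0 / P < q%:R.
  have /andP[h1 h2] := yH i.
  by rewrite divr_ge0 ?(ltW P0)//= ltr_pdivrMr.
have yq i : (Num.truncn (y i ord0 / P) < q)%N.
  by have /andP[h1 h2] := yP i; rewrite truncn_lt_nat.
pose k0 := [ffun i => Ordinal (yq i)].
rewrite (bigD1 k0)//= big1 ?addr0 => [|k /eqP kk0].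
  rewrite indic_in// => i.
  have /andP[h1 h2] := yP i; have /andP[h3 h4] := truncn_itv h1.
  rewrite !mxE ffunE/= subr_ge0 ltrBlDl; apply/andP; split.
    by rewrite mulrC -ler_pdivlMr.
  by rewrite -[X in _ + X]mulr1 -mulrDr mulrC natr1 -ltr_pdivrMr.
rewrite indic_out// => /Hk h; apply: kk0; apply/ffunP => i.
apply/val_inj; rewrite ffunE/=; symmetry; apply/eqP.
by rewrite truncn_eq ?h//; have /andP[] := yP i.
Qed.

End boxes.

Section periodic.
Context {R : realType} {d : nat}.
Notation X := (Rd R d).
Local Open Scope ereal_scope.

(** Horizontal translations, that is, those of the periodicity assumptions. *)
Definition hsh (a : 'cV[R]_d.-1) (x : X) : X := (x.1 + a, x.2)%R.

Lemma add_fst (x y : X) : (x + y)%R.1 = (x.1 + y.1)%R. Proof. by []. Qed.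

Lemma add_snd (x y : X) : (x + y)%R.2 = (x.2 + y.2)%R. Proof. by []. Qed.

Lemma hshE a x : hsh a x = (x + (a, 0))%R.
Proof. by case: x => x t; rewrite /hsh/=; congr pair; rewrite addr0. Qed.

Lemma hshD a b x : hsh a (hsh b x) = hsh (b + a)%R x.
Proof. by rewrite /hsh/= addrA. Qed.

Lemma measurable_addx (a : X) : measurable_fun setT (fun x : X => (x + a)%R).
Proof. by apply: measurable_xD => //; exact: measurable_cst. Qed.

Lemma measurable_hsh a : measurable_fun setT (hsh a).
Proof. by rewrite (funext (hshE a)); exact: measurable_addx. Qed.

Lemma integral_EFin_shift (a : X) (g : X -> R) :
  measurable_fun setT g -> (forall x, 0 <= g x)%R ->
  \int[vol]_x (g (x + a)%R)%:E = \int[vol]_x (g x)%:E.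
Proof.
move=> mg g0; rewrite (integral_vol_shift a (g := fun x => (g x)%:E))//.
  exact/measurable_EFinP.
Qed.

Lemma measurable_indic1 (A : set 'cV[R]_d.-1) : measurable A ->
  measurable_fun setT (fun x : X => \1_A x.1 : R).
Proof. by move=> mA; apply: measurable_indicT. Qed.

Lemma integral_box_sum q (P : R) (F : X -> R) : (0 < P)%R ->
  measurable_fun setT F -> (forall x, 0 <= F x)%R ->
  \int[vol]_x (\1_(Hc (q%:R * P)) x.1 * F x)%:E =
  \int[vol]_x (\1_(Hc P) x.1 *
    \sum_(k : {ffun 'I_d.-1 -> 'I_q}) F (hsh (P *: vecn k) x))%:E.
Proof.
move=> P0 mF F0.
under eq_integral do rewrite -(tile _ _ P0) mulr_suml.
under [RHS]eq_integral do rewrite mulr_sumr.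
have mi (k : {ffun 'I_d.-1 -> 'I_q}) :
    measurable_fun setT (fun x : X => \1_(Hc P) (x.1 - P *: vecn k)%R : R).
  apply: measurable_indicT; first exact: measurable_Hc.
  by apply: measurable_cVB => //; exact: measurable_cst.
rewrite !ge0_integral_EFin_sum.
- apply: eq_bigr => k _.
  rewrite -(integral_EFin_shift (P *: vecn k, 0)%R
    (g := fun x => (\1_(Hc P) (x.1 - P *: vecn k) * F x)%R)).
  + by apply: eq_integral => x _; rewrite -hshE /= addrK.
  + exact: measurable_funM.
  + by move=> x; rewrite mulr_ge0 ?indic_ge0.
- move=> k; apply: measurable_funM; first by apply: measurable_indic1; exact: measurable_Hc.
  by apply: measurableT_comp => //; exact: measurable_hsh.
- by move=> k x; rewrite mulr_ge0 ?indic_ge0.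
- by move=> k; exact: measurable_funM.
- by move=> k x; rewrite mulr_ge0 ?indic_ge0.
Qed.

Definition hperiodic (T : Type) (P : R) (F : X -> T) :=
  forall (k : 'cV[int]_d.-1) x, F (hsh (P *: map_mx intr k)%R x) = F x.

(** Modulo the lattice, [a] may be taken in the period cell. The translated cell
    then meets only the 2 ^ n cells with indices 0 and 1, and translating back
    the pieces recovers the cell itself, by [tile] twice. *)
Lemma integral_periodic_shift (P : R) (F : X -> R) (a : X) : (0 < P)%R ->
  measurable_fun setT F -> (forall x, 0 <= F x)%R -> hperiodic P F ->
  \int[vol]_x (\1_(Hc P) x.1 * F (x + a)%R)%:E =
  \int[vol]_x (\1_(Hc P) x.1 * F x)%:E.
Proof.
move=> P0 mF F0 FP.
pose j : 'cV[int]_d.-1 := \col_i Num.floor (a.1 i ord0 / P).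
pose b : 'cV[R]_d.-1 := (a.1 - P *: map_mx intr j)%R.
have bH : Hc P b.
  move=> i; rewrite /b !mxE; have /andP[h1 h2] := floor_itv (a.1 i ord0 / P).
  rewrite subr_ge0 ltrBlDl mulrC -ler_pdivlMr// h1/=.
  by rewrite -[X in (_ + X)%R]mul1r -mulrDl -ltr_pdivrMr// -(intrD _ _ 1).
have Fab x : F (x + a)%R = F (x + (b, a.2))%R.
  rewrite -[RHS](FP j) /hsh/=; congr (F (_, _)).
  by rewrite -addrA /b subrK.
clearbody b; under eq_integral do rewrite Fab.
pose s (k : {ffun 'I_d.-1 -> 'I_2}) : X := ((b - P *: vecn k)%R, a.2).
have mi (k : {ffun 'I_d.-1 -> 'I_2}) c (e : R) :
    measurable_fun setT (fun x : X => \1_(Hc P) (x.1 + c + e *: vecn k)%R : R).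
  apply: measurable_indicT; first exact: measurable_Hc.
  by do 2 apply: measurable_cVD => //.
have mH : measurable_fun setT (fun x : X => \1_(Hc P) x.1 : R).
  by apply: measurable_indic1; exact: measurable_Hc.
have vi (k : {ffun 'I_d.-1 -> 'I_2}) :
    vecn k = map_mx intr (\col_i (k i : nat)%:Z) :> 'cV[R]_d.-1.
  by apply/matrixP => i z; rewrite !mxE.
transitivity (\sum_(k : {ffun 'I_d.-1 -> 'I_2})
   \int[vol]_x (\1_(Hc P) x.1 * \1_(Hc P) (x + s k)%R.1 * F (x + s k)%R)%:E).
  rewrite -ge0_integral_EFin_sum.
  - apply: eq_integral => x _; congr EFin.
    have [xH|xH] := pselect (Hc P x.1); last first.
      by rewrite indic_out// big1 ?mul0r// => k _; rewrite !mul0r.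
    rewrite indic_in// mul1r.
    transitivity (\sum_(k : {ffun 'I_d.-1 -> 'I_2})
       \1_(Hc P) ((x.1 + b) - P *: vecn k) * F (x + (b, a.2)))%R.
      rewrite -mulr_suml tile// indic_in ?mul1r// => i.
      have /andP[h1 h2] := xH i; have /andP[h3 h4] := bH i.
      by rewrite mxE addr_ge0//= mulr_natl mulr2n ltrD.
    apply: eq_bigr => k _; rewrite mul1r.
    have -> : F ((x : X) + s k)%R = F ((x : X) + (b, a.2))%R.
      rewrite -(FP (\col_i (k i : nat)%:Z) ((x : X) + s k)%R) /hsh/= -vi.
      by congr (F (_, _)); rewrite -addrA subrK.
    congr (_ * _)%R; congr (\1_(_) _); rewrite add_fst; apply/matrixP => i z.
    by rewrite /s/= !mxE; ring.
  - move=> k; apply: measurable_funM; [apply: measurable_funM => //|].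
      apply: measurable_indicT; first exact: measurable_Hc.
      by apply: measurableT_comp => //; exact: measurable_addx.
    by apply: measurableT_comp => //; exact: measurable_addx.
  - by move=> k x; rewrite !mulr_ge0 ?indic_ge0.
transitivity (\sum_(k : {ffun 'I_d.-1 -> 'I_2})
   \int[vol]_x (\1_(Hc P) (x.1 - b + P *: vecn k)%R * (\1_(Hc P) x.1 * F x))%:E).
  apply: eq_bigr => k _.
  rewrite -[RHS](integral_EFin_shift (s k)).
  - apply: eq_integral => x _; rewrite mulrA; congr (_ * _ * _)%:E.
    by congr (\1_(_) _); rewrite add_fst /s/=; apply/matrixP => i z; rewrite !mxE; ring.
  - by apply: measurable_funM => //; exact: measurable_funM.
  - by move=> x; rewrite !mulr_ge0 ?indic_ge0.
rewrite -ge0_integral_EFin_sum.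
- apply: eq_integral => x _; congr EFin; rewrite -mulr_suml.
  have [xH|xH] := pselect (Hc P x.1); last by rewrite indic_out// !mul0r mulr0.
  rewrite -[RHS]mul1r; congr (_ * _)%R.
  pose e : 'cV[R]_d.-1 := \col_i 1%R.
  transitivity (\sum_(k : {ffun 'I_d.-1 -> 'I_2})
    \1_(Hc P) ((x.1 - b + P *: e) - P *: vecn k)%R : R)%R; last first.
    rewrite tile// indic_in// => i.
    have /andP[h1 h2] := xH i; have /andP[h3 h4] := bH i.
    rewrite !mxE mulr1; apply/andP; split; first by lra.
    by rewrite mulr_natl mulr2n; lra.
  pose r (k : {ffun 'I_d.-1 -> 'I_2}) := [ffun i => rev_ord (k i)].
  have rK : involutive r by move=> k; apply/ffunP => i; rewrite !ffunE rev_ordK.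
  rewrite (reindex_inj (inv_inj rK))/=; apply: eq_bigr => k _.
  congr (\1_(_) _); apply/matrixP => i z; rewrite !mxE ffunE /=.
  by case: (k i) => -[|[|//]] ? /=; rewrite ?subnn ?subn1 /=; ring.
- by move=> k; apply: measurable_funM => //; exact: measurable_funM.
- by move=> k x; rewrite !mulr_ge0 ?indic_ge0.
Qed.

End periodic.

Section pshift.
Context {R : realType} {d : nat}.
Notation X := (Rd R d).

Lemma pshiftE (delta : R) (xi x : X) :
  pshift delta xi x = x + (xi.1, delta * xi.2).
Proof. by []. Qed.

Lemma measurable_pshift (delta : R) d' (T : measurableType d') (F G : T -> X) :
  measurable_fun setT F -> measurable_fun setT G ->
  measurable_fun setT (fun t => pshift delta (F t) (G t)).
Proof.
move=> mF mG; apply: measurable_fun_pair.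
  by apply: measurable_cVD; exact: measurableT_comp.
apply: measurable_funD; first exact: measurableT_comp.
by apply: measurable_funM => //; exact: measurableT_comp.
Qed.

Lemma measurable_hshT a d' (T : measurableType d') (F : T -> X) :
  measurable_fun setT F -> measurable_fun setT (fun t => hsh a (F t)).
Proof. by move=> mF; apply: measurableT_comp => //; exact: measurable_hsh. Qed.

Lemma pshift_hsh (delta : R) xi a (x : X) :
  pshift delta xi (hsh a x) = hsh a (pshift delta xi x).
Proof. by rewrite /pshift /hsh/= addrAC. Qed.

End pshift.

(** Decomposes a measurability goal along the syntax of the function. *)
Ltac mfun :=
  lazymatch goal with
  | |- measurable_fun _ (fun x => (@?f x)%:E) => apply/measurable_EFinP; mfun
  | |- measurable_fun _ (fun x => _) =>
    first [ exact: measurable_cst | exact: measurable_id | assumption |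
    lazymatch goal with
    | |- measurable_fun _ (fun x => pshift _ (@?f x) (@?g x)) =>
        apply: (@measurable_pshift _ _ _ _ _ f g); mfun
    | |- measurable_fun _ (fun x => hsh _ (@?f x)) =>
        apply: (@measurable_hshT _ _ _ _ _ f); mfun
    | |- measurable_fun _ (fun x => ((@?f x), (@?g x))) =>
        apply: (@measurable_fun_pair _ _ _ _ _ _ f g); mfun
    | |- measurable_fun _ (fun x => (@?f x).1) =>
        apply: (measurableT_comp measurable_fst (g := f)); mfun
    | |- measurable_fun _ (fun x => (@?f x).2) =>
        apply: (measurableT_comp measurable_snd (g := f)); mfun
    | |- measurable_fun _ (fun x => powR (@?f x) _) =>
        apply: (@measurable_powRT _ _ _ f); mfun
    | |- measurable_fun _ (fun x => snorm (@?f x)) =>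
        apply: (@measurable_snorm _ _ _ _ f); mfun
    | |- measurable_fun _ (fun x => enorm (@?f x)) =>
        apply: (@measurable_enorm _ _ _ _ f); mfun
    | |- measurable_fun _ (fun x => indic ?A (@?f x)) =>
        apply: (@measurable_indicT _ _ _ _ _ f A); [try assumption|mfun]
    | |- measurable_fun _ (fun x => `|@?f x|) =>
        apply: (measurableT_comp (@normr_measurable _ setT) (g := f)); mfun
    | |- measurable_fun _ (fun x => \sum_(i <- _) _) =>
        first [apply: measurable_fsum => ?; mfun | apply: measurable_cV_sum => ?; mfun]
    | |- measurable_fun _ (fun x => (@?f x * @?g x)%R) =>
        apply: (@measurable_funM _ _ _ _ f g); mfun
    | |- measurable_fun _ (fun x => (@?f x *: @?g x)%R) =>
        apply: (@measurable_cVZ _ _ _ _ f g); mfun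
    | |- measurable_fun _ (fun x => (_ *m @?g x)%R) =>
        apply: (@measurable_mulmx _ _ _ _ _ _ g); mfun
    | |- measurable_fun _ (fun x => (@?f x - @?g x)%R) =>
        first [apply: (@measurable_funB _ _ _ _ f g); mfun
              |apply: (@measurable_cVB _ _ _ _ f g); mfun]
    | |- measurable_fun _ (fun x => (@?f x + @?g x)%R) =>
        first [apply: (@measurable_funD _ _ _ _ f g); mfun
              |apply: (@measurable_cVD _ _ _ _ f g); mfun
              |apply: (@measurable_xD _ _ _ _ f g); mfun]
    | H : measurable_fun setT ?W |- measurable_fun setT (fun x => ?W (@?f x)) =>
        apply: (measurableT_comp H (g := f)); mfun
    | _ => idtac
    end ]
  | _ => first [assumption | exact: measurable_cst | exact: measurable_id
               | exact: measurable_fst | exact: measurable_snd | idtac]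
  end.

Section box_measure.
Context {R : realType}.
Local Open Scope ereal_scope.

Lemma lebSE n (S : set 'cV[R]_n.+1) :
  leb n.+1 S = (leb n \x leb1) (@cons_cV R n @^-1` S).
Proof. by []. Qed.

Lemma leb_box n (A : set R) (a : R) : measurable A -> leb1 A = a%:E ->
  leb n [set y : 'cV[R]_n | forall i, A (y i ord0)] = (a ^+ n)%:E.
Proof.
move=> mA Aa; elim: n => [|n IH].
  rewrite (_ : [set _ | _] = setT) /= ?diracT//.
  by apply/seteqP; split => // y _ [].
have mB := @measurable_cVbox R n (fun=> A) (fun=> mA).
rewrite lebSE.
have -> : @cons_cV R n @^-1` [set y | forall i, A (y i ord0)] =
    [set y : 'cV[R]_n | forall i, A (y i ord0)] `*` A.
  apply/seteqP; split => [[y t] h|[y t] [/= h1 h2] i].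
    split => [i|]/=.
      by have := h (rshift 1 i); rewrite /cons_cV (@col_mxEd _ 1 n).
    by have := h (lshift n (ord0 : 'I_1)); rewrite /cons_cV (@col_mxEu _ 1 n) mxE.
  rewrite /cons_cV; case: (@splitP 1 n i) => j ij.
    have -> : i = lshift n j by exact/val_inj.
    by rewrite (@col_mxEu _ 1 n) mxE.
  have -> : i = rshift 1 j by exact/val_inj.
  by rewrite (@col_mxEd _ 1 n).
by rewrite product_measure1E//; rewrite [X in X * _]IH [X in _ * X]Aa -EFinM exprSr.
Qed.

Lemma leb_coor0 n (i : 'I_n) : leb n [set y : 'cV[R]_n | y i ord0 = 0%R] = 0.
Proof.
elim: n i => [[]//|n IH] i.
have m0 k (j : 'I_k) : measurable [set y : 'cV[R]_k | y j ord0 = 0%R].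
  have := @measurable_coor _ R k j measurableT [set 0%R] (measurable_set1 _).
  by rewrite setTI.
rewrite lebSE.
case: (@splitP 1 n i) => j ij.
  have -> : i = lshift n j by exact/val_inj.
  have -> : @cons_cV R n @^-1` [set y | y (lshift n j) ord0 = 0%R] =
      setT `*` [set 0%R].
    apply/seteqP; split => [[y t] h|[y t] [/= h1 h2]].
      by move: h; rewrite /cons_cV/= (@col_mxEu _ 1 n) mxE.
    by rewrite /cons_cV/= (@col_mxEu _ 1 n) mxE.
  rewrite product_measure1E//; rewrite [X in _ * X](_ : _ = 0) ?mule0//.
  exact: lebesgue_measure_set1.
have -> : i = rshift 1 j by exact/val_inj.
have -> : @cons_cV R n @^-1` [set y | y (rshift 1 j) ord0 = 0%R] =
    [set y : 'cV[R]_n | y j ord0 = 0%R] `*` setT.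
  apply/seteqP; split => [[y t] h|[y t] [/= h1 h2]].
    by move: h; rewrite /cons_cV/= (@col_mxEd _ 1 n).
  by rewrite /cons_cV/= (@col_mxEd _ 1 n).
by rewrite product_measure1E//; [rewrite [X in X * _]IH mul0e|exact: m0].
Qed.

Lemma leb1_itv (u v : R) (b c : bool) : (u <= v)%R ->
  leb1 [set` Interval (BSide b u) (BSide c v)] = (v - u)%:E.
Proof.
move=> uv; rewrite /leb1 lebesgue_measure_itv/= lte_fin; case: ltP => // vu.
by have -> : u = v; [apply/eqP; rewrite eq_le uv vu|rewrite subrr].
Qed.

Lemma leb_Hc n (P : R) : (0 <= P)%R -> leb n (@Hc R n P) = (P ^+ n)%:E.
Proof.
move=> P0; have := @leb_box n [set` `[0%R, P[] P (measurable_itv _).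
rewrite leb1_itv// subr0 => /(_ erefl) <-.
by congr (leb n _).
Qed.

End box_measure.

Section vol_measure.
Context {R : realType} {d : nat}.
Notation X := (Rd R d).
Local Open Scope ereal_scope.

Lemma volX (A : set 'cV[R]_d.-1) (B : set R) : measurable A -> measurable B ->
  vol (A `*` B) = leb d.-1 A * leb1 B.
Proof. by move=> mA mB; rewrite /vol product_measure1E. Qed.

Lemma integral_indicX (A : set 'cV[R]_d.-1) (B : set R) :
  measurable A -> measurable B ->
  \int[vol]_x (\1_A x.1 * \1_B x.2)%:E = leb d.-1 A * leb1 B.
Proof.
move=> mA mB; rewrite -volX//.
rewrite -[A `*` B in RHS]setIT -integral_indic//; last exact: measurableX.
apply: eq_integral => -[y t] _; rewrite !indicE in_setX.
by case: (_ \in A); case: (_ \in B); rewrite ?mul1r ?mul0r.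
Qed.

(** The two cells differ by pieces of the hyperplanes [y i ord0 = 0], which are
    null by [leb_coor0]. *)
Lemma integral_cube1_Hc1 (g : X -> R) :
  measurable_fun setT g -> (forall x, 0 <= g x)%R ->
  \int[vol]_x (\1_(Hc 1) x.1 * g x)%:E = \int[vol]_x (\1_(cube 1) x.1 * g x)%:E.
Proof.
move=> mg g0.
have m1 := @measurable_Hc R d.-1 1.
have m2 := @measurable_cube R d.-1 1.
pose Z (i : 'I_d.-1) : set X := [set y : 'cV[R]_d.-1 | y i ord0 = 0%R] `*` setT.
have mZ0 (i : 'I_d.-1) : measurable [set y : 'cV[R]_d.-1 | y i ord0 = 0%R].
  have := @measurable_coor _ R d.-1 i measurableT [set 0%R] (measurable_set1 _).
  by rewrite setTI.
have mZ i : measurable (Z i) by exact: measurableX.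
have Z0 i : vol (Z i) = 0 by rewrite volX// leb_coor0 mul0e.
have [mU U0] : measurable (\big[setU/set0]_(i : 'I_d.-1) Z i) /\
    vol (\big[setU/set0]_(i : 'I_d.-1) Z i) = 0.
  elim/big_ind : _ => [|A B [mA A0] [mB B0]|i _]; last by split.
    by split => //; exact: measure0.
  by split; [exact: measurableU|rewrite measureU0].
apply: ge0_ae_eq_integral => //.
- by mfun.
- by mfun.
- by move=> x _; rewrite lee_fin mulr_ge0 ?indic_ge0.
- by move=> x _; rewrite lee_fin mulr_ge0 ?indic_ge0.
exists (\big[setU/set0]_(i : 'I_d.-1) Z i); split.
- exact: mU.
- exact: U0.
- move=> x /= h; rewrite -bigcup_seq; apply: contrapT => hZ; apply: h => _.
  congr (_ * _)%:E; apply/eqP; rewrite eq_le; apply/andP; split; last first.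
    by apply: le_indic; exact: cube_Hc.
  apply: le_indic => hx i; have /andP[h1 ->] := hx i; rewrite andbT lt_neqAle h1 andbT.
  apply/eqP => x0; apply: hZ; exists i; first by rewrite /= mem_index_enum.
  by split => //=.
Qed.

End vol_measure.

(** * Long increments of a periodic function are controlled by short ones *)

Lemma sume_const {R : realType} (k : nat) (x : \bar R) : (0 <= x)%E ->
  (\sum_(j < k) x = k%:R%:E * x)%E.
Proof.
move=> x0; elim: k => [|k IH]; first by rewrite big_ord0 mul0e.
rewrite big_ord_recr /= IH -natr1 EFinD ge0_muleDl ?lee_fin//.
by rewrite mul1e.
Qed.

Section long_range.
Context {R : realType} {d m : nat}.
Notation X := (Rd R d).
Variables (p delta P : R) (W : X -> 'cV[R]_m).
Hypotheses (p1 : 1 <= p) (delta0 : 0 < delta) (P0 : 0 < P).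
Hypothesis mW : measurable_fun setT W.
Hypothesis perW : hperiodic P W.

Local Notation ps := (pshift delta).

(** Pairs that leave the slab carry no energy, hence the two indicators. *)
Definition incr (xi x : X) : R :=
  \1_II x.2 * \1_II (ps xi x).2 * snorm (W (ps xi x) - W x) `^ p.

Definition incr_energy (xi : X) : \bar R :=
  (\int[vol]_x (\1_(Hc P) x.1 * incr xi x)%:E)%E.

Lemma measurable_II : measurable (@II R).
Proof. exact: measurable_itv. Qed.

Lemma incr_ge0 xi x : 0 <= incr xi x.
Proof. by rewrite !mulr_ge0 ?indic_ge0 ?powR_ge0. Qed.

Lemma measurable_incr : measurable_fun setT (fun z : X * X => incr z.1 z.2).
Proof. by have mI := measurable_II; rewrite /incr; mfun. Qed.

Lemma measurable_incr2 d' (T : measurableType d') (F G : T -> X) :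
  measurable_fun setT F -> measurable_fun setT G ->
  measurable_fun setT (fun t => incr (F t) (G t)).
Proof.
move=> mF mG; apply: (measurableT_comp measurable_incr (g := fun t => (F t, G t))).
exact: measurable_fun_pair.
Qed.

Lemma incrE xi x : II x.2 -> II (ps xi x).2 ->
  incr xi x = snorm (W (ps xi x) - W x) `^ p.
Proof. by move=> h1 h2; rewrite /incr (indic_in h1) (indic_in h2) !mul1r. Qed.

Lemma incr_periodic xi : hperiodic P (incr xi).
Proof.
by move=> k x; rewrite /incr pshift_hsh !perW.
Qed.

Lemma incr_energy_shift xi a :
  (\int[vol]_x (\1_(Hc P) x.1 * incr xi (x + a))%:E = incr_energy xi)%E.
Proof.
apply: integral_periodic_shift; [exact: P0| |exact: incr_ge0|exact: incr_periodic].
by apply: measurable_incr2; [exact: measurable_cst|exact: measurable_id].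
Qed.

Definition xscale (k : R) (xi : X) : X := (k *: xi.1, k * xi.2).

Lemma II_conv (a b t : R) : II a -> II b -> 0 <= t <= 1 -> II (a + t * (b - a)).
Proof.
rewrite /II /= !in_itv/= => /andP[a1 a2] /andP[b1 b2] /andP[t0 t1].
have t1' : 0 <= 1 - t by rewrite subr_ge0.
have [ab|ba] := lerP a b.
  have ab' : 0 <= b - a by rewrite subr_ge0.
  have := mulr_ge0 t0 ab'; have := mulr_ge0 t1' ab'.
  by rewrite mulrBl mul1r => ? ?; apply/andP; split; lra.
have ba' : 0 <= a - b by rewrite subr_ge0 ltW.
have := mulr_ge0 t0 ba'; have := mulr_ge0 t1' ba'.
by rewrite -(opprB b a) !mulrN mulrBl mul1r => ? ?; apply/andP; split; lra.
Qed.

(** The increment along [k xi] is the sum of [k] increments along [xi] from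
    equally spaced points; these points stay in the slab, which is convex. The
    factor comes from the convexity of the power [p]. *)
Lemma incr_chain (k : nat) (xi x : X) : (0 < k)%N ->
  incr (xscale k%:R xi) x <=
  k%:R `^ (p - 1) * \sum_(j < k) incr xi (x + (xi.1, delta * xi.2) *+ j).
Proof.
move=> k0; set s : X := (xi.1, delta * xi.2).
have sn j : s *+ j = (j%:R *: xi.1, j%:R * (delta * xi.2)).
  elim: j => [|j IH]; first by rewrite mulr0n scale0r mul0r.
  rewrite mulrSr IH -natr1 scalerDl mulrDl scale1r mul1r//.
have sum0 : 0 <= \sum_(j < k) incr xi (x + s *+ j).
  by apply: sumr_ge0 => j _; exact: incr_ge0.
rewrite {1}/incr.
have E j : ps (xscale j%:R xi) x = x + s *+ j.
  by rewrite pshiftE sn /xscale/=; congr (_ + (_, _)); ring.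
have [x2|x2] := pselect (II x.2); last first.
  by rewrite (indic_out x2) !mul0r mulr_ge0 ?powR_ge0.
have [xk|xk] := pselect (II (ps (xscale k%:R xi) x).2); last first.
  by rewrite (indic_out xk) mulr0 mul0r mulr_ge0 ?powR_ge0.
rewrite !indic_in// !mul1r.
have Ij (j : nat) : (j <= k)%N -> II (x + s *+ j).2.
  move=> jk; rewrite add_snd sn/=.
  have := @II_conv x.2 (ps (xscale k%:R xi) x).2 (j%:R / k%:R) x2 xk.
  rewrite E add_snd sn/= addrAC subrr add0r mulrA divfK ?pnatr_eq0 ?gtn_eqF//.
  apply; rewrite divr_ge0//= ler_pdivrMr ?ltr0n// mul1r ler_nat//.
have -> : W (ps (xscale k%:R xi) x) - W x =
    \sum_(j < k) (W (x + s *+ j.+1) - W (x + s *+ j)).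
  rewrite -(big_mkord xpredT (fun j => W (x + s *+ j.+1) - W (x + s *+ j))).
  by rewrite telescope_sumr// E mulr0n addr0.
have := @powR_sum_le _ p 'I_k (index_enum 'I_k)
  (fun j => snorm (W (x + s *+ j.+1) - W (x + s *+ j))) p1 (fun=> snorm_ge0 _).
rewrite [X in X%:R](_ : _ = k); last by rewrite /index_enum -enumT size_enum_ord.
move=> h; apply: (le_trans _ (le_trans h _)).
  apply: le_powR; [exact: le_trans p1|exact: snorm_ge0|exact: snorm_sum].
apply: ler_wpM2l; first exact: powR_ge0.
apply: ler_sum => j _; rewrite /incr pshiftE -/s -addrA -mulrSr.
by rewrite !indic_in ?mul1r//; apply: Ij => //; exact: ltnW.
Qed.

(** By periodicity the [k] increments of [incr_chain] have the same energy. *)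
Lemma incr_energy_chain (k : nat) (xi : X) : (0 < k)%N ->
  (incr_energy (xscale k%:R xi) <= (k%:R `^ p)%:E * incr_energy xi)%E.
Proof.
move=> k0; have mH := @measurable_Hc R d.-1 P.
set s : X := (xi.1, delta * xi.2).
have mj (j : nat) : measurable_fun setT (fun x : X => incr xi (x + s *+ j)).
  by apply: measurable_incr2; [exact: measurable_cst|exact: measurable_addx].
have k0R : 0 < k%:R :> R by rewrite ltr0n.
apply: (@le_trans _ _ (\int[vol]_x (k%:R `^ (p - 1) *
    \sum_(j < k) (\1_(Hc P) x.1 * incr xi (x + s *+ j)))%:E)%E).
  apply: ge0_le_integral_EFin.
  - apply: measurable_funM; first by mfun.
    by apply: measurable_incr2; [exact: measurable_cst|exact: measurable_id].
  - apply: measurable_funM; first exact: measurable_cst.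
    apply: measurable_fsum => j; apply: measurable_funM; first by mfun.
    exact: mj.
  - by move=> x; rewrite mulr_ge0 ?indic_ge0 ?incr_ge0.
  - move=> x; rewrite -mulr_sumr [leRHS]mulrCA; apply: ler_wpM2l; first exact: indic_ge0.
    exact: incr_chain.
rewrite ge0_integral_EFinZ ?powR_ge0//; last 2 first.
- apply: measurable_fsum => j; apply: measurable_funM; first by mfun.
  exact: mj.
- by move=> x; apply: sumr_ge0 => j _; rewrite mulr_ge0 ?indic_ge0 ?incr_ge0.
rewrite ge0_integral_EFin_sum; last 2 first.
- by move=> j; apply: measurable_funM; [mfun|exact: mj].
- by move=> j x; rewrite mulr_ge0 ?indic_ge0 ?incr_ge0.
under eq_bigr do rewrite incr_energy_shift.
rewrite sume_const; last first.
  by apply: integral_EFin_ge0 => x; rewrite mulr_ge0 ?indic_ge0 ?incr_ge0.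
have -> : (k%:R `^ p = k%:R `^ (p - 1) * k%:R :> R)%R.
  rewrite -[X in (_ = _ * X)%R]powRr1 ?ltW// -powRD ?subrK//.
  by apply/implyP => _; rewrite gt_eqF.
by rewrite EFinM -muleA.
Qed.

Lemma measurable_incr_energy : measurable_fun setT incr_energy.
Proof.
have mH := @measurable_Hc R d.-1 P.
apply: (@measurable_integral2 R _ _ _ _ vol
  (fun z : X * X => (\1_(Hc P) z.2.1 * incr z.1 z.2)%:E)).
  apply/measurable_EFinP; apply: measurable_funM; last exact: measurable_incr.
  by mfun.
by move=> z; rewrite lee_fin mulr_ge0 ?indic_ge0 ?incr_ge0.
Qed.

Lemma incr_energy_ge0 xi : (0 <= incr_energy xi)%E.
Proof.
by apply: integral_EFin_ge0 => x; rewrite mulr_ge0 ?indic_ge0 ?incr_ge0.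
Qed.

Definition sbox (r : R) : set X :=
  [set xi : X | (forall i, `|xi.1 i ord0| < r) /\ `|xi.2| < r].

Lemma measurable_sbox r : measurable (sbox r).
Proof.
have -> : sbox r =
    [set y : 'cV[R]_d.-1 | forall i, [set t | `|t| < r] (y i ord0)] `*`
    [set t : R | `|t| < r] by [].
have m1 : measurable [set t : R | `|t| < r].
  have -> : [set t : R | `|t| < r] = [set` `]- r, r[].
    by apply/seteqP; split => t /=; rewrite in_itv/= ltr_norml.
  exact: measurable_itv.
apply: measurableX => //.
exact: (@measurable_cVbox R _ (fun=> [set t : R | `|t| < r]) (fun=> m1)).
Qed.

Definition short_energy (r : R) : \bar R :=
  (\int[vol]_xi ((\1_(sbox r) xi)%:E * incr_energy xi))%E.

Let Bh (r : R) : set X := [set xi : X | Hc r xi.1 /\ `|xi.2| < r].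

Let measurable_Bh r : measurable (Bh r).
Proof.
have -> : Bh r = Hc r `*` [set` `]- r, r[].
  by apply/seteqP; split => -[y t] /= [h1 h2]; split => //=;
    move: h2; rewrite /= in_itv/= ltr_norml.
by apply: measurableX; first exact: measurable_Hc.
Qed.

(** The increment along [ze] is the difference of the increments from [x] and
    from the other end to a common third point, reached from [x] along [et].
    This is averaged over a box of directions [et]: a single [et] would not be
    seen by an integral over the directions. *)
Let incr_average (r : R) (ze x : X) : 0 < r -> delta * r <= 1 ->
  ((r ^+ d.-1 * r * incr ze x)%:E <= \int[vol]_et
     (\1_(Bh r) et * (2 `^ p * (incr et x + incr (et - ze)%R (ps ze x))))%:E)%E.
Proof.
move=> r0 dr.
have mH := @measurable_Hc R d.-1 r.
have rhs0 et : 0 <= \1_(Bh r) et * (2 `^ p * (incr et x + incr (et - ze)%R (ps ze x))).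
  by rewrite mulr_ge0 ?indic_ge0// mulr_ge0 ?powR_ge0// addr_ge0 ?incr_ge0.
have [x2|x2] := pselect (II x.2); last first.
  rewrite {1}/incr (indic_out x2) !mul0r mulr0.
  exact: integral_EFin_ge0.
have [xz|xz] := pselect (II (ps ze x).2); last first.
  rewrite {1}/incr (indic_out xz) mulr0 mul0r mulr0.
  exact: integral_EFin_ge0.
(* half of the vertical interval keeps the intermediate point in the slab *)
pose J : set R := if 0 <= x.2 then [set` `]- r, 0%R]] else [set` `[0%R, r[].
have mJ : measurable J by rewrite /J; case: ifP => _; exact: measurable_itv.
have lJ : leb1 J = r%:E.
  rewrite /J; case: ifP => _; rewrite leb1_itv ?ltW//.
  - by rewrite sub0r opprK.
  - by rewrite oppr_lt0.
  - by rewrite subr0.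
have JP t : J t -> `|t| < r /\ II (x.2 + delta * t).
  move: x2; rewrite /J /II /= in_itv/= => /andP[x1 x2].
  have dt : 0 <= delta by exact: ltW.
  case: ifPn => [x0|]; [|rewrite -ltNge => x0];
      rewrite /= !in_itv/= => /andP[t1 t2].
    have h1 : delta * - r < delta * t by rewrite ltr_pM2l.
    have h2 : delta * t <= 0 by rewrite pmulr_rle0.
    split; first by rewrite ltr_norml t1 (le_lt_trans t2).
    by rewrite mulrN in h1; apply/andP; split; lra.
  have h1 : delta * t < delta * r by rewrite ltr_pM2l.
  have h2 : 0 <= delta * t by rewrite mulr_ge0.
  split; first by rewrite ger0_norm.
  by apply/andP; split; lra.
pose h (et : X) : R := \1_(Hc r) et.1 * \1_J et.2.
have mh : measurable_fun setT h by rewrite /h; mfun.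
have -> : ((r ^+ d.-1 * r * incr ze x)%:E =
    \int[vol]_et (incr ze x * h et)%:E)%E.
  have h0 et : 0 <= h et by rewrite mulr_ge0 ?indic_ge0.
  rewrite (ge0_integral_EFinZ vol mh h0 (incr_ge0 _ _)).
  by rewrite (integral_indicX mH mJ) leb_Hc ?ltW// lJ muleC -!EFinM.
apply: ge0_le_integral_EFin => //.
- by mfun.
- apply: measurable_funM; first by have := measurable_Bh r; mfun.
  apply: measurable_funM => //; apply: measurable_funD.
    by apply: measurable_incr2.
  apply: measurable_incr2; last exact: measurable_cst.
  exact: measurable_addx.
- by move=> et; rewrite mulr_ge0 ?incr_ge0// /h mulr_ge0 ?indic_ge0.
- move=> et; rewrite /h.
  have [e1|e1] := pselect (Hc r et.1); last first.
    by rewrite (indic_out e1) mul0r mulr0.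
  have [e2|e2] := pselect (J et.2); last first.
    by rewrite (indic_out e2) !mulr0.
  have [e3 e4] := JP _ e2.
  rewrite [leLHS](_ : _ = incr ze x); last by rewrite !indic_in ?mulr1.
  rewrite (@indic_in _ _ (Bh r))// mul1r.
  have psE : ps (et - ze) (ps ze x) = ps et x.
    rewrite /pshift (_ : (et - ze).1 = et.1 - ze.1)//.
    rewrite (_ : (et - ze).2 = et.2 - ze.2)//=.
    by rewrite -addrA subrKC -addrA -mulrDr subrKC.
  have xe' : II (ps (et - ze) (ps ze x)).2 by rewrite psE.
  rewrite (incrE x2 xz) (incrE xz xe') psE (@incrE et x x2 e4).
  apply: (@le_trans _ _ ((snorm (W (ps et x) - W x) + snorm (W (ps et x) - W (ps ze x))) `^ p)).
    apply: le_powR; [exact: le_trans p1|exact: snorm_ge0|].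
    rewrite -(snormN (W (ps et x) - W (ps ze x))) opprB.
    apply: le_trans (snormD _ _).
    by rewrite [X in _ <= snorm X]addrC addrA subrK.
  exact: powRD_le p1 (snorm_ge0 _) (snorm_ge0 _).
Qed.

(** [incr_average] integrated over [x]; if [et] and [ze] have size less than
    [r], then [et] and [et - ze] have size less than [2 * r]. *)
Lemma incr_energy_short (r : R) (ze : X) : 0 < r -> delta * r <= 1 ->
  sbox r ze ->
  ((r ^+ d.-1 * r)%:E * incr_energy ze <= (2 `^ p * 2)%:E * short_energy (2 * r))%E.
Proof.
move=> r0 dr zr.
have mH := @measurable_Hc R d.-1 P.
have mB := measurable_Bh r.
have c0 : 0 <= r ^+ d.-1 * r by rewrite mulr_ge0 ?exprn_ge0// ltW.
have minc (e : X) : measurable_fun setT (fun x : X => incr e x).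
  by apply: measurable_incr2; [exact: measurable_cst|exact: measurable_id].
pose F (z : X * X) := \1_(Hc P) z.1.1 *
  (\1_(Bh r) z.2 * (2 `^ p * (incr z.2 z.1 + incr (z.2 - ze)%R (ps ze z.1)))).
have mF : measurable_fun setT F.
  rewrite /F; apply: measurable_funM; first by mfun.
  apply: measurable_funM; first by mfun.
  apply: measurable_funM; first by mfun.
  apply: measurable_funD; first by apply: measurable_incr2; mfun.
  by apply: measurable_incr2; last mfun;
    apply: measurable_xD; [exact: measurable_snd|exact: measurable_cst].
have F0 z : 0 <= F z.
  rewrite /F mulr_ge0 ?indic_ge0// mulr_ge0 ?indic_ge0// mulr_ge0 ?powR_ge0//.
  by rewrite addr_ge0 ?incr_ge0.
have mFE : measurable_fun setT (fun z => (F z)%:E) by exact/measurable_EFinP.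
have F0E z : (0 <= (F z)%:E)%E by rewrite lee_fin.
apply: (@le_trans _ _ (\int[vol]_x \int[vol]_et (F (x, et))%:E)%E).
  rewrite /incr_energy -ge0_integral_EFinZ//; last 2 first.
  - by apply: measurable_funM; [mfun|exact: minc].
  - by move=> x; rewrite mulr_ge0 ?indic_ge0 ?incr_ge0.
  apply: ge0_le_integral => //.
  - by move=> x _; rewrite lee_fin mulr_ge0// mulr_ge0 ?indic_ge0 ?incr_ge0.
  - apply/measurable_EFinP; apply: measurable_funM => //.
    by apply: measurable_funM; [mfun|exact: minc].
  - exact: (@measurable_integral2 R _ _ _ _ vol (fun z : X * X => (F z)%:E)).
  - move=> x _; rewrite mulrCA EFinM.
    have mi : measurable_fun setT (fun et : X => \1_(Bh r) et * (2 `^ p * (incr et x + incr (et - ze)%R (ps ze x)))).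
      apply: measurable_funM; first by mfun.
      apply: measurable_funM => //; apply: measurable_funD.
        by apply: measurable_incr2.
      apply: measurable_incr2; last exact: measurable_cst.
      exact: measurable_addx.
    rewrite /F/= ge0_integral_EFinZ ?indic_ge0//; last first.
      by move=> et; rewrite mulr_ge0 ?indic_ge0// mulr_ge0 ?powR_ge0// addr_ge0 ?incr_ge0.
    by apply: lee_wpmul2l; [rewrite lee_fin indic_ge0|exact: incr_average].
rewrite (@fubini_tonelli _ _ _ _ R vol vol (fun z => (F z)%:E) mFE F0E).
have mG := measurable_incr_energy.
have mGz : measurable_fun setT (fun e : X => incr_energy (e - ze)%R).
  by apply: (measurableT_comp mG); exact: measurable_addx.
have mi : measurable_fun setT (fun e : X => (\1_(Bh r) e)%:E : \bar R).
  by apply/measurable_EFinP; mfun.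
have mi' : measurable_fun setT (fun e : X => (\1_(sbox (2 * r)) e)%:E : \bar R).
  by have := measurable_sbox (2 * r) => ?; apply/measurable_EFinP; mfun.
have i0 (A : set X) e : (0 <= (\1_A e : R)%:E :> \bar R)%E by rewrite lee_fin indic_ge0.
have step e : (\int[vol]_x (F (x, e))%:E = (2 `^ p)%:E *
    ((\1_(Bh r) e)%:E * incr_energy e + (\1_(Bh r) e)%:E * incr_energy (e - ze)%R))%E.
  have ringE (a b q i j : R) : a * (b * (q * (i + j))) =
      q * (b * (a * i) + b * (a * j)) by ring.
  have FE x : F (x, e) = 2 `^ p * (\1_(Bh r) e * (\1_(Hc P) x.1 * incr e x) +
       \1_(Bh r) e * (\1_(Hc P) x.1 * incr (e - ze) (ps ze x))).
    exact: ringE.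
  under eq_integral do rewrite FE.
  have m1 (A : X -> X) g : measurable_fun setT A ->
      measurable_fun setT (fun x => \1_(Hc P) x.1 * incr g (A x)).
    by move=> mA; apply: measurable_funM; [mfun|exact: measurable_incr2].
  have g1 (A : X -> X) g x : 0 <= \1_(Hc P) x.1 * incr g (A x).
    by rewrite mulr_ge0 ?indic_ge0 ?incr_ge0.
  have mp : measurable_fun setT (fun x => ps ze x) by mfun.
  have mid : measurable_fun setT (fun x : X => x) by exact: measurable_id.
  rewrite ge0_integral_EFinZ ?powR_ge0//; last 2 first.
  - by apply: measurable_funD; apply: measurable_funM => //; exact: m1.
  - by move=> x; rewrite addr_ge0// mulr_ge0 ?indic_ge0 ?g1// (g1 (fun x => x)).
  rewrite ge0_integral_EFinD; last 4 first.
  - by apply: measurable_funM => //; exact: m1.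
  - by apply: measurable_funM => //; exact: m1.
  - by move=> x; rewrite mulr_ge0 ?indic_ge0// (g1 (fun x => x)).
  - by move=> x; rewrite mulr_ge0 ?indic_ge0.
  have E1 : (\int[vol]_x (\1_(Bh r) e * (\1_(Hc P) x.1 * incr e x))%:E =
      (\1_(Bh r) e)%:E * incr_energy e)%E.
    apply: ge0_integral_EFinZ; last exact: indic_ge0.
      exact: (m1 (fun x => x)).
    exact: (g1 (fun x => x)).
  have E2 : (\int[vol]_x (\1_(Bh r) e * (\1_(Hc P) x.1 * incr (e - ze) (ps ze x)))%:E =
      (\1_(Bh r) e)%:E * incr_energy (e - ze)%R)%E.
    rewrite -(incr_energy_shift (e - ze) (ze.1, delta * ze.2)).
    apply: ge0_integral_EFinZ; last exact: indic_ge0.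
      exact: (m1 (fun x => ps ze x)).
    exact: (g1 (fun x => ps ze x)).
  by congr (_ * _)%E; congr (_ + _)%E; [exact: E1|exact: E2].
have t1 : measurable_fun setT (fun e : X => (\1_(Bh r) e)%:E * incr_energy e)%E.
  exact: (emeasurable_funM mi mG).
have t2 : measurable_fun setT (fun e : X => (\1_(Bh r) e)%:E * incr_energy (e - ze)%R)%E.
  exact: (emeasurable_funM mi mGz).
have t3 : measurable_fun setT (fun e : X => (\1_(sbox (2 * r)) e)%:E * incr_energy e)%E.
  exact: (emeasurable_funM mi' mG).
have t4 : measurable_fun setT (fun e : X => (\1_(Bh r) (e + ze)%R)%:E * incr_energy e)%E.
  apply: (emeasurable_funM _ mG).
  exact: (measurableT_comp mi (measurable_addx ze)).
have g0 (A : set X) e e' : (0 <= (\1_A e : R)%:E * incr_energy e')%E.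
  by apply: mule_ge0; [exact: i0|exact: incr_energy_ge0].
under eq_integral do rewrite step.
rewrite ge0_integralZl_EFin ?powR_ge0//; last 2 first.
- by move=> e _; exact: adde_ge0 (g0 _ _ _) (g0 _ _ _).
- exact: (emeasurable_funD t1 t2).
rewrite (ge0_integralD vol measurableT (fun (e : X) _ => g0 _ e e) t1 (fun (e : X) _ => g0 _ e (e - ze)%R) t2).
have S0 : (0 <= short_energy (2 * r))%E.
  by apply: integral_ge0 => e _; exact: g0.
rewrite EFinM -muleA; apply: lee_wpmul2l; first by rewrite lee_fin powR_ge0.
have -> : (2%:E * short_energy (2 * r) = short_energy (2 * r) + short_energy (2 * r))%E.
  by rewrite -[2]/(1 + 1) EFinD ge0_muleDl ?lee_fin// mul1e.
apply: leeD.
  apply: (ge0_le_integral _ _ (fun (e : X) _ => g0 _ e e) t1 t3) => // e _.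
  apply: lee_wpmul2r; first exact: incr_energy_ge0.
  rewrite lee_fin; apply: le_indic => -[h1 h2]; split; last by lra.
  by move=> i; have /andP[a1 a2] := h1 i; rewrite ger0_norm//; lra.
rewrite -(integral_vol_shift ze t2 (fun e : X => g0 _ e (e - ze)%R)).
under eq_integral do rewrite addrK.
apply: (ge0_le_integral _ _ (fun (e : X) _ => g0 _ (e + ze)%R e) t4 t3) => // e _.
apply: lee_wpmul2r; first exact: incr_energy_ge0.
rewrite lee_fin; apply: le_indic => -[h1 h2]; case: zr => z1 z2; split.
  move=> i; have /andP[] := h1 i; have := z1 i; rewrite add_fst mxE !ltr_norml.
  by move=> /andP[? ?] ? ?; apply/andP; split; lra.
move: h2 z2; rewrite add_snd !ltr_norml.
by move=> /andP[? ?] /andP[? ?]; apply/andP; split; lra.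
Qed.

(** [xi] is cut into about [xnorm xi / r] equal steps of size less than [r]: the
    chain inequality costs the power [p] of the number of steps, and one step is
    controlled by the energy of the short increments. *)
Lemma incr_energy_growth (r : R) (xi : X) : 0 < r -> delta * r <= 1 ->
  1 <= xnorm xi ->
  ((r ^+ d.-1 * r)%:E * incr_energy xi <=
   ((r^-1 + 1) `^ p * (2 `^ p * 2) * xnorm xi `^ p)%:E * short_energy (2 * r))%E.
Proof.
move=> r0 dr x1.
pose k := (Num.truncn (xnorm xi / r)).+1.
have kx : xnorm xi < k%:R * r by rewrite -ltr_pdivrMr// truncnS_gt.
have xr0 : 0 <= xnorm xi / r by rewrite divr_ge0 ?xnorm_ge0 ?ltW.
have kle : k%:R <= (r^-1 + 1) * xnorm xi.
  have /andP[h _] := truncn_itv xr0.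
  have -> : (r^-1 + 1) * xnorm xi = xnorm xi / r + xnorm xi by ring.
  by rewrite /k -[in leLHS]natr1; exact: lerD.
have k0 : 0 < k%:R :> R by rewrite ltr0n.
have k0' : k%:R != 0 :> R by rewrite gt_eqF.
have Exi : xi = xscale k%:R (xscale k%:R^-1 xi).
  rewrite /xscale/= scalerA mulrA mulfV// scale1r mul1r.
  exact: surjective_pairing.
have small t : `|t| <= xnorm xi -> `|k%:R^-1 * t| < r.
  move=> tx; rewrite normrM ger0_norm ?invr_ge0 ?ltW//.
  by rewrite ltr_pdivrMl// (le_lt_trans tx).
have zr : sbox r (xscale k%:R^-1 xi).
  split => [i|]/=; last by apply: small; rewrite lerDr snorm_ge0.
  by rewrite mxE; apply: small; exact: le_trans (snorm_ge _ _) (snorm_le_xnorm _).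
have c0 : 0 <= r ^+ d.-1 * r by rewrite mulr_ge0 ?exprn_ge0// ltW.
have S0 : (0 <= short_energy (2 * r))%E.
  apply: integral_ge0 => e _; apply: mule_ge0; first by rewrite lee_fin indic_ge0.
  exact: incr_energy_ge0.
rewrite {1}Exi.
apply: (@le_trans _ _ ((r ^+ d.-1 * r)%:E *
    ((k%:R `^ p)%:E * incr_energy (xscale k%:R^-1 xi)))%E).
  by apply: lee_wpmul2l; [rewrite lee_fin|exact: incr_energy_chain].
rewrite muleCA.
apply: (@le_trans _ _ ((k%:R `^ p)%:E * ((2 `^ p * 2)%:E * short_energy (2 * r)))%E).
  by apply: lee_wpmul2l; [rewrite lee_fin powR_ge0|exact: incr_energy_short].
rewrite muleA -EFinM; apply: lee_wpmul2r => //; rewrite lee_fin.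
rewrite mulrAC -powRM ?xnorm_ge0//; last by rewrite addr_ge0// invr_ge0 ltW.
apply: ler_wpM2r; first by rewrite mulr_ge0 ?powR_ge0.
by apply: le_powR; [exact: le_trans p1|exact: ltW|exact: kle].
Qed.

End long_range.

(** * Dominated convergence, local integrability and null sets *)

Section monotone_integral.
Local Open Scope ereal_scope.

(** The integral of a nonnegative function is the supremum of the integrals of
    the simple functions below it, whence the monotonicity on all functions,
    measurable or not. *)
Lemma le_integral_patch d (T : measurableType d) (R : realType)
    (mu : {measure set T -> \bar R}) (K : set T) (f g : T -> R) :
  (forall x, 0 <= f x)%R -> (forall x, 0 <= g x)%R ->
  (forall x, K x -> f x <= g x)%R ->
  \int[mu]_(x in K) (f x)%:E <= \int[mu]_x (g x)%:E.
Proof.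
move=> f0 g0 fg; rewrite !ge0_integralE//; last 2 first.
- by move=> x _; rewrite lee_fin.
- by move=> x _; rewrite lee_fin.
apply: le_ereal_sup => _ [h hf <-]; exists h => // x.
apply: (le_trans (hf x)); rewrite !patchE; case: ifPn => [xK|_].
  by rewrite in_setT lee_fin fg//; exact: set_mem.
by rewrite in_setT lee_fin.
Qed.

(** Dominated convergence: [h] dominates the products [b N * h]. *)
Lemma integral_weight_small d (T : measurableType d) (R : realType)
    (mu : {measure set T -> \bar R}) (h : T -> R) (b : nat -> T -> R) :
  measurable_fun setT h -> (forall x, 0 <= h x)%R ->
  \int[mu]_x (h x)%:E < +oo ->
  (forall N, measurable_fun setT (b N)) ->
  (forall N x, 0 <= b N x <= 1)%R ->
  (forall x, b ^~ x @ \oo --> (0%R : R)) ->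
  forall e : R, (0 < e)%R ->
    \forall N \near \oo, \int[mu]_x (b N x * h x)%:E <= e%:E.
Proof.
move=> mh h0 hoo mb b01 b0 e e0.
have ih : mu.-integrable setT (EFin \o h).
  apply/integrableP; split; first exact/measurable_EFinP.
  by under eq_integral do rewrite /= ger0_norm//.
have bcvg : {ae mu, forall x, setT x ->
    (fun N => (b N x * h x)%:E) @ \oo --> (cst 0 : T -> \bar R) x}.
  apply: aeW => x _; apply/fine_cvgP; split; first exact: nearW.
  rewrite -[X in _ --> X](mul0r (h x)).
  by apply: cvgM; [exact: b0|exact: cvg_cst].
have bdom : {ae mu, forall x N, setT x -> `|(b N x * h x)%:E| <= (EFin \o h) x}.
  apply: aeW => x N _; rewrite lee_fin normrM.
  have /andP[h1 h2] := b01 N x.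
  by rewrite !ger0_norm// -[leRHS]mul1r ler_wpM2r.
have mbh N : measurable_fun setT (fun x => (b N x * h x)%:E).
  by apply/measurable_EFinP; exact: measurable_funM.
have [_ _] := dominated_convergence measurableT mbh (measurable_cst _) bcvg ih bdom.
rewrite /= integral0.
move=> /fine_cvgP[fin /cvgrPdist_le/(_ e e0)].
apply: filterS2 fin => N /= fin; rewrite sub0r normrN => he.
rewrite -(fineK fin) lee_fin; apply: le_trans he.
exact: ler_norm.
Qed.

End monotone_integral.

Section local_integrability.
Context {R : realType} {d m : nat}.
Notation X := (Rd R d).

Definition cbox (A : R) : set X :=
  [set x : X | (forall i, `|x.1 i ord0| <= A) /\ `|x.2| <= A].

Lemma cboxE A : cbox A =
  [set y : 'cV[R]_d.-1 | forall i, `[- A, A]%classic (y i ord0)] `*` `[- A, A]%classic.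
Proof.
apply/seteqP; split => -[y t] /= [h1 h2]; split => //=.
- by move=> i; rewrite in_itv/= -ler_norml.
- by rewrite in_itv/= -ler_norml.
- by move=> i; have := h1 i; rewrite in_itv/= -ler_norml.
- by move: h2; rewrite in_itv/= -ler_norml.
Qed.

Lemma measurable_cbox A : measurable (cbox A).
Proof.
rewrite cboxE; apply: measurableX; last exact: measurable_itv.
exact: (@measurable_cVbox R _ (fun=> `[- A, A]%classic) (fun=> measurable_itv _)).
Qed.

Lemma trmx_continuous n : continuous (@trmx R 1 n : 'rV[R]_n -> 'cV[R]_n).
Proof.
move=> /= M s /= /(nbhs_ballP (M^T)) [e e0 es].
apply/nbhs_ballP; exists e => //= N [e0' MN]; apply: es; split => //.
by move=> i j; rewrite !mxE; exact: MN.
Qed.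

Lemma compact_cbox A : compact (cbox A).
Proof.
rewrite cboxE; apply: compact_setX; last exact: segment_compact.
have -> : [set y : 'cV[R]_d.-1 | forall i, `[- A, A]%classic (y i ord0)] =
    (@trmx R 1 d.-1) @` [set y : 'rV[R]_d.-1 | forall i, `[- A, A]%classic (y ord0 i)].
  apply/seteqP; split => [y h|_ [y h <-] i]; last by rewrite mxE; exact: h.
  by exists y^T; [move=> i; rewrite mxE; exact: h|rewrite trmxK].
apply: continuous_compact.
  by apply: continuous_subspaceT; exact: trmx_continuous.
by apply: (@rV_compact R d.-1 (fun=> `[- A, A]%classic)) => i; exact: segment_compact.
Qed.

Lemma compact_sub_cbox (K : set X) : compact K -> exists2 A, 0 < A & K `<=` cbox A.
Proof.
move=> /compact_bounded[A [_ hA]]; pose B := Num.max A 0 + 1.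
have AB : A < B by rewrite /B ltr_pwDr// le_max lexx.
have B0 : 0 < B by rewrite /B ltr_wpDl// le_max lexx orbT.
exists B => // x /(hA _ AB)/=; rewrite prod_normE ge_max => /andP[h1 h2]; split => // i.
apply: le_trans h1; rewrite [leRHS]/Num.Def.normr/= mx_normrE.
exact: (@le_bigmax _ _ _ 0 (fun ij : 'I_d.-1 * 'I_1 => `|x.1 ij.1 ij.2|) (i, ord0)).
Qed.

Lemma vol_cbox A : 0 <= A ->
  (\int[vol]_x (\1_(cbox A) x : R)%:E = ((2 * A) ^+ d.-1 * (2 * A))%:E)%E.
Proof.
move=> A0; have AA : - A <= A by rewrite (le_trans _ A0)// oppr_le0.
have e : A - - A = 2 * A by rewrite opprK mulr_natl mulr2n.
have lA : (leb1 `[(- A)%R, A%R]%classic = (2 * A)%:E)%E by rewrite leb1_itv ?e.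
have mB := @measurable_cVbox R d.-1 (fun=> `[- A, A]%classic) (fun=> measurable_itv _).
rewrite EFinM -[in RHS]lA -(@leb_box R d.-1 _ _ (measurable_itv _) lA).
rewrite -volX// -cboxE integral_indic// ?setIT//; exact: measurable_cbox.
Qed.

Variables (p : R) (p1 : 1 <= p).

Lemma Lploc_cbox (u : X -> 'cV[R]_m) (A : R) : Lploc p u ->
  (\int[vol]_x (\1_(cbox A) x * snorm (u x) `^ p)%:E < +oo)%E.
Proof.
move=> [mu hu]; have := hu _ (@compact_cbox A).
have mA := measurable_cbox A.
rewrite (integral_indicM _ _ mA) => h.
have c0 : 0 <= (m%:R : R) `^ p by exact: powR_ge0.
have me : measurable_fun setT (fun x : X => \1_(cbox A) x * enorm (u x) `^ p) by mfun.
have e0 x : 0 <= \1_(cbox A) x * enorm (u x) `^ p by rewrite mulr_ge0 ?indic_ge0 ?powR_ge0.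
apply: (@le_lt_trans _ _ (\int[vol]_x (m%:R `^ p * (\1_(cbox A) x * enorm (u x) `^ p))%:E)%E).
  apply: ge0_le_integral_EFin => //.
  - by mfun.
  - by mfun.
  - by move=> x; rewrite mulr_ge0 ?indic_ge0 ?powR_ge0.
  - move=> x; rewrite mulrCA -powRM ?enorm_ge0//.
    apply: ler_wpM2l; first exact: indic_ge0.
    by apply: le_powR; [exact: le_trans p1|exact: snorm_ge0|exact: snorm_le_enorm].
rewrite (ge0_integral_EFinZ vol me e0 c0) lte_mul_pinfty// lee_fin.
Qed.

(** Every compact set is contained in a box. *)
Lemma cbox_Lploc (u : X -> 'cV[R]_m) : measurable_fun setT u ->
  (forall A : R, 0 < A -> (\int[vol]_x (\1_(cbox A) x * snorm (u x) `^ p)%:E < +oo)%E) ->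
  Lploc p u.
Proof.
move=> mu h; split => // K /compact_sub_cbox[A A0 KA].
apply: le_lt_trans (h A A0); apply: le_integral_patch.
- by move=> x; exact: powR_ge0.
- by move=> x; rewrite mulr_ge0 ?indic_ge0 ?powR_ge0.
- move=> x /KA xA; rewrite indic_in// mul1r.
  by apply: le_powR; [exact: le_trans p1|exact: enorm_ge0|exact: enorm_le_snorm].
Qed.

Lemma cbox_affine (M : 'M[R]_(m, d.-1)) (A : R) :
  (\int[vol]_x (\1_(cbox A) x * snorm (M *m x.1) `^ p)%:E < +oo)%E.
Proof.
have [A0|A0] := leP 0 A; last first.
  rewrite integral0_eq// => x _; rewrite indic_out ?mul0r// => -[_].
  by rewrite leNgt (lt_le_trans A0).
have mA := measurable_cbox A.
pose c : R := ((\sum_i \sum_j `|M i j|) * (d.-1%:R * A)) `^ p.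
apply: (@le_lt_trans _ _ (\int[vol]_x (c * \1_(cbox A) x)%:E)%E).
  apply: ge0_le_integral_EFin => //.
  - by mfun.
  - by mfun.
  - by move=> x; rewrite mulr_ge0 ?indic_ge0 ?powR_ge0.
  - move=> x; have [xA|xA] := pselect (cbox A x); last by rewrite (indic_out xA) mul0r mulr0.
    rewrite (indic_in xA) mul1r mulr1.
    apply: le_powR; [exact: le_trans p1|exact: snorm_ge0|].
    apply: le_trans (snorm_mulmx _ _) _; apply: ler_wpM2l.
      by apply: sumr_ge0 => i _; exact: sumr_ge0.
    rewrite mulr_natl -[X in _ *+ X]card_ord -sumr_const; apply: ler_sum => i _.
    by have [] := xA.
have mi : measurable_fun setT (\1_(cbox A) : X -> R) by mfun.
by rewrite (ge0_integral_EFinZ vol mi (indic_ge0 _) (powR_ge0 _ _)) vol_cbox// -EFinM ltry.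
Qed.

Lemma cbox_le_add (g a b : X -> 'cV[R]_m) (A : R) :
  measurable_fun setT g -> measurable_fun setT a -> measurable_fun setT b ->
  {ae vol, forall x, (snorm (g x) <= snorm (a x) + snorm (b x))%R} ->
  (\int[vol]_x (\1_(cbox A) x * snorm (a x) `^ p)%:E < +oo)%E ->
  (\int[vol]_x (\1_(cbox A) x * snorm (b x) `^ p)%:E < +oo)%E ->
  (\int[vol]_x (\1_(cbox A) x * snorm (g x) `^ p)%:E < +oo)%E.
Proof.
move=> mg ma mb gab; have mA := measurable_cbox A.
have p0 : (0 <= p)%R by exact: le_trans p1.
pose F1 (x : X) : R := (\1_(cbox A) x * snorm (a x) `^ p)%R.
pose F2 (x : X) : R := (\1_(cbox A) x * snorm (b x) `^ p)%R.
rewrite -/F1 -/F2 => fa fb.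
have mF1 : measurable_fun setT F1 by rewrite /F1; mfun.
have mF2 : measurable_fun setT F2 by rewrite /F2; mfun.
have F10 x : (0 <= F1 x)%R by rewrite mulr_ge0 ?indic_ge0 ?powR_ge0.
have F20 x : (0 <= F2 x)%R by rewrite mulr_ge0 ?indic_ge0 ?powR_ge0.
have mF : measurable_fun setT (fun x => F1 x + F2 x)%R by exact: measurable_funD.
have F0 x : (0 <= F1 x + F2 x)%R by rewrite addr_ge0.
apply: (@le_lt_trans _ _ (\int[vol]_x (2 `^ p * (F1 x + F2 x))%:E)%E).
  apply: ae_ge0_le_integral => //.
  - by move=> x _; rewrite lee_fin mulr_ge0 ?indic_ge0 ?powR_ge0.
  - by apply/measurable_EFinP; mfun.
  - by move=> x _; rewrite lee_fin mulr_ge0 ?powR_ge0.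
  - by apply/measurable_EFinP; apply: measurable_funM => //; exact: measurable_cst.
  - apply: filterS gab => x hx _.
    rewrite lee_fin /F1 /F2 -mulrDr [leRHS]mulrCA.
    apply: ler_wpM2l; first exact: indic_ge0.
    apply: le_trans (powRD_le p1 (snorm_ge0 _) (snorm_ge0 _)).
    by apply: le_powR => //; exact: snorm_ge0.
rewrite (ge0_integral_EFinZ vol mF F0 (powR_ge0 _ _)).
rewrite (ge0_integral_EFinD vol mF1 mF2 F10 F20).
have i1 := integral_EFin_ge0 vol F10; have i2 := integral_EFin_ge0 vol F20.
apply: lte_mul_pinfty; rewrite ?lee_fin ?powR_ge0//.
by apply: lte_add_pinfty; [exact: fa|exact: fb].
Qed.

End local_integrability.

Section ae_replacement.
Context {R : realType} {d m : nat}.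
Notation X := (Rd R d).
Local Open Scope ereal_scope.

Lemma vol_shift0 (a : X) (A : set X) : measurable A -> vol A = 0 ->
  vol ((fun x : X => x + a)%R @^-1` A) = 0.
Proof.
move=> mA A0.
have mp : measurable ((fun x : X => x + a)%R @^-1` A).
  by rewrite -[X in measurable X]setTI; exact: measurable_addx.
have := integral_EFin_shift a (g := \1_A : X -> R) (measurable_indic mA) (indic_ge0 A).
rewrite (integral_indic _ measurableT mA) setIT => h.
rewrite -[RHS]A0; apply: etrans h.
by rewrite -[LHS]/(vol _) -[X in vol X]setIT -(integral_indic _ measurableT mp).
Qed.

(** The integrand sees the values at [x] and at a translate of [x], and a
    translate of a null set is null. *)
Lemma energy_ae (f : X -> X -> 'cV[R]_m -> R) (delta : R) (D : X -> set X)
    (v v' : X -> 'cV[R]_m) :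
  (forall x xi z, 0 <= f x xi z)%R ->
  measurable_fun setT (fun t : X * X * 'cV[R]_m => f t.1.1 t.1.2 t.2) ->
  (forall xi, measurable (D xi)) ->
  measurable_fun setT v -> measurable_fun setT v' ->
  {ae vol, forall x, v x = v' x} -> energy f delta D v = energy f delta D v'.
Proof.
move=> f0 mf mD mv mv' [N [mN N0 hN]].
rewrite /energy; apply: congr1; apply: eq_integral => xi _.
have mE (w : X -> 'cV[R]_m) : measurable_fun setT w ->
    measurable_fun setT (fun x : X => (f x xi (w (pshift delta xi x) - w x)%R)%:E).
  move=> mw; apply/measurable_EFinP.
  apply: (measurableT_comp mf
    (g := fun x : X => (x, xi, (w (pshift delta xi x) - w x)%R))).
  by mfun.
apply: ge0_ae_eq_integral => //.
- by apply: measurable_funTS; exact: mE.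
- by apply: measurable_funTS; exact: mE.
- by move=> x _; rewrite lee_fin.
- by move=> x _; rewrite lee_fin.
pose a : X := (xi.1, delta * xi.2)%R.
exists (N `|` (fun x : X => x + a)%R @^-1` N); split.
- apply: measurableU => //.
  by rewrite -[X in measurable X]setTI; exact: measurable_addx.
- rewrite measureU0//; last exact: vol_shift0.
  by rewrite -[X in measurable X]setTI; exact: measurable_addx.
- move=> x; apply: contra_notP => /not_orP[h1 h2] _ /=.
  have -> : v x = v' x by apply: contrapT => h; apply: h1; exact: hN.
  have -> // : v (pshift delta xi x) = v' (pshift delta xi x).
  by apply: contrapT => h; apply: h2; exact: hN.
Qed.

End ae_replacement.

(** * The fraction of the cells near the boundary *)

Section counting.
Context {R : realType}.

Lemma sum_le_threshold (N : nat) (t : R) : 0 <= t ->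
  \sum_(j < N) (j%:R <= t)%R%:R <= t + 1 :> R.
Proof.
move=> t0; elim: N => [|N IH]; first by rewrite big_ord0 addr_ge0.
rewrite big_ord_recr/=; case: (lerP N%:R t) => [Nt|tN]; last by rewrite addr0.
rewrite lerD2r; apply: (le_trans _ Nt); rewrite -[X in _ <= X%:R]card_ord.
by rewrite -sumr_const; apply: ler_sum => j _; rewrite lern1 leq_b1.
Qed.

(** Each value of [k i] is taken by N ^ (n - 1) functions [k]; multiplying by [N]
    keeps the exponent meaningful. *)
Lemma sum_ffun_coor n N (i : 'I_n) (g : 'I_N -> R) :
  N%:R * \sum_(k : {ffun 'I_n -> 'I_N}) g (k i) = N%:R ^+ n * \sum_j g j.
Proof.
pose F (i' : 'I_n) (j : 'I_N) : R := if i' == i then g j else 1.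
have -> : \sum_(k : {ffun 'I_n -> 'I_N}) g (k i) =
    \sum_(k : {ffun 'I_n -> 'I_N}) \prod_i' F i' (k i').
  apply: eq_bigr => k _; rewrite (bigD1 i)//= big1 => [|i' /negPf i'i].
    by rewrite /F eqxx mulr1.
  by rewrite /F i'i.
rewrite -bigA_distr_bigA (bigD1 i)//= mulrCA.
rewrite [X in X * _](eq_bigr g); last by move=> j _; rewrite /F eqxx.
rewrite mulrC; congr (_ * _).
have -> : \prod_(i' | i' != i) \sum_j F i' j = \prod_(i' : 'I_n | i' != i) (N%:R : R).
  apply: eq_bigr => i' /negPf i'i; rewrite /F i'i sumr_const card_ord//.
rewrite -[X in _ = _ ^+ X]card_ord -prodr_const.
by rewrite [RHS](bigD1 i).
Qed.

End counting.

Section bad_fraction.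
Context {R : realType} {d : nat}.
Notation X := (Rd R d).

(** The pairs both of whose ends have depth more than [c] in the cube. The cut-off
    function is 1 at both ends for [c = 2]; both ends are in the cube for
    [c = 0]. *)
Definition inner (c L : R) (xi : X) : set X :=
  [set y : X | (forall i, c < y.1 i ord0 < L - c) /\
               (forall i, c < (y.1 + xi.1) i ord0 < L - c)].

Notation box N := {ffun 'I_d.-1 -> 'I_N}.

(** A bound, uniform in the base point, for the proportion of the integer
    translations by which a pair in the direction [xi] is not [inner], for
    depths up to 2; the minimum with 1 makes it a weight for dominated
    convergence. *)
Definition badfrac (N : nat) (xi : X) : R :=
  Num.min 1 (8 * d.-1%:R * (1 + xnorm xi) / N%:R).

Lemma card_box N : #|{: box N}|%:R = N%:R ^+ d.-1 :> R.
Proof. by rewrite card_ffun !card_ord natrX. Qed.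

(** If a translated pair is not [inner], then in some coordinate the index of the
    translation is within [c + 1 + xnorm xi] of one of the ends 0 and [N - 1]. *)
Lemma bad_count (c L : R) (N : nat) (xi x : X) : 0 <= c ->
  N%:R - 1 < L -> Hc 1 x.1 ->
  N%:R * \sum_(k : box N) (1 - \1_(inner c L xi) (hsh (vecn k) x)) <=
  N%:R ^+ d.-1 * (d.-1%:R * (2 * (c + 2 + xnorm xi))) :> R.
Proof.
move=> c0 NL xH; pose t := c + 1 + xnorm xi.
have t0 : 0 <= t by have := xnorm_ge0 xi; rewrite /t; lra.
pose g (j : 'I_N) : R := (j%:R <= t)%R%:R + ((rev_ord j)%:R <= t)%R%:R.
have g0 j : 0 <= g j by rewrite addr_ge0.
have gS : \sum_j g j <= 2 * (c + 2 + xnorm xi).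
  rewrite big_split/= -[X in _ + X](_ : \sum_(j < N) (j%:R <= t)%R%:R = _).
    by have := sum_le_threshold N t0; rewrite /t; lra.
  by rewrite [LHS](reindex_inj rev_ord_inj).
have bad k : 1 - \1_(inner c L xi) (hsh (vecn k) x) <= \sum_i g (k i).
  have [yi|yi] := pselect (inner c L xi (hsh (vecn k) x)).
    by rewrite (indic_in yi) subrr; apply: sumr_ge0 => i _.
  rewrite (indic_out yi) subr0.
  suff [i gi] : exists i, 1 <= g (k i).
    by rewrite (bigD1 i)//= (le_trans gi)// lerDl; apply: sumr_ge0 => i' _.
  have g1 (j : 'I_N) : (j%:R <= t)%R || (N%:R - 1 - j%:R <= t) -> 1 <= g j.
    have rj : (rev_ord j)%:R = N%:R - 1 - j%:R :> R.
      by rewrite /= natrB// -natr1; ring.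
    rewrite /g rj => /orP[->|->]; first by rewrite lerDl.
    by rewrite lerDr.
  have xin i : `|xi.1 i ord0| <= xnorm xi.
    exact: le_trans (snorm_ge _ _) (snorm_le_xnorm _).
  have x0 : 0 <= xnorm xi by exact: xnorm_ge0.
  apply: contrapT => hk; apply: yi.
  have hk' i : ~~ ((k i)%:R <= t) /\ ~~ (N%:R - 1 - (k i)%:R <= t).
    apply/andP; rewrite -negb_or; apply/negP => h; apply: hk.
    by exists i; exact: g1.
  split=> i; have [] := hk' i; rewrite -!ltNge /t /= !mxE => h1 h2;
    have /andP[h3 h4] := xH i; have := xin i; rewrite ler_norml => /andP[h5 h6];
    apply/andP; split; lra.
apply: (@le_trans _ _ (N%:R * \sum_(k : box N) \sum_i g (k i))).
  by apply: ler_wpM2l => //; apply: ler_sum => k _; exact: bad.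
rewrite exchange_big/= mulr_sumr; under eq_bigr do rewrite sum_ffun_coor.
rewrite -mulr_sumr; apply: ler_wpM2l; first by rewrite exprn_ge0.
by rewrite sumr_const card_ord -[leLHS]mulr_natl; exact: ler_wpM2l.
Qed.

Lemma bad_fraction (c L : R) (N : nat) (xi x : X) : 0 <= c <= 2 -> (0 < N)%N ->
  N%:R - 1 < L -> Hc 1 x.1 ->
  (N%:R ^+ d.-1)^-1 * \sum_(k : box N) (1 - \1_(inner c L xi) (hsh (vecn k) x)) <=
  badfrac N xi.
Proof.
move=> /andP[c0 c2] N0 NL xH.
have N0' : 0 < N%:R :> R by rewrite ltr0n.
have Nn0 : 0 < N%:R ^+ d.-1 :> R by rewrite exprn_gt0.
rewrite /badfrac le_min; apply/andP; split; rewrite ler_pdivrMl//.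
  rewrite mulr1 -card_box -sumr_const; apply: ler_sum => k _.
  by rewrite gerBl indic_ge0.
rewrite mulrA ler_pdivlMr// mulrC.
apply: (le_trans (bad_count xi c0 NL xH)); apply: ler_wpM2l; first exact: ltW.
rewrite mulrAC mulrC -[leRHS]mulrA [leRHS]mulrA; apply: ler_wpM2r => //.
by have := xnorm_ge0 xi; lra.
Qed.

Lemma badfrac01 N xi : 0 <= badfrac N xi <= 1.
Proof.
rewrite /badfrac le_min ler01/= ge_min lexx/= andbT.
by have := xnorm_ge0 xi => x0; rewrite divr_ge0// !mulr_ge0//; lra.
Qed.

Lemma measurable_xnorm : measurable_fun setT (@xnorm R d).
Proof. by rewrite /xnorm; mfun. Qed.

Lemma measurable_badfrac N : measurable_fun setT (badfrac N).
Proof.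
have mx := measurable_xnorm.
by apply: measurable_minr => //; mfun.
Qed.

Lemma badfrac_cvg0 xi : badfrac ^~ xi @ \oo --> (0 : R).
Proof.
pose K : R := 8 * d.-1%:R * (1 + xnorm xi).
have K0 : 0 <= K by have := xnorm_ge0 xi => x0; rewrite !mulr_ge0//; lra.
apply/cvgrPdist_le => e e0; near=> N.
have N0 : (0 < N)%N by near: N; exact: nbhs_infty_gt.
have N0' : 0 < N%:R :> R by rewrite ltr0n.
have /andP[f0 _] := badfrac01 N xi.
rewrite sub0r normrN ger0_norm// /badfrac ge_min; apply/orP; right.
rewrite -/K ler_pdivrMr// mulrC -ler_pdivrMr//; near: N.
exact: nbhs_infty_ger.
Unshelve. all: by end_near. Qed.

Lemma badfrac_powR_cvg0 (q : R) xi : 0 < q -> (fun N => badfrac N xi `^ q) @ \oo --> (0 : R).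
Proof.
move=> q0; apply/cvgrPdist_le => e e0.
have e1 : 0 < e `^ q^-1 by exact: powR_gt0.
have := badfrac_cvg0 xi => /cvgrPdist_le/(_ _ e1); apply: filterS => N.
have /andP[f0 _] := badfrac01 N xi.
rewrite !sub0r !normrN ger0_norm// ger0_norm ?powR_ge0// => h.
have := le_powR (ltW q0) f0 h; rewrite -powRrM mulVf ?gt_eqF// powRr1//.
exact: ltW.
Qed.

End bad_fraction.

Section unit_boxes.
Context {R : realType} {d : nat}.
Notation X := (Rd R d).

Lemma integral_unit_box_sum N (F : X -> R) :
  measurable_fun setT F -> (forall x, 0 <= F x) ->
  (\int[vol]_x (\1_(Hc N%:R) x.1 * F x)%:E = \int[vol]_x (\1_(Hc 1) x.1 *
    \sum_(k : {ffun 'I_d.-1 -> 'I_N}) F (hsh (vecn k) x))%:E)%E.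
Proof.
move=> mF F0; have := integral_box_sum N (ltr01 : 0 < 1 :> R) mF F0.
rewrite mulr1 => ->; apply: eq_integral => x _.
by under eq_bigr do rewrite scale1r.
Qed.

Lemma integral_slab (P : R) : 0 <= P ->
  (\int[vol]_x (\1_(@Hc R d.-1 P) x.1 * \1_II x.2)%:E = (P ^+ d.-1 * 2)%:E)%E.
Proof.
move=> P0; rewrite integral_indicX; last 2 first.
- exact: measurable_Hc.
- exact: measurable_itv.
rewrite leb_Hc// /II leb1_itv ?opprK; last by rewrite lerNl (le_trans _ ler01)// lerN10.
by rewrite -EFinM.
Qed.

(** A translation by an integer vector permutes the residues modulo [N]. *)
Lemma sum_box_periodic (V : zmodType) N (F : X -> V) (j : 'cV[int]_d.-1) x :
  (0 < N)%N -> hperiodic N%:R F ->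
  \sum_(k : {ffun 'I_d.-1 -> 'I_N}) F (hsh (vecn k) (hsh (map_mx intr j) x)) =
  \sum_(k : {ffun 'I_d.-1 -> 'I_N}) F (hsh (vecn k) x).
Proof.
move=> N0 FN.
have NZ : (N%:Z != 0)%R by rewrite lt0r_neq0.
have mlt (k : {ffun 'I_d.-1 -> 'I_N}) i :
    (`|(((k i)%:Z + j i ord0) %% N%:Z)%Z|%N < N)%N.
  by rewrite -ltz_nat gez0_abs ?modz_ge0// ltz_pmod.
pose h (k : {ffun 'I_d.-1 -> 'I_N}) : {ffun 'I_d.-1 -> 'I_N} := [ffun i => Ordinal (mlt k i)].
have hE k i : (h k i : nat)%:Z = (((k i)%:Z + j i ord0) %% N%:Z)%Z.
  by rewrite ffunE/= gez0_abs ?modz_ge0.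
have hI : injective h.
  move=> k k' kk'; apply/ffunP => i; apply/val_inj.
  have : ((k i)%:Z + j i ord0 = (k' i)%:Z + j i ord0 %[mod N%:Z])%Z.
    by rewrite -!hE kk'.
  move=> /eqP; rewrite eqz_modDr => /eqP.
  by rewrite !modz_nat !modn_small// => -[].
rewrite [RHS](reindex_inj hI); apply: eq_bigr => k _.
pose q : 'cV[int]_d.-1 := \col_i (((k i)%:Z + j i ord0) %/ N%:Z)%Z.
rewrite -[RHS](FN q) !hshD; congr (F (hsh _ _)).
apply/matrixP => i z; rewrite !mxE (ord1 z).
have := divz_eq ((k i)%:Z + j i ord0) N%:Z; rewrite -hE => /(congr1 (intr : int -> R)).
rewrite !intrD intrM !pmulrn => e.
by rewrite addrC [RHS]addrC [X in _ = X + _]mulrC; exact: e.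
Qed.

End unit_boxes.

(** * Energies as iterated integrals *)

Section double_integral.
Context {R : realType} {d : nat}.
Notation X := (Rd R d).

Definition dint (F : X -> X -> R) : \bar R :=
  (\int[vol]_xi \int[vol]_x (F xi x)%:E)%E.

Definition jmeas (F : X -> X -> R) :=
  measurable_fun setT (fun z : X * X => F z.1 z.2).

Lemma dintE F : jmeas F -> (forall xi x, 0 <= F xi x) ->
  dint F = (\int[vol \x vol]_z (F z.1 z.2)%:E)%E.
Proof.
move=> mF F0; rewrite (@fubini_tonelli1 _ _ _ _ R vol vol (fun z => (F z.1 z.2)%:E))//.
  exact/measurable_EFinP.
by move=> z; rewrite lee_fin.
Qed.

Lemma jmeas_slice F xi : jmeas F -> measurable_fun setT (F xi).
Proof. by move=> mF; exact: (measurableT_comp mF (measurable_pair1 xi)). Qed.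

Lemma dint_ge0 F : (forall xi x, 0 <= F xi x) -> (0 <= dint F)%E.
Proof. by move=> F0; apply: integral_ge0 => xi _; exact: integral_EFin_ge0. Qed.

Lemma le_dint F G : jmeas F -> jmeas G -> (forall xi x, 0 <= F xi x) ->
  (forall xi x, F xi x <= G xi x) -> (dint F <= dint G)%E.
Proof.
move=> mF mG F0 FG.
have G0 xi x : 0 <= G xi x by exact: le_trans (F0 _ _) (FG _ _).
by rewrite !dintE//; apply: ge0_le_integral_EFin.
Qed.

Lemma dintD F G : jmeas F -> jmeas G -> (forall xi x, 0 <= F xi x) ->
  (forall xi x, 0 <= G xi x) ->
  dint (fun xi x => F xi x + G xi x) = (dint F + dint G)%E.
Proof.
move=> mF mG F0 G0.
have FG0 xi x : 0 <= F xi x + G xi x by rewrite addr_ge0.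
have mFG : jmeas (fun xi x => F xi x + G xi x) by exact: measurable_funD.
rewrite (dintE mFG FG0) (dintE mF F0) (dintE mG G0).
by apply: ge0_integral_EFinD.
Qed.

Lemma dintZ F c : jmeas F -> (forall xi x, 0 <= F xi x) -> 0 <= c ->
  dint (fun xi x => c * F xi x) = (c%:E * dint F)%E.
Proof.
move=> mF F0 c0.
have cF0 xi x : 0 <= c * F xi x by rewrite mulr_ge0.
have mcF : jmeas (fun xi x => c * F xi x).
  by apply: measurable_funM => //; exact: measurable_cst.
by rewrite (dintE mcF cF0) (dintE mF F0); apply: ge0_integral_EFinZ.
Qed.

Lemma dint_fst (a : X -> R) (B : X -> X -> R) (b : \bar R) :
  measurable_fun setT a -> (forall xi, 0 <= a xi) ->
  jmeas B -> (forall xi x, 0 <= B xi x) -> (0 <= b)%E ->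
  (forall xi, \int[vol]_x (B xi x)%:E <= b)%E ->
  (dint (fun xi x => a xi * B xi x)%R <= b * \int[vol]_xi (a xi)%:E)%E.
Proof.
move=> ma a0 mB B0 b0 Bb.
rewrite -ge0_integralZl//; last 2 first.
- exact/measurable_EFinP.
- by move=> xi _; rewrite lee_fin.
apply: ge0_le_integral => //.
- by move=> xi _; apply: integral_EFin_ge0 => x; rewrite mulr_ge0.
- apply: (@measurable_integral2 R _ _ _ _ vol (fun z : X * X => (a z.1 * B z.1 z.2)%:E)).
    apply/measurable_EFinP; apply: measurable_funM => //.
    exact: (measurableT_comp ma measurable_fst).
  by move=> z; rewrite lee_fin mulr_ge0.
- by apply: emeasurable_funM; [exact: measurable_cst|exact/measurable_EFinP].
move=> xi _; rewrite (ge0_integral_EFinZ vol (jmeas_slice xi mB) (B0 xi) (a0 xi)) muleC.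
by apply: lee_wpmul2r; [rewrite lee_fin|exact: Bb].
Qed.

Lemma dint_weight_small (h : X -> X -> R) (b : nat -> X -> R) :
  jmeas h -> (forall xi x, 0 <= h xi x) -> (dint h < +oo)%E ->
  (forall N, measurable_fun setT (b N)) ->
  (forall N xi, 0 <= b N xi <= 1) ->
  (forall xi, b ^~ xi @ \oo --> (0 : R)) ->
  forall e : R, 0 < e ->
    \forall N \near \oo, (dint (fun xi x => b N xi * h xi x)%R <= e%:E)%E.
Proof.
move=> mh h0 hoo mb b01 b0 e e0; rewrite (dintE mh h0) in hoo.
have mb2 N : measurable_fun setT (fun z : X * X => b N z.1).
  exact: (measurableT_comp (mb N) measurable_fst).
have := integral_weight_small mh (fun z => h0 z.1 z.2) hoo mb2
  (fun N z => b01 N z.1) (fun z => b0 z.1) e0.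
apply: filterS => N; rewrite dintE//.
- exact: measurable_funM.
- by move=> xi x; have /andP[? _] := b01 N xi; rewrite mulr_ge0.
Qed.

End double_integral.

Section setup.
Context {R : realType} {d m : nat}.
Notation X := (Rd R d).
Variables (p delta : R) (f : X -> X -> 'cV[R]_m -> R).
Hypotheses (p1 : 1 < p) (delta0 : 0 < delta).
Hypothesis f_ge0 : forall x xi z, 0 <= f x xi z.
Hypothesis f_borel : measurable_fun setT
  (fun t : X * X * 'cV[R]_m => f t.1.1 t.1.2 t.2).

Local Notation ps := (pshift delta).
Local Notation kappa := (Num.max delta 1).

Lemma kappa_gt0 : 0 < kappa.
Proof. by rewrite lt_max delta0. Qed.

Definition slab (xi x : X) : R := \1_II x.2 * \1_II (ps xi x).2.

Lemma slab_ge0 xi x : 0 <= slab xi x.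
Proof. by rewrite mulr_ge0 ?indic_ge0. Qed.

Definition dens (v : X -> 'cV[R]_m) (xi x : X) : R := f x xi (v (ps xi x) - v x).

Lemma dens_ge0 v xi x : 0 <= dens v xi x.
Proof. exact: f_ge0. Qed.

Lemma jmeas_slab : jmeas slab.
Proof. by have mI := @measurable_II R; rewrite /jmeas /slab; mfun. Qed.

Lemma jmeas_dens v : measurable_fun setT v -> jmeas (dens v).
Proof.
move=> mv; rewrite /jmeas /dens.
apply: (measurableT_comp f_borel
  (g := fun z : X * X => (z.2, z.1, (v (pshift delta z.1 z.2) - v z.2)%R))).
by mfun.
Qed.

(** Both energies are integrals over a horizontal cell; as pairs must stay in the
    slab, [slab] is common to them and [pairs] is specific to the cube. *)
Definition cell (P : R) (xi x : X) : R := \1_(Hc P) x.1 * slab xi x.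

Lemma cell_ge0 P xi x : 0 <= cell P xi x.
Proof. by rewrite mulr_ge0 ?indic_ge0 ?slab_ge0. Qed.

Lemma jmeas_cell P : jmeas (cell P).
Proof.
have mH := @measurable_Hc R d.-1 P.
by apply: measurable_funM; [mfun|exact: jmeas_slab].
Qed.

Lemma jmeasM F G : jmeas F -> jmeas G -> jmeas (fun xi x : X => F xi x * G xi x).
Proof. exact: measurable_funM. Qed.

Lemma jmeas_fst a : measurable_fun setT a -> jmeas (fun xi _ : X => a xi).
Proof. by move=> ma; exact: (measurableT_comp ma measurable_fst). Qed.

Definition per_dom (xi : X) : set X := cube 1 `*` Idelta delta xi.2.

Lemma measurable_per_dom xi : measurable (per_dom xi).
Proof.
apply: measurableX; first exact: measurable_cube.
have -> : Idelta delta xi.2 = II `&` (fun s => s + delta * xi.2) @^-1` II by [].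
apply: measurableI; first exact: measurable_itv.
rewrite -[X in measurable X]setTI.
have ms : measurable_fun setT (fun s : R => s + delta * xi.2) by mfun.
by apply: ms => //; exact: measurable_itv.
Qed.

Lemma energy_perE v : measurable_fun setT v ->
  energy f delta per_dom v =
  (kappa%:E * dint (fun xi x => cell 1 xi x * dens v xi x)%R)%E.
Proof.
move=> mv; rewrite /energy /dint; congr (_ * _)%E; apply: eq_integral => xi _.
have mD := measurable_per_dom xi.
have mg : measurable_fun setT (fun x => slab xi x * dens v xi x).
  by apply: measurable_funM; apply: jmeas_slice; [exact: jmeas_slab|exact: jmeas_dens].
rewrite (integral_indicM _ _ mD).
under [RHS]eq_integral do rewrite -mulrA.
rewrite integral_cube1_Hc1//; last by move=> x; rewrite mulr_ge0 ?slab_ge0 ?dens_ge0.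
apply: eq_integral => x _; rewrite mulrA; congr (_ * _)%:E.
rewrite /slab /per_dom !indicE -natrM -natrM !mulnb; congr (nat_of_bool _)%:R.
by rewrite in_setX; congr andb; rewrite in_setI.
Qed.

Lemma measurable_int1 (L : R) xi : measurable (int1 delta L xi : set X).
Proof.
have mC : measurable (cube L `*` II : set X).
  by apply: measurableX; [exact: measurable_cube|exact: measurable_itv].
have -> : int1 delta L xi = (cube L `*` II) `&` (ps xi) @^-1` (cube L `*` II) by [].
apply: measurableI => //; rewrite -[X in measurable X]setTI.
have mp : measurable_fun setT (fun x : X => ps xi x) by mfun.
exact: mp.
Qed.

Definition pairs (L : R) (xi x : X) : R := \1_(cube L) x.1 * \1_(cube L) (ps xi x).1.

Lemma pairs_ge0 L xi x : 0 <= pairs L xi x.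
Proof. by rewrite mulr_ge0 ?indic_ge0. Qed.

Lemma jmeas_pairs L : jmeas (pairs L).
Proof. by have mC := @measurable_cube R d.-1 L; rewrite /jmeas /pairs; mfun. Qed.

Lemma energy_int1E L P v : L <= P -> measurable_fun setT v ->
  energy f delta (int1 delta L) v =
  (kappa%:E * dint (fun xi x => cell P xi x * (pairs L xi x * dens v xi x))%R)%E.
Proof.
move=> LP mv; rewrite /energy /dint; congr (_ * _)%E; apply: eq_integral => xi _.
rewrite (integral_indicM _ _ (measurable_int1 _ _)); apply: eq_integral => x _.
rewrite mulrA; congr (_ * _)%:E.
have -> : cell P xi x * pairs L xi x = slab xi x * pairs L xi x.
  rewrite /cell mulrAC [LHS]mulrC; congr (_ * _); rewrite /pairs mulrA.
  congr (_ * _); have [xL|xL] := pselect (cube L x.1); last first.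
    by rewrite (indic_out xL) mulr0.
  rewrite (indic_in xL) mulr1 indic_in// => i.
  by have /andP[/ltW -> h] := xL i; rewrite (lt_le_trans h).
rewrite /slab /pairs !indicE -!natrM !mulnb; congr (nat_of_bool _)%:R.
apply/idP/idP => [/set_mem [[a b] [c e]]|]; first by rewrite !mem_set.
move=> /andP[/andP[/set_mem a /set_mem b] /andP[/set_mem c /set_mem e]].
by apply/mem_set.
Qed.

End setup.

(** * A cut-off function for the cube *)

Section cutoff.
Context {R : realType} {n : nat}.
Implicit Types (L : R) (y : 'cV[R]_n).

Definition layer L y : R :=
  \sum_i (Num.max 0 (2 - y i ord0) + Num.max 0 (y i ord0 - (L - 2))).

(** A Lipschitz function that vanishes in the boundary layer of width 1 where the
    competitors are affine, and is 1 at depth more than 2. *)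
Definition cutoff L y : R := Num.max 0 (1 - layer L y).

Lemma max0_lip (a b : R) : `|Num.max 0 a - Num.max 0 b| <= `|a - b|.
Proof.
by case: (lerP 0 a) => a0; case: (lerP 0 b) => b0;
  rewrite ler_norml; have := ler_norm (a - b); have := ler_norm (- (a - b));
  rewrite normrN => ? ?; apply/andP; split; lra.
Qed.

Lemma max0_ge0 (a : R) : 0 <= Num.max 0 a.
Proof. by rewrite le_max lexx. Qed.

Lemma layer_ge0 L y : 0 <= layer L y.
Proof. by apply: sumr_ge0 => i _; rewrite addr_ge0 ?max0_ge0. Qed.

Lemma cutoff_ge0 L y : 0 <= cutoff L y.
Proof. exact: max0_ge0. Qed.

Lemma cutoff_le1 L y : cutoff L y <= 1.
Proof. by rewrite /cutoff ge_max ler01/= gerBl layer_ge0. Qed.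

Lemma cutoff_inner L y : (forall i, 2 < y i ord0 < L - 2) -> cutoff L y = 1.
Proof.
move=> h; rewrite /cutoff [layer L y](_ : _ = 0) ?subr0 ?max_r//.
rewrite /layer big1// => i _; have /andP[h1 h2] := h i.
by rewrite !max_l ?addr0//; lra.
Qed.

Lemma cutoff_outer L y i : y i ord0 < 1 \/ L - 1 < y i ord0 -> cutoff L y = 0.
Proof.
move=> h; rewrite /cutoff max_l// subr_le0 /layer (bigD1 i)//=.
apply: (@le_trans _ _ (Num.max 0 (2 - y i ord0) + Num.max 0 (y i ord0 - (L - 2)))).
  case: h => h.
    apply: (@le_trans _ _ (Num.max 0 (2 - y i ord0))).
      by rewrite le_max; apply/orP; right; lra.
    by rewrite lerDl max0_ge0.
  apply: (@le_trans _ _ (Num.max 0 (y i ord0 - (L - 2)))).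
    by rewrite le_max; apply/orP; right; lra.
  by rewrite lerDr max0_ge0.
by rewrite lerDl; apply: sumr_ge0 => j _; rewrite addr_ge0 ?max0_ge0.
Qed.

Lemma cutoff_lip L y (xi : 'cV[R]_n) :
  `|cutoff L (y + xi) - cutoff L y| <= 2 * snorm xi.
Proof.
apply: le_trans (max0_lip _ _) _.
have -> : 1 - layer L (y + xi) - (1 - layer L y) = layer L y - layer L (y + xi) by ring.
rewrite /layer -sumrB /snorm mulr_sumr; apply: le_trans (ler_norm_sum _ _ _) _.
apply: ler_sum => i _; rewrite mxE.
have ACA (a b c e : R) : a + b - (c + e) = (a - c) + (b - e) by ring.
rewrite ACA.
apply: le_trans (ler_normD _ _) _; rewrite mulr_natl mulr2n; apply: lerD.
  apply: le_trans (max0_lip _ _) _; rewrite le_eqVlt; apply/orP; left.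
  by apply/eqP; congr (`| _ |); ring.
apply: le_trans (max0_lip _ _) _; rewrite le_eqVlt; apply/orP; left.
by apply/eqP; rewrite -normrN; congr (`| _ |); ring.
Qed.

Lemma measurable_cutoff L : measurable_fun setT (cutoff L).
Proof.
rewrite /cutoff; apply: measurable_maxr; first exact: measurable_cst.
apply: measurable_funB; first exact: measurable_cst.
rewrite /layer; apply: measurable_fsum => i.
apply: measurable_funD; apply: measurable_maxr; try exact: measurable_cst.
  by apply: measurable_funB; [exact: measurable_cst|exact: measurable_coor].
by apply: measurable_funB; [exact: measurable_coor|exact: measurable_cst].
Qed.

(** The distance is an infimum, hence some point outside the cube is at distance
    less than 1; it has a coordinate outside the interval from 0 to [L]. *)
Lemma eucl_dist_lt1 L y : (0 < n)%N -> eucl_dist y (~` cube L) < 1 ->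
  exists i, y i ord0 < 1 \/ L - 1 < y i ord0.
Proof.
move=> n0 h.
have S0 : [set enorm (y - z)%R | z in ~` cube L] !=set0.
  exists (enorm (y - 0)); exists 0 => //= /(_ (Ordinal n0)).
  by rewrite mxE ltxx.
have [_ [z hz <-] yz] := inf_lt S0 h.
apply: contrapT => hy; apply: hz => i; apply: contrapT => hi; apply: hy; exists i.
have := le_lt_trans (enorm_ge (y - z) i) yz; rewrite !mxE ltr_norml => /andP[h1 h2].
have [z0|z0] := lerP (z i ord0) 0; first by left; lra.
have [zL|zL] := ltrP (z i ord0) L; last by right; lra.
by exfalso; apply: hi; rewrite z0 zL.
Qed.

(** Moving the coordinate [i] alone to the nearest end of its range leaves the
    cube. *)
Lemma eucl_dist_lt1_coor L y i : y i ord0 < 1 \/ L - 1 < y i ord0 ->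
  eucl_dist y (~` cube L) < 1.
Proof.
have key a : (a <= 0 \/ L <= a) -> `|y i ord0 - a| < 1 ->
    eucl_dist y (~` cube L) < 1.
  move=> ha ya; pose z : 'cV[R]_n := \col_j (if j == i then a else y j ord0).
  have zC : (~` cube L) z.
    by move=> /(_ i); rewrite mxE eqxx => /andP[h1 h2]; case: ha => ?; lra.
  have yz : enorm (y - z) <= `|y i ord0 - a|.
    apply: le_trans (enorm_le_snorm _) _; rewrite /snorm (bigD1 i)//= big1.
      by rewrite addr0 !mxE eqxx.
    by move=> j /negPf ji; rewrite !mxE ji subrr normr0.
  apply: (le_lt_trans _ ya); apply: (le_trans _ yz); apply: ge_inf; last by exists z.
  by exists 0 => _ [t _ <-]; exact: enorm_ge0.
move=> [h|h].
  have [y0|y0] := lerP (y i ord0) 0.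
    by apply: (key (y i ord0)); [left|rewrite subrr normr0].
  by apply: (key 0); [left|rewrite subr0 ger0_norm// ltW].
have [yL|yL] := lerP L (y i ord0).
  by apply: (key (y i ord0)); [right|rewrite subrr normr0].
by apply: (key L); [right|rewrite ltr_norml; apply/andP; split; lra].
Qed.

End cutoff.

(** * Periodic representatives and perturbed averages *)

Section reduction.
Context {R : realType} {d : nat}.
Notation X := (Rd R d).
Variable P : R.
Hypothesis P0 : 0 < P.

Definition floorv (y : 'cV[R]_d.-1) : 'cV[int]_d.-1 :=
  \col_i Num.floor (y i ord0 / P).

(** The representative of [x] in the half-open cell of side [P]. *)
Definition red (x : X) : X := hsh (- (P *: map_mx intr (floorv x.1))) x.

Lemma red_id x : Hc P x.1 -> red x = x.
Proof.
move=> xH; rewrite /red (_ : floorv x.1 = 0).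
  rewrite (_ : map_mx _ _ = 0); last by apply/matrixP => i j; rewrite !mxE.
  by rewrite scaler0 oppr0 /hsh addr0; case: x {xH}.
apply/matrixP => i j; rewrite !mxE; apply: floor_def.
have /andP[h1 h2] := xH i.
by rewrite divr_ge0 ?(ltW P0)//= add0r ltr_pdivrMr// mul1r.
Qed.

Lemma red_hsh (k : 'cV[int]_d.-1) x : red (hsh (P *: map_mx intr k) x) = red x.
Proof.
have e : floorv (x.1 + P *: map_mx intr k) = floorv x.1 + k.
  apply/matrixP => i j; rewrite !mxE (ord1 j) mulrDl mulrAC divff ?gt_eqF// mul1r.
  by rewrite floorDrz ?intrEfloor// ?intr_int// intrKfloor.
rewrite /red hshD /= e; congr hsh.
by apply/matrixP => i j; rewrite !mxE rmorphD/=; ring.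
Qed.

Lemma measurable_floorR : measurable_fun setT (fun t : R => (Num.floor t)%:~R : R).
Proof.
apply: nondecreasing_measurable => // x y xy.
by rewrite ler_int; exact: le_floor.
Qed.

Lemma measurable_red : measurable_fun setT red.
Proof.
apply: measurable_fun_pair => /=; last exact: measurable_snd.
apply: measurable_fun_cVP => i.
have m1 : measurable_fun setT (fun x : X => x.1 i ord0).
  by apply: measurable_cV_coor; exact: measurable_fst.
have m2 : measurable_fun setT (fun x : X => x.1 i ord0 / P) by mfun.
have m3 : measurable_fun setT (fun x : X => (Num.floor (x.1 i ord0 / P))%:~R : R).
  exact: (measurableT_comp measurable_floorR m2).
rewrite (_ : (fun _ => _) = (fun x : X => x.1 i ord0 - P * (Num.floor (x.1 i ord0 / P))%:~R)).
  by mfun.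
by apply/funext => x; rewrite !mxE.
Qed.

Lemma hperiodic_red T (F : X -> T) : hperiodic P (F \o red).
Proof. by move=> k x; rewrite /= red_hsh. Qed.

End reduction.

Section averages.
Context {R : realType}.

(** Jensen on the support of [b] only: the mean is the proportion of the support
    times the mean over it, and the power [p] of this proportion splits as its
    power [p - 1] times itself. *)
Lemma powR_avg_fraction (p : R) (I : finType) (b : pred I) (t : I -> R) (be : R) :
  1 <= p -> (0 < #|I|)%N -> (forall i, 0 <= t i) ->
  #|I|%:R^-1 * \sum_i (b i)%:R <= be ->
  (#|I|%:R^-1 * \sum_i (b i)%:R * t i) `^ p <=
  be `^ (p - 1) * (#|I|%:R^-1 * \sum_i (b i)%:R * t i `^ p).
Proof.
move=> p1 I0 t0 hb.
have n0 : 0 < #|I|%:R :> R by rewrite ltr0n.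
have nV0 : 0 <= #|I|%:R^-1 :> R by rewrite invr_ge0 ltW.
pose s := [seq i <- index_enum I | b i].
have sumE (F : I -> R) : \sum_i (b i)%:R * F i = \sum_(i <- s) F i.
  rewrite big_filter [RHS]big_mkcond; apply: eq_bigr => i _.
  by case: (b i); rewrite ?mul1r ?mul0r.
have sizeE : (size s)%:R = \sum_i (b i)%:R :> R.
  rewrite size_filter -sum1_count natr_sum [LHS]big_mkcond.
  by apply: eq_bigr => i _; case: (b i).
rewrite !sumE -sizeE in hb *.
have T0 : 0 <= \sum_(i <- s) t i `^ p by apply: sumr_ge0 => i _; exact: powR_ge0.
rewrite powRM ?sumr_ge0//.
apply: (@le_trans _ _ (#|I|%:R^-1 `^ p * ((size s)%:R `^ (p - 1) * \sum_(i <- s) t i `^ p))).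
  by apply: ler_wpM2l; [exact: powR_ge0|exact: powR_sum_le].
have -> : #|I|%:R^-1 `^ p = #|I|%:R^-1 * #|I|%:R^-1 `^ (p - 1) :> R.
  rewrite -[X in _ = X * _]powRr1// -powRD ?subrKC//.
  by apply/implyP => _; rewrite gt_eqF// invr_gt0.
rewrite mulrA -[X in X * _]mulrA -powRM// [leRHS]mulrA [X in _ <= X * _]mulrC.
apply: ler_wpM2r => //; apply: ler_wpM2l => //.
by apply: le_powR; rewrite ?subr_ge0// mulr_ge0.
Qed.

Lemma powR_avg (p : R) (I : finType) (t : I -> R) :
  1 <= p -> (0 < #|I|)%N -> (forall i, 0 <= t i) ->
  (#|I|%:R^-1 * \sum_i t i) `^ p <= #|I|%:R^-1 * \sum_i t i `^ p.
Proof.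
move=> p1 I0 t0.
have n0 : #|I|%:R != 0 :> R by rewrite pnatr_eq0 -lt0n.
have := @powR_avg_fraction p I xpredT t 1 p1 I0 t0.
rewrite powR1 mul1r /= sumr_const mulVf// => /(_ (lexx _)).
by under eq_bigr do rewrite mul1r; under [in leRHS]eq_bigr do rewrite mul1r.
Qed.

(** The mean of the [z i] is [a + r], where [a] is the mean of the [z' i] and [r]
    that of the differences. Writing it as the convex combination
    [s (a + r / s) + (1 - s) a], the growth of [g] bounds the first term, in
    which the power [p] of [r / s] costs [s ^ (1 - p)], and Jensen bounds the
    second one. The price for the perturbation is a small multiple of [G] and a
    large multiple of the power [p] of [r]. *)
Lemma convex_perturb (p : R) m (g : 'cV[R]_m -> R) (ps rh CL CU : R)
    (I : finType) (z z' : I -> 'cV[R]_m) (s G : R) :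
  1 <= p -> convex_function (setT : set 'cV[R]_m) g -> (forall y, 0 <= g y) ->
  0 <= ps -> 0 <= rh -> 0 <= CL -> 0 <= CU ->
  (forall y, ps * snorm y `^ p <= CL * (g y + rh)) ->
  (forall y, g y <= CU * (ps * snorm y `^ p + rh)) ->
  (0 < #|I|)%N -> 0 < s < 1 ->
  G = #|I|%:R^-1 * \sum_i g (z' i) ->
  g (#|I|%:R^-1 *: \sum_i z i) <=
    (1 + s * (CU * (2 `^ p * CL + 1))) * G + s * (CU * (2 `^ p * CL + 1)) * rh +
    s `^ (1 - p) * (CU * 2 `^ p) *
      (ps * snorm (#|I|%:R^-1 *: \sum_i (z i - z' i)) `^ p).
Proof.
move=> p1 cg g0 ps0 rh0 CL0 CU0 low up I0 /andP[s0 s1] GE.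
have p0 : 0 <= p by rewrite (le_trans _ p1).
have n0 : 0 < #|I|%:R :> R by rewrite ltr0n.
have nV0 : 0 <= #|I|%:R^-1 :> R by rewrite invr_ge0 ltW.
set a := #|I|%:R^-1 *: \sum_i z' i.
set r := #|I|%:R^-1 *: \sum_i (z i - z' i).
have G0 : 0 <= G by rewrite GE mulr_ge0// sumr_ge0.
have splitE (x y : 'cV[R]_m) : s *: (x + s^-1 *: y) + (1 - s) *: x = x + y.
  by apply/matrixP => i j; rewrite !mxE; field; rewrite gt_eqF.
have Ezar : #|I|%:R^-1 *: \sum_i z i = s *: (a + s^-1 *: r) + (1 - s) *: a.
  by rewrite splitE /a /r -scalerDr sumrB addrC subrK.
have aG : g a <= G by rewrite GE; exact: jensen_avg.
have pa : ps * snorm a `^ p <= CL * (G + rh).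
  apply: (@le_trans _ _ (ps * (#|I|%:R^-1 * \sum_i snorm (z' i) `^ p))).
    apply: ler_wpM2l => //; apply: (@le_trans _ _ ((#|I|%:R^-1 * \sum_i snorm (z' i)) `^ p)).
      apply: le_powR => //; first exact: snorm_ge0.
      by rewrite /a snormZ ger0_norm// ler_wpM2l// snorm_sum.
    by apply: powR_avg => // i; exact: snorm_ge0.
  rewrite mulrCA -ler_pdivlMl ?invr_gt0// invrK.
  have -> : #|I|%:R * (CL * (G + rh)) = \sum_i CL * (g (z' i) + rh).
    rewrite -mulr_sumr mulrCA big_split/= sumr_const -[rh *+ _]mulr_natl.
    by congr (CL * _); rewrite mulrDr GE mulrA divff ?mul1r// gt_eqF.
  by rewrite mulr_sumr; apply: ler_sum => i _; exact: low.
have sp0 : 0 <= s `^ (1 - p) by exact: powR_ge0.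
have R0 : 0 <= ps * snorm r `^ p by rewrite mulr_ge0 ?powR_ge0.
have big : s * (ps * snorm (a + s^-1 *: r) `^ p) <=
    2 `^ p * (s * (CL * (G + rh)) + s `^ (1 - p) * (ps * snorm r `^ p)).
  have -> : s `^ (1 - p) = s * s^-1 `^ p.
    by rewrite -[in RHS](powR_inv1 (ltW s0)) -powRrM mulN1r powRD ?powRr1 ?ltW//;
      apply/implyP => _; rewrite gt_eqF.
  have -> : 2 `^ p * (s * (CL * (G + rh)) + s * s^-1 `^ p * (ps * snorm r `^ p)) =
     s * (2 `^ p * (CL * (G + rh) + s^-1 `^ p * (ps * snorm r `^ p))) by ring.
  apply: ler_wpM2l; first exact: ltW.
  apply: (@le_trans _ _ (ps * (2 `^ p * (snorm a `^ p + snorm (s^-1 *: r) `^ p)))).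
    apply: ler_wpM2l => //; apply: (@le_trans _ _ ((snorm a + snorm (s^-1 *: r)) `^ p)).
      by apply: le_powR => //; [exact: snorm_ge0|exact: snormD].
    exact: powRD_le p1 (snorm_ge0 _) (snorm_ge0 _).
  rewrite mulrCA; apply: ler_wpM2l; first exact: powR_ge0.
  rewrite mulrDr; apply: lerD => //.
  have sV0 : 0 <= s^-1 by rewrite invr_ge0 ltW.
  by rewrite snormZ (ger0_norm sV0) (powRM _ sV0 (snorm_ge0 r)) mulrCA.
have s01 : 0 <= s <= 1 by rewrite !ltW.
rewrite Ezar; apply: (le_trans (convex_functionE cg (a + s^-1 *: r) a s01)).
have h1 : s * g (a + s^-1 *: r) <= CU * (2 `^ p * (s * (CL * (G + rh)) +
    s `^ (1 - p) * (ps * snorm r `^ p)) + s * rh).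
  apply: (@le_trans _ _ (s * (CU * (ps * snorm (a + s^-1 *: r) `^ p + rh)))).
    by apply: ler_wpM2l; [exact: ltW|exact: up].
  rewrite mulrCA; apply: ler_wpM2l => //; rewrite mulrDr.
  by apply: lerD.
have h2 : (1 - s) * g a <= G.
  by apply: (le_trans _ aG); apply: ler_piMl; [exact: g0|rewrite gerBl ltW].
apply: (le_trans (lerD h1 h2)).
have X0 : 0 <= CU * s * G by rewrite !mulr_ge0// ltW.
rewrite -subr_ge0; set q := s `^ (1 - p); set T := ps * snorm r `^ p; set K := 2 `^ p.
have -> : (1 + s * (CU * (K * CL + 1))) * G + s * (CU * (K * CL + 1)) * rh +
  q * (CU * K) * T - (CU * (K * (s * (CL * (G + rh)) + q * T) + s * rh) + G) = CU * s * G by ring.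
exact: X0.
Qed.

End averages.

Lemma scaled_half_le {R : realType} (e K : R) : 0 <= K -> 0 < e ->
  e / (2 * (K + 1)) * K <= e / 2.
Proof.
move=> K0 e0; have K1 : 0 < K + 1 by rewrite ltr_wpDl.
have -> : e / (2 * (K + 1)) * K = e / 2 * (K / (K + 1)).
  by field; rewrite gt_eqF//= gt_eqF// ltr0n.
rewrite ler_piMr//; first by rewrite divr_ge0 ?ltW// ltr0n.
by rewrite ler_pdivrMr// mul1r lerDl.
Qed.

Section representative.
Context {R : realType} {d m : nat}.
Notation X := (Rd R d).
Variables (p : R) (p1 : 1 <= p) (M : 'M[R]_(m, d.-1)) (u : X -> 'cV[R]_m).
Hypothesis uD : Dper p M u.

(** The periodicity of a class in [Dper] holds for almost every point only;
    reading [u] on the unit cell gives a corrector that is periodic everywhere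
    and equal to it almost everywhere. *)
Definition per_corr (x : X) : 'cV[R]_m := u (red 1 x) - M *m (red 1 x).1.

Let mu : measurable_fun setT u. Proof. by case: uD => -[]. Qed.

Lemma measurable_per_corr : measurable_fun setT per_corr.
Proof.
have mr := @measurable_red R d 1.
have m1 : measurable_fun setT (fun x => u (red 1 x)) by exact: (measurableT_comp mu mr).
rewrite /per_corr; apply: measurable_cVB => //.
by apply: measurable_mulmx; exact: (measurableT_comp measurable_fst mr).
Qed.

Lemma hperiodic_per_corr : hperiodic 1 per_corr.
Proof. exact: (hperiodic_red ltr01 (fun x => u x - M *m x.1)). Qed.

Lemma per_corr_ae : {ae vol, forall x, u x = M *m x.1 + per_corr x}.
Proof.
have [_ h] := uD.
pose Q (n : nat) (x : X) : Prop := forall k : 'cV[int]_d.-1, unpickle n = Some k ->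
  u (hsh (map_mx intr k) x) - M *m (hsh (map_mx intr k) x).1 = u x - M *m x.1.
have : {ae vol, forall x, forall n, Q n x}.
  apply: ae_foralln => n; rewrite /Q; case: (unpickle n) => [k|]; last exact: aeW.
  by apply: filterS (h k) => x hx k' [<-].
apply: filterS => x /(_ _ (- floorv 1 x.1) (pickleK _)).
have -> : hsh (map_mx intr (- floorv 1 x.1)) x = red 1 x.
  rewrite /red; congr hsh; apply/matrixP => i j.
  by rewrite scale1r !mxE rmorphN.
by rewrite -/(per_corr x) => ->; rewrite addrC subrK.
Qed.

Lemma per_corr_cbox (A : R) :
  (\int[vol]_x (\1_(cbox A) x * snorm (per_corr x) `^ p)%:E < +oo)%E.
Proof.
have mw := measurable_per_corr.
have mM : measurable_fun setT (fun x : X => M *m x.1) by mfun.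
have uL : Lploc p u by case: uD.
apply: (cbox_le_add p1 mw mu mM _ (Lploc_cbox p1 _ uL) (cbox_affine p1 M A)).
by apply: filterS per_corr_ae => x ->; exact: snorm_le_addl.
Qed.

Lemma per_corr_cell :
  (\int[vol]_x (\1_(Hc 1) x.1 * (\1_II x.2 * snorm (per_corr x) `^ p))%:E < +oo)%E.
Proof.
have mH := @measurable_Hc R d.-1 1; have mI := @measurable_II R.
have mA := @measurable_cbox R d 1; have mw := measurable_per_corr.
apply: le_lt_trans (per_corr_cbox 1); apply: ge0_le_integral_EFin.
- by mfun.
- by mfun.
- by move=> x; rewrite !mulr_ge0 ?indic_ge0 ?powR_ge0.
- move=> x; rewrite mulrA; apply: ler_wpM2r; first exact: powR_ge0.
  have [xH|xH] := pselect (Hc 1 x.1); last by rewrite (indic_out xH) mul0r indic_ge0.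
  have [xI|xI] := pselect (II x.2); last by rewrite (indic_out xI) mulr0 indic_ge0.
  have xA : cbox 1 x.
    split=> [i|]; first by have /andP[h1 h2] := xH i; rewrite ger0_norm// ltW.
    by move: xI; rewrite /II/= in_itv/= -ltr_norml => /ltW.
  by rewrite (indic_in xA) (indic_in xH) mul1r indic_le1.
Qed.

End representative.

Section blocks.
Context {R : realType}.

Lemma block_index (L : R) : 0 < L -> exists N : nat, N%:R - 1 < L /\ L <= N%:R.
Proof.
move=> L0; have /andP[h1 h2] := truncn_itv (ltW L0).
have [e|e] := eqVneq L (Num.truncn L)%:R.
  by exists (Num.truncn L); rewrite -e; split=> //; rewrite ltrBlDr ltrDl.
exists (Num.truncn L).+1; split; last exact: ltW.
by rewrite -natr1 addrK lt_neqAle eq_sym e.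
Qed.

(** Every large real [L] lies in one interval from [N - 1], excluded, to [N] with
    [N] large. *)
Lemma near_block (Q : nat -> R -> Prop) :
  (\forall N \near \oo, forall L, N%:R - 1 < L -> L <= N%:R -> Q N L) ->
  \forall L \near +oo, exists N : nat, [/\ N%:R - 1 < L, L <= N%:R & Q N L].
Proof.
case=> N0 _ hN0; near=> L.
have L0 : 0 < L by near: L; exact: nbhs_pinfty_gt.
have [N [NL LN]] := block_index L0; exists N; split => //; apply: hN0 => //=.
rewrite -(ler_nat R); apply: le_trans LN.
by near: L; exact: nbhs_pinfty_ge.
Unshelve. all: by end_near. Qed.

(** For [t = 1 / L] this compares the volumes of the cubes of sides [L] and
    [L + 1]. *)
Lemma exprDl_le (n : nat) (t : R) : 0 <= t -> t <= 1 -> (1 + t) ^+ n <= 1 + 3 ^+ n * t.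
Proof.
move=> t0 t1; elim: n => [|n IH]; first by rewrite !expr0 lerDl mul1r.
have h3 : 1 <= 3 ^+ n :> R by rewrite exprn_ege1// ler1n.
rewrite exprS; apply: (@le_trans _ _ ((1 + t) * (1 + 3 ^+ n * t))).
  by apply: ler_wpM2l => //; rewrite addr_ge0.
rewrite [3 ^+ n.+1]exprS; set a := 3 ^+ n in h3 *.
have h : a * t * t <= a * t by rewrite ler_piMr// mulr_ge0// (le_trans ler01).
have h' : t <= a * t by rewrite ler_peMl.
lra.
Qed.

End blocks.

(** * Upper bound: truncation of a periodic competitor *)

Section homogenization.
Context {R : realType} {d m : nat}.
Notation X := (Rd R d).
Variables (p delta : R) (f : X -> X -> 'cV[R]_m -> R).
Hypotheses (p1 : 1 < p) (delta0 : 0 < delta).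
Hypothesis f_ge0 : forall x xi z, 0 <= f x xi z.
Hypothesis f_borel : measurable_fun setT
  (fun t : X * X * 'cV[R]_m => f t.1.1 t.1.2 t.2).
Hypothesis f_periodic : forall (k : 'cV[int]_d.-1) x xi z,
  f (hsh (map_mx intr k) x) xi z = f x xi z.
Variables (psi rho : X -> R) (CL CU : R).
Hypotheses (mpsi : measurable_fun setT psi) (mrho : measurable_fun setT rho).
Hypotheses (psi0 : forall xi, 0 <= psi xi) (rho0 : forall xi, 0 <= rho xi).
Hypotheses (CL0 : 0 <= CL) (CU0 : 0 <= CU).
Hypothesis f_low : forall x xi z, psi xi * snorm z `^ p <= CL * (f x xi z + rho xi).
Hypothesis f_up : forall x xi z, f x xi z <= CU * (psi xi * snorm z `^ p + rho xi).

(** The weight of a direction, once the increments of the affine function are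
    taken into account; it dominates in every passage to the limit. *)
Definition theta (xi : X) : R := psi xi * xnorm xi `^ p + rho xi.

Hypothesis theta_fin : (\int[vol]_xi (theta xi)%:E < +oo)%E.
Variables (M : 'M[R]_(m, d.-1)) (cM : R).
Hypotheses (cM0 : 0 <= cM) (cMP : forall y, snorm (M *m y) <= cM * snorm y).

Local Notation ps := (pshift delta).
Local Notation kappa := (Num.max delta 1).
Local Notation fd := (dens delta f).
Local Notation cl := (cell delta).
Local Notation box N := {ffun 'I_d.-1 -> 'I_N}.

Lemma theta_ge0 xi : 0 <= theta xi.
Proof. by rewrite addr_ge0// mulr_ge0 ?powR_ge0. Qed.

Lemma measurable_theta : measurable_fun setT theta.
Proof. by have mx := @measurable_xnorm R d; rewrite /theta; mfun. Qed.

Lemma rho_le_theta xi : rho xi <= theta xi.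
Proof. by rewrite lerDr mulr_ge0 ?powR_ge0. Qed.

Lemma psi_le_theta xi : psi xi * xnorm xi `^ p <= theta xi.
Proof. by rewrite lerDl. Qed.

Lemma f_vecn N (k : box N) x xi z : f (hsh (vecn k) x) xi z = f x xi z.
Proof.
rewrite -(f_periodic (\col_i (k i : nat)%:Z) x xi z); congr (f (hsh _ _) _ _).
by apply/matrixP => i j; rewrite !mxE.
Qed.

Lemma affine_incr (w : X -> 'cV[R]_m) xi x :
  (M *m (ps xi x).1 + w (ps xi x)) - (M *m x.1 + w x) =
  M *m xi.1 + (w (ps xi x) - w x).
Proof. by rewrite /pshift/= mulmxDr opprD addrACA [X in X + _ = _]addrAC subrr add0r. Qed.

Lemma affine_le xi : snorm (M *m xi.1) <= cM * xnorm xi.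
Proof. by apply: le_trans (cMP _) _; rewrite ler_wpM2l// snorm_le_xnorm. Qed.

Lemma affine_powR_le xi : psi xi * snorm (M *m xi.1) `^ p <= cM `^ p * theta xi.
Proof.
have p0 : 0 <= p by rewrite ltW// (lt_trans _ p1).
apply: (@le_trans _ _ (psi xi * (cM * xnorm xi) `^ p)).
  by apply: ler_wpM2l => //; apply: le_powR => //; [exact: snorm_ge0|exact: affine_le].
rewrite powRM ?xnorm_ge0// mulrCA; apply: ler_wpM2l; first exact: powR_ge0.
exact: psi_le_theta.
Qed.

Lemma dint_box_sum N (F : X -> X -> R) : jmeas F -> (forall xi x, 0 <= F xi x) ->
  dint (fun xi x => cl N%:R xi x * F xi x) =
  dint (fun xi x => cl 1 xi x * \sum_(k : box N) F xi (hsh (vecn k) x)).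
Proof.
move=> mF F0; apply: eq_integral => xi _.
under eq_integral do rewrite -mulrA.
rewrite integral_unit_box_sum.
- apply: eq_integral => x _; rewrite /cell -mulrA; congr (_ * _)%:E.
  by rewrite mulr_sumr; apply: eq_bigr.
- apply: measurable_funM; first exact: jmeas_slice (jmeas_slab _).
  exact: jmeas_slice mF.
- by move=> x; rewrite mulr_ge0 ?slab_ge0.
Qed.

Section upper.
Variable w : X -> 'cV[R]_m.
Hypotheses (mw : measurable_fun setT w) (perw : hperiodic 1 w).

Let u x := M *m x.1 + w x.
Let v L x := M *m x.1 + cutoff L x.1 *: w x.

Lemma measurable_affine : measurable_fun setT u.
Proof. by rewrite /u; mfun. Qed.

Lemma measurable_truncated L : measurable_fun setT (v L).
Proof. by have mc := @measurable_cutoff R d.-1 L; rewrite /v; mfun. Qed.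

Lemma w_vecn N (k : box N) x : w (hsh (vecn k) x) = w x.
Proof.
rewrite -[RHS](perw (\col_i (k i : nat)%:Z)); congr (w (hsh _ _)).
by apply/matrixP => i j; rewrite !mxE mul1r.
Qed.

Definition trunc_const : R :=
  CU * (4 `^ p * (cM `^ p + 2 `^ p * (CL + cM `^ p) + 2 `^ p) + 1).

(** An integrable bound for the energy density of the truncated function in any
    cell, used in the cells that meet the boundary layer. *)
Definition htrunc (xi x : X) : R :=
  trunc_const * (fd u xi x + theta xi + theta xi * snorm (w (ps xi x)) `^ p).

Lemma trunc_const_ge0 : 0 <= trunc_const.
Proof. by rewrite /trunc_const mulr_ge0// addr_ge0// mulr_ge0 ?powR_ge0// !addr_ge0 ?mulr_ge0 ?addr_ge0 ?powR_ge0. Qed.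

Lemma htrunc_ge0 xi x : 0 <= htrunc xi x.
Proof.
apply: mulr_ge0; first exact: trunc_const_ge0.
have T0 := theta_ge0 xi; have D0 := dens_ge0 delta f_ge0 u xi x.
by apply: addr_ge0; [exact: addr_ge0|rewrite mulr_ge0 ?powR_ge0].
Qed.

(** With [phi] the cut-off function, the increment of [M x + phi w] is the sum
    of [M xi], of [phi] times the increment of [w] and of the increment of [phi]
    times [w]. The second term is bounded by the energy density of [u], by
    coercivity, and the third one by [2 * xnorm xi] times [w]. *)
Lemma truncated_le L N (k : box N) xi x :
  fd (v L) xi (hsh (vecn k) x) <= htrunc xi x.
Proof.
have p0 : 0 <= p by rewrite ltW// (lt_trans _ p1).
have p1' : 1 <= p by exact: ltW.
set y := hsh (vecn k) x; rewrite /dens f_vecn.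
apply: (le_trans (f_up _ _ _)).
have wp : w (ps xi y) = w (ps xi x) by rewrite /y pshift_hsh w_vecn.
have wy : w y = w x by rewrite /y w_vecn.
set Dw := w (ps xi x) - w x.
have E : v L (ps xi y) - v L y = M *m xi.1 + cutoff L y.1 *: Dw +
    (cutoff L (y.1 + xi.1) - cutoff L y.1) *: w (ps xi x).
  rewrite /v (affine_incr (fun z : X => cutoff L z.1 *: w z) xi y) -addrA.
  congr (_ + _); rewrite wp wy /Dw scalerBr scalerBl.
  by rewrite [RHS]addrC addrA subrK.
rewrite E.
set S := fd u xi x + theta xi + theta xi * snorm (w (ps xi x)) `^ p.
have T0 := theta_ge0 xi.
have W0 : 0 <= theta xi * snorm (w (ps xi x)) `^ p by rewrite mulr_ge0 ?powR_ge0.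
have D0 := dens_ge0 delta f_ge0 u xi x.
have TS : theta xi <= S by rewrite /S; lra.
have WS : theta xi * snorm (w (ps xi x)) `^ p <= S by rewrite /S; lra.
have DS : fd u xi x + theta xi <= S by rewrite /S; lra.
have S0 : 0 <= S by lra.
have h1 : psi xi * snorm (M *m xi.1) `^ p <= cM `^ p * S.
  by apply: (le_trans (affine_powR_le xi)); apply: ler_wpM2l => //; exact: powR_ge0.
have h2 : psi xi * snorm (cutoff L y.1 *: Dw) `^ p <= 2 `^ p * (CL + cM `^ p) * S.
  apply: (@le_trans _ _ (psi xi * (snorm (M *m xi.1 + Dw) + snorm (M *m xi.1)) `^ p)).
    apply: ler_wpM2l => //; apply: le_powR => //; first exact: snorm_ge0.
    rewrite snormZ ger0_norm ?cutoff_ge0//.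
    apply: (@le_trans _ _ (snorm Dw)).
      by rewrite ler_piMl ?snorm_ge0// cutoff_le1.
    exact: snorm_le_addl.
  apply: (@le_trans _ _ (psi xi * (2 `^ p * (snorm (M *m xi.1 + Dw) `^ p + snorm (M *m xi.1) `^ p)))).
    by apply: ler_wpM2l => //; exact: powRD_le p1' (snorm_ge0 _) (snorm_ge0 _).
  rewrite mulrCA -mulrA; apply: ler_wpM2l; first exact: powR_ge0.
  rewrite mulrDr mulrDl; apply: lerD => //.
  have := f_low x xi (M *m xi.1 + Dw) => /le_trans; apply; apply: ler_wpM2l => //.
  apply: le_trans DS; apply: lerD; last exact: rho_le_theta.
  by rewrite /dens /u affine_incr.
have h3 : psi xi * snorm ((cutoff L (y.1 + xi.1) - cutoff L y.1) *: w (ps xi x)) `^ p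
    <= 2 `^ p * S.
  apply: (@le_trans _ _ (psi xi * ((2 * xnorm xi) * snorm (w (ps xi x))) `^ p)).
    apply: ler_wpM2l => //; apply: le_powR => //; first exact: snorm_ge0.
    rewrite snormZ; apply: ler_wpM2r; first exact: snorm_ge0.
    by apply: (le_trans (cutoff_lip _ _ _)); rewrite ler_wpM2l// snorm_le_xnorm.
  rewrite !powRM ?mulr_ge0 ?snorm_ge0 ?xnorm_ge0//.
  rewrite -mulrA mulrCA; apply: ler_wpM2l; first exact: powR_ge0.
  apply: le_trans WS; rewrite mulrA; apply: ler_wpM2r; first exact: powR_ge0.
  exact: psi_le_theta.
have h4 : psi xi * snorm (M *m xi.1 + cutoff L y.1 *: Dw +
    (cutoff L (y.1 + xi.1) - cutoff L y.1) *: w (ps xi x)) `^ p <=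
  4 `^ p * (cM `^ p * S + 2 `^ p * (CL + cM `^ p) * S + 2 `^ p * S).
  set a := M *m xi.1 in h1 *; set b := cutoff L y.1 *: Dw in h2 *; set c := _ *: w _ in h3 *.
  apply: (@le_trans _ _ (psi xi * (4 `^ p * (snorm a `^ p + snorm b `^ p + snorm c `^ p)))).
    apply: ler_wpM2l => //.
    apply: (@le_trans _ _ ((snorm a + snorm b + snorm c) `^ p)).
      apply: le_powR => //; first exact: snorm_ge0.
      by apply: le_trans (snormD _ _) _; rewrite lerD2r snormD.
    exact: powRD3_le p1' (snorm_ge0 _) (snorm_ge0 _) (snorm_ge0 _).
  rewrite mulrCA; apply: ler_wpM2l; first exact: powR_ge0.
  by rewrite [leLHS]mulrDr [X in X + _]mulrDr; exact: lerD (lerD h1 h2) h3.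
rewrite /htrunc -/S /trunc_const -mulrA; apply: ler_wpM2l => //.
rewrite [leRHS]mulrDl mul1r; apply: lerD; last exact: le_trans (rho_le_theta xi) TS.
by apply: (le_trans h4); rewrite -!mulrDl mulrA.
Qed.

(** A translated pair of depth more than 2 sees [u] itself, and the proportion of
    the other translations is at most [badfrac N xi]. *)
Lemma truncated_sum_le L N xi x : (0 < N)%N -> N%:R - 1 < L -> Hc 1 x.1 ->
  (N%:R ^+ d.-1)^-1 *
    \sum_(k : box N) pairs delta L xi (hsh (vecn k) x) * fd (v L) xi (hsh (vecn k) x) <=
  fd u xi x + badfrac N xi * htrunc xi x.
Proof.
move=> N0 NL xH.
have Nn0 : 0 < N%:R ^+ d.-1 :> R by rewrite exprn_gt0// ltr0n.
have each (k : box N) :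
    pairs delta L xi (hsh (vecn k) x) * fd (v L) xi (hsh (vecn k) x) <=
    fd u xi x + (1 - \1_(inner 2 L xi) (hsh (vecn k) x)) * htrunc xi x.
  set y := hsh (vecn k) x.
  have D0 := dens_ge0 delta f_ge0 (v L) xi y.
  apply: (@le_trans _ _ (fd (v L) xi y)).
    by apply: ler_piMl => //; rewrite /pairs mulr_ile1 ?indic_ge0 ?indic_le1.
  have [yi|yi] := pselect (inner 2 L xi y); last first.
    rewrite (indic_out yi) subr0 mul1r; apply: (le_trans (truncated_le L k xi x)).
    by rewrite lerDr dens_ge0.
  rewrite (indic_in yi) subrr mul0r addr0 /dens f_vecn.
  have [y1 y2] := yi.
  rewrite (_ : v L (ps xi y) - v L y = u (ps xi x) - u x)//.
  have wp : w (ps xi y) = w (ps xi x) by rewrite /y pshift_hsh w_vecn.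
  have wy : w y = w x by rewrite /y w_vecn.
  rewrite /u affine_incr /v (affine_incr (fun z : X => cutoff L z.1 *: w z) xi y).
  by rewrite wp wy !cutoff_inner// !scale1r.
rewrite ler_pdivrMl//; apply: (le_trans (ler_sum _ (fun k _ => each k))).
rewrite big_split/= sumr_const -mulr_suml -[X in X + _]mulr_natl card_box mulrDr lerD2l.
rewrite [leRHS]mulrA; apply: ler_wpM2r; first exact: htrunc_ge0.
rewrite -ler_pdivrMl//; apply: bad_fraction => //.
by rewrite ler0n lexx.
Qed.

Lemma jmeas_htrunc : jmeas htrunc.
Proof.
have mt := measurable_theta; have mu := measurable_affine.
have mD := jmeas_dens delta f_borel mu.
rewrite /jmeas /htrunc; apply: measurable_funM; first exact: measurable_cst.
apply: measurable_funD; first by apply: measurable_funD; [exact: mD|mfun].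
by mfun.
Qed.

Lemma cell_integral_le P (xi : X) : 0 <= P ->
  (\int[vol]_x (cl P xi x)%:E <= (P ^+ d.-1 * 2)%:E)%E.
Proof.
move=> P0; rewrite -(integral_slab (d := d) P0).
have mH := @measurable_Hc R d.-1 P; have mI := @measurable_II R.
apply: ge0_le_integral_EFin.
- exact: jmeas_slice (jmeas_cell _ _).
- by mfun.
- by move=> x; exact: cell_ge0.
- move=> x; rewrite /cell; apply: ler_wpM2l; first exact: indic_ge0.
  by rewrite /slab ler_piMr ?indic_ge0 ?indic_le1.
Qed.

Hypothesis w_fin : (\int[vol]_x (\1_(Hc 1) x.1 * (\1_II x.2 * snorm (w x) `^ p))%:E < +oo)%E.
Hypothesis u_fin : (dint (fun xi x => cl 1 xi x * fd u xi x)%R < +oo)%E.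

Lemma cell_shift_le xi :
  (\int[vol]_x (cl 1 xi x * snorm (w (ps xi x)) `^ p)%:E <=
   \int[vol]_x (\1_(Hc 1) x.1 * (\1_II x.2 * snorm (w x) `^ p))%:E)%E.
Proof.
have mI := @measurable_II R; have mH := @measurable_Hc R d.-1 1.
have mp : measurable_fun setT (fun x : X => ps xi x) by mfun.
pose F (x : X) := \1_II x.2 * snorm (w x) `^ p.
have mF : measurable_fun setT F by rewrite /F; mfun.
have F0 x : 0 <= F x by rewrite mulr_ge0 ?indic_ge0 ?powR_ge0.
have PF : hperiodic 1 F by move=> k x; rewrite /F perw.
rewrite -(integral_periodic_shift (xi.1, delta * xi.2) ltr01 mF F0 PF).
have mFs : measurable_fun setT (fun x : X => F (ps xi x)) by mfun.
apply: ge0_le_integral_EFin.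
- apply: measurable_funM; first exact: jmeas_slice (jmeas_cell _ _).
  by mfun.
- by apply: measurable_funM; [mfun|exact: mFs].
- by move=> x; rewrite mulr_ge0 ?cell_ge0 ?powR_ge0.
- move=> x; rewrite /cell -mulrA; apply: ler_wpM2l; first exact: indic_ge0.
  rewrite /F /slab -!pshiftE -mulrA.
  by rewrite ler_piMl ?mulr_ge0 ?indic_ge0 ?powR_ge0 ?indic_le1.
Qed.

Lemma dint_htrunc_fin : (dint (fun xi x => cl 1 xi x * htrunc xi x)%R < +oo)%E.
Proof.
have mt := measurable_theta; have mu := measurable_affine.
have mD := jmeas_dens delta f_borel mu.
have mC := @jmeas_cell R d delta 1.
have T0 := theta_ge0.
have c0 := @cell_ge0 R d delta 1.
pose A xi x := cl 1 xi x * fd u xi x.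
pose B xi x := theta xi * cl 1 xi x.
pose C xi x := theta xi * (cl 1 xi x * snorm (w (ps xi x)) `^ p).
have mA : jmeas A by exact: jmeasM.
have mT : jmeas (fun xi _ : X => theta xi) by exact: jmeas_fst.
have mB : jmeas B by exact: jmeasM.
have mw' : jmeas (fun xi x : X => cl 1 xi x * snorm (w (ps xi x)) `^ p).
  by apply: jmeasM => //; rewrite /jmeas; mfun.
have mC' : jmeas C by exact: jmeasM.
have A0 xi x : 0 <= A xi x by rewrite mulr_ge0 ?c0 ?dens_ge0.
have B0 xi x : 0 <= B xi x by rewrite mulr_ge0 ?c0 ?T0.
have cw0 xi x : 0 <= cl 1 xi x * snorm (w (ps xi x)) `^ p.
  by rewrite mulr_ge0 ?powR_ge0 ?c0.
have C0 xi x : 0 <= C xi x by rewrite mulr_ge0 ?T0 ?cw0.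
have AB0 xi x : 0 <= A xi x + B xi x by rewrite addr_ge0.
have mAB : jmeas (fun xi x => A xi x + B xi x) by exact: measurable_funD.
have ABC0 xi x : 0 <= A xi x + B xi x + C xi x by rewrite addr_ge0.
have mABC : jmeas (fun xi x => A xi x + B xi x + C xi x) by exact: measurable_funD.
have -> : (fun xi x => cl 1 xi x * htrunc xi x)%R =
    (fun xi x => trunc_const * (A xi x + B xi x + C xi x)).
  by apply/funext => xi; apply/funext => x; rewrite /htrunc /A /B /C; ring.
rewrite (dintZ mABC ABC0 trunc_const_ge0) (dintD mAB mC' AB0 C0) (dintD mA mB A0 B0).
have fA : (dint A < +oo)%E by [].
have t0 : (0 <= \int[vol]_xi (theta xi)%:E)%E by exact: integral_EFin_ge0.
have fB : (dint B < +oo)%E.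
  have b0 : (0 <= (1 ^+ d.-1 * 2 : R)%:E)%E by rewrite lee_fin expr1n mul1r.
  have bC (xi : X) : (\int[vol]_x (cl 1 xi x)%:E <= (1 ^+ d.-1 * 2 : R)%:E)%E.
    exact: cell_integral_le.
  apply: (le_lt_trans (dint_fst mt T0 mC c0 b0 bC)).
  by apply: lte_mul_pinfty.
have fC : (dint C < +oo)%E.
  pose b := (\int[vol]_x (\1_(Hc 1) x.1 * (\1_II x.2 * snorm (w x) `^ p))%:E)%E.
  have b0 : (0 <= b)%E.
    by apply: integral_EFin_ge0 => x; rewrite !mulr_ge0 ?indic_ge0 ?powR_ge0.
  apply: (le_lt_trans (dint_fst (b := b) mt T0 mw' cw0 b0 cell_shift_le)).
  by apply: lte_mul_pinfty => //; rewrite ge0_fin_numE.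
have dA := dint_ge0 A0; have dB := dint_ge0 B0; have dC := dint_ge0 C0.
apply: lte_mul_pinfty; rewrite ?lee_fin ?trunc_const_ge0//.
by apply: lte_add_pinfty; [apply: lte_add_pinfty; [exact: fA|exact: fB]|exact: fC].
Qed.

(** The error of [truncated_sum_le] is [badfrac N] times an integrable function. *)
Lemma truncated_energy_le (e : R) : 0 < e ->
  \forall N \near \oo, forall L, N%:R - 1 < L -> L <= N%:R ->
  (((N%:R ^+ d.-1)^-1)%:E * energy f delta (int1 delta L) (v L) <=
   energy f delta (per_dom delta) u + e%:E)%E.
Proof.
move=> e0.
have k0 := kappa_gt0 delta0.
have mu := measurable_affine.
have mC := @jmeas_cell R d delta 1.
have mD := jmeas_dens delta f_borel mu.
have mh := jmeasM mC jmeas_htrunc.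
have c0 := @cell_ge0 R d delta 1.
have h0 xi x : 0 <= cl 1 xi x * htrunc xi x by rewrite mulr_ge0 ?c0 ?htrunc_ge0.
have hoo := dint_htrunc_fin.
have ek : 0 < e / kappa by rewrite divr_gt0.
have mb N : jmeas (fun xi _ : X => badfrac N xi) by apply: jmeas_fst; exact: measurable_badfrac.
have small := dint_weight_small mh h0 hoo (@measurable_badfrac R d)
  (@badfrac01 R d) (@badfrac_cvg0 R d) ek.
near=> N => L NL LN.
have N0 : (0 < N)%N by near: N; exact: nbhs_infty_gt.
have Nn0 : 0 < N%:R ^+ d.-1 :> R by rewrite exprn_gt0// ltr0n.
have mv := measurable_truncated L.
have mDv := jmeas_dens delta f_borel mv.
have mP := @jmeas_pairs R d delta L.
have F0 xi x : 0 <= pairs delta L xi x * fd (v L) xi x.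
  by rewrite mulr_ge0 ?pairs_ge0 ?dens_ge0.
have mF := jmeasM mP mDv.
rewrite (energy_int1E delta f LN mv) (dint_box_sum N mF F0).
rewrite (energy_perE delta f_ge0 f_borel mu) muleCA.
set G := fun xi x => _; set H := fun xi x : X => cl 1 xi x * fd u xi x.
have Nn1 : 0 <= (N%:R ^+ d.-1)^-1 :> R by rewrite invr_ge0 ltW.
have mG : jmeas G.
  apply: jmeasM => //; rewrite /jmeas.
  apply: measurable_fsum => k.
  have mk : measurable_fun setT (fun z : X * X => (z.1, hsh (vecn k) z.2)) by mfun.
  exact: (measurableT_comp mF mk).
have G0 xi x : 0 <= G xi x by rewrite mulr_ge0 ?c0// sumr_ge0.
have mH : jmeas H by exact: jmeasM.
have H0 xi x : 0 <= H xi x by rewrite mulr_ge0 ?c0 ?dens_ge0.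
pose T xi x := badfrac N xi * (cl 1 xi x * htrunc xi x).
have mT : jmeas T by apply: jmeasM => //; exact: mb.
have T0 xi x : 0 <= T xi x.
  by have /andP[b0 _] := badfrac01 N xi; rewrite mulr_ge0.
have kR : (0 <= kappa%:E :> \bar R)%E by rewrite lee_fin ltW.
have -> : (e%:E = kappa%:E * (e / kappa)%:E :> \bar R)%E.
  by rewrite -EFinM mulrC divfK// gt_eqF.
have ek' : (0 <= (e / kappa)%:E :> \bar R)%E by rewrite lee_fin ltW.
rewrite -(ge0_muleDr _ (dint_ge0 H0) ek').
apply: lee_wpmul2l => //.
rewrite -(dintZ mG G0 Nn1).
apply: (@le_trans _ _ (dint (fun xi x => H xi x + T xi x))%R).
  apply: le_dint.
  - by apply: jmeasM => //; exact: measurable_cst.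
  - exact: measurable_funD.
  - by move=> xi x; rewrite mulr_ge0.
  - move=> xi x; rewrite /G /H /T mulrCA [X in _ + X]mulrCA -mulrDr.
    have [xH|xH] := pselect (Hc 1 x.1); last first.
      by rewrite /cell (indic_out xH) !mul0r.
    by apply: ler_wpM2l; [exact: c0|exact: truncated_sum_le].
rewrite (dintD mH mT H0 T0) leeD2l//.
rewrite /T; near: N; exact: small.
Unshelve. all: by end_near. Qed.

Hypothesis w_cbox : forall A : R, 0 < A ->
  (\int[vol]_x (\1_(cbox A) x * snorm (w x) `^ p)%:E < +oo)%E.

Lemma truncated_D1 L : (0 < d.-1)%N -> D1 p M L (v L).
Proof.
move=> n0.
have mv := measurable_truncated L.
have p1' : 1 <= p by exact: ltW.
have p0 : 0 <= p by rewrite (le_trans _ p1').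
split; last first.
  apply: aeW => x /(eucl_dist_lt1 n0)[i hi].
  by rewrite /v (cutoff_outer hi) scale0r addr0.
apply: (cbox_Lploc p1' mv) => A A0.
have mM : measurable_fun setT (fun x : X => M *m x.1) by mfun.
apply: (cbox_le_add p1' mv mM mw _ (cbox_affine p1' M A) (w_cbox A0)).
apply: aeW => x; apply: le_trans (snormD _ _) _.
rewrite lerD2l snormZ ger0_norm ?cutoff_ge0//.
by rewrite ler_piMl ?snorm_ge0 ?cutoff_le1.
Qed.

End upper.

(** * Lower bound: averaging over integer translations *)

Hypothesis f_convex : forall x xi, convex_function setT (f x xi).
Variables (c0 r : R).
Hypotheses (c00 : 0 < c0) (r0 : 0 < r) (dr : delta * r <= 1) (r1 : 2 * r <= 1).
Hypothesis psi_low : forall xi : X, sbox (2 * r) xi -> c0 <= psi xi.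

Section averaging.
Variables (N : nat) (L : R) (v : X -> 'cV[R]_m).
Hypotheses (N0 : (0 < N)%N) (NL : N%:R - 1 < L) (LN : L <= N%:R).
Hypothesis mv : measurable_fun setT v.

Let NR0 : 0 < N%:R :> R. Proof. by rewrite ltr0n. Qed.
Let Nn0 : 0 < N%:R ^+ d.-1 :> R. Proof. by rewrite exprn_gt0. Qed.

Definition core : set X := [set x : X | forall i, 1 <= x.1 i ord0 <= L - 1].

Lemma measurable_core : measurable core.
Proof.
have := @measurable_cVbox R d.-1 (fun=> `[1, L - 1]%classic) (fun=> measurable_itv _).
move=> h; have -> : core = [set y : 'cV[R]_d.-1 | forall i, `[1, L - 1]%classic (y i ord0)] `*` setT.
  apply/seteqP; split => -[y t] /= h'.
    by split => //= i; rewrite in_itv/=; exact: h'.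
  by move=> i; have := h'.1 i; rewrite in_itv.
exact: measurableX.
Qed.

(** The deviation of [v] from the affine function, cut to 0 on the boundary layer,
    where it vanishes almost everywhere, and its [N]-periodic extension. *)
Definition w0 x : 'cV[R]_m := \1_core x *: (v x - M *m x.1).
Definition wper : X -> 'cV[R]_m := w0 \o red N%:R.
Definition vcut x : 'cV[R]_m := M *m x.1 + w0 x.

(** The mean over the integer points of the period turns the [N]-periodic
    extension into a 1-periodic function. *)
Definition wavg x : 'cV[R]_m :=
  (N%:R ^+ d.-1)^-1 *: \sum_(k : box N) wper (hsh (vecn k) x).
Definition uavg x : 'cV[R]_m := M *m x.1 + wavg x.

Lemma measurable_w0 : measurable_fun setT w0.
Proof. by have mc := measurable_core; rewrite /w0; mfun. Qed.

Lemma measurable_wper : measurable_fun setT wper.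
Proof. exact: (measurableT_comp measurable_w0 (measurable_red _)). Qed.

Lemma measurable_vcut : measurable_fun setT vcut.
Proof. by have mw := measurable_w0; rewrite /vcut; mfun. Qed.

Lemma measurable_wavg : measurable_fun setT wavg.
Proof. by have mw := measurable_wper; rewrite /wavg; mfun. Qed.

Lemma measurable_uavg : measurable_fun setT uavg.
Proof. by have mw := measurable_wavg; rewrite /uavg; mfun. Qed.

Lemma hperiodic_wper : hperiodic N%:R wper.
Proof. exact: hperiodic_red. Qed.

Lemma wavg_hsh (j : 'cV[int]_d.-1) x : wavg (hsh (map_mx intr j) x) = wavg x.
Proof. by rewrite /wavg sum_box_periodic//; exact: hperiodic_wper. Qed.

Lemma cube_HcN (y : 'cV[R]_d.-1) : cube L y -> Hc N%:R y.
Proof. by move=> h i; have /andP[/ltW -> h2] := h i; rewrite (lt_le_trans h2). Qed.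

Lemma wper_cube x : cube L x.1 -> wper x = w0 x.
Proof. by move=> xL; rewrite /wper /= red_id//; exact: cube_HcN. Qed.

Lemma core_near (x : X) (xi : X) : core x -> (forall i, `|xi.1 i ord0| < 1) ->
  cube L (x.1 + xi.1).
Proof.
move=> xc h i; have /andP[h1 h2] := xc i.
by have := h i; rewrite mxE ltr_norml => /andP[h3 h4]; apply/andP; split; lra.
Qed.

(** A pair shorter than the width of the layer and with an end outside the cube
    has both ends outside the core, where the extension vanishes. This is why
    short directions create no error. *)
Lemma wper_near (xi x : X) : Hc N%:R x.1 -> (forall i, `|xi.1 i ord0| < 1) ->
  ~ (cube L x.1 /\ cube L (ps xi x).1) -> wper (ps xi x) = wper x.
Proof.
move=> xH h bad.
have out y : ~ core y -> w0 y = 0 by move=> yc; rewrite /w0 (indic_out yc) scale0r.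
have core_cube y : core y -> cube L y.1.
  by move=> yc i; have /andP[h1 h2] := yc i; apply/andP; split; lra.
have wx : wper x = 0.
  rewrite /wper /= red_id//; apply: out => xc; apply: bad.
  by split; [exact: core_cube|exact: core_near].
rewrite wx; apply: out => yc; apply: bad.
(* the other end lies in a translate of the cube, which has to be the cube *)
set y := ps xi x in yc *.
pose j := floorv N%:R y.1.
have x'L : cube L (x.1 - N%:R *: map_mx intr j).
  have := @core_near (red N%:R y) (- xi) yc.
  rewrite /red /y /pshift /= addrAC addrK; apply => i.
  by rewrite mxE normrN; exact: h.
have j0 : j = 0.
  apply/matrixP => i z; rewrite (ord1 z) [RHS]mxE.
  have /andP[a1 a2] := xH i; have /andP[b1 b2] := x'L i.
  have e : (x.1 - N%:R *: map_mx intr j) i ord0 = x.1 i ord0 - N%:R * (j i ord0)%:~R.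
    by rewrite !mxE.
  rewrite e in b1 b2.
  have c1 : (-1 : R) < (j i ord0)%:~R.
    rewrite -(ltr_pM2l NR0) mulrN1.
    have gen (a b l n : R) : 0 <= a -> a - b < l -> l <= n -> - n < b by lra.
    exact: gen a1 b2 LN.
  have c2 : (j i ord0)%:~R < (1 : R).
    rewrite -(ltr_pM2l NR0) mulr1.
    have gen (a b n : R) : 0 < a - b -> a < n -> b < n by lra.
    exact: gen b1 a2.
  move: c1 c2; rewrite -[-1 : R]/((-1)%:~R) -[1 : R]/(1%:~R) !ltr_int.
  by case: (j i ord0) => [[|k]|[|k]].
have jz : map_mx intr j = 0 :> 'cV[R]_d.-1.
  by rewrite j0; apply/matrixP => i z; rewrite !mxE.
split; first by have := x'L; rewrite jz scaler0 subr0.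
apply: core_cube; have := yc; rewrite /red -/j jz scaler0 oppr0.
by rewrite /hsh addr0 -surjective_pairing.
Qed.

Lemma vcut_ae : D1 p M L v -> {ae vol, forall x, v x = vcut x}.
Proof.
move=> [_]; apply: filterS => x hx; rewrite /vcut /w0.
have [xc|xc] := pselect (core x).
  by rewrite (indic_in xc) scale1r addrC subrK.
rewrite (indic_out xc) scale0r addr0; apply: hx.
have [i hi] : exists i, ~ (1 <= x.1 i ord0 <= L - 1).
  by apply: contrapT => h; apply: xc => i; apply: contrapT => h'; apply: h; exists i.
apply: (@eucl_dist_lt1_coor _ _ _ _ i).
have [h1|h1] := ltP (x.1 i ord0) 1; first by left.
have [h2|h2] := ltP (L - 1) (x.1 i ord0); first by right.
by exfalso; apply: hi; rewrite h1 h2.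
Qed.

Lemma uavg_incr xi x : uavg (ps xi x) - uavg x = (#|{: box N}|%:R)^-1 *:
  \sum_(k : box N) (M *m xi.1 +
    (wper (ps xi (hsh (vecn k) x)) - wper (hsh (vecn k) x))).
Proof.
rewrite card_box /uavg affine_incr big_split/= scalerDr sumr_const.
have -> : M *m xi.1 *+ #|{: box N}| = N%:R ^+ d.-1 *: (M *m xi.1).
  by rewrite -card_box scaler_nat.
rewrite scalerA mulVf ?gt_eqF// scale1r; congr (_ + _).
rewrite /wavg -scalerBr -sumrB; congr (_ *: _).
by apply: eq_bigr => k _; rewrite pshift_hsh.
Qed.

Definition perturb_const : R := CU * (2 `^ p * CL + 1).
Definition affine_const : R := CU * (cM `^ p + 1).
Definition far (xi : X) : R := \1_[set xi : X | 1 <= xnorm xi] xi.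

Lemma perturb_const_ge0 : 0 <= perturb_const.
Proof. by rewrite mulr_ge0// addr_ge0// mulr_ge0 ?powR_ge0. Qed.

Lemma affine_const_ge0 : 0 <= affine_const.
Proof. by rewrite mulr_ge0// addr_ge0 ?powR_ge0. Qed.

Lemma affine_dens_le x xi : f x xi (M *m xi.1) <= affine_const * theta xi.
Proof.
apply: (le_trans (f_up _ _ _)); rewrite /affine_const -mulrA; apply: ler_wpM2l => //.
rewrite mulrDl mul1r; apply: lerD; last exact: rho_le_theta.
exact: affine_powR_le.
Qed.

Lemma hsh_HcN (k : box N) (x : X) : Hc 1 x.1 -> Hc N%:R (hsh (vecn k) x).1.
Proof.
move=> xH i; have /andP[h1 h2] := xH i; rewrite /= !mxE addr_ge0//=.
have : (k i).+1%:R <= N%:R :> R by rewrite ler_nat.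
by rewrite -natr1; lra.
Qed.

(** Jensen over the translations, after replacing the increments of the pairs
    that leave the cube by the affine one. The replacement costs [theta] on a
    proportion [badfrac N xi] of the translations, and the mean of the removed
    increments enters through [convex_perturb]; these vanish in the short
    directions by [wper_near]. *)
Lemma avg_dens_le s xi x : 0 < s < 1 -> Hc 1 x.1 ->
  fd uavg xi x <=
  (1 + s * perturb_const) * ((N%:R ^+ d.-1)^-1 *
    \sum_(k : box N) pairs delta L xi (hsh (vecn k) x) * fd vcut xi (hsh (vecn k) x)) +
  (1 + s * perturb_const) * affine_const * (badfrac N xi * theta xi) + s * perturb_const * theta xi +
  s `^ (1 - p) * (CU * 2 `^ p) * (badfrac N xi `^ (p - 1) * (far xi * psi xi) *
    ((N%:R ^+ d.-1)^-1 * \sum_(k : box N)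
      snorm (wper (ps xi (hsh (vecn k) x)) - wper (hsh (vecn k) x)) `^ p)).
Proof.
move=> s01 xH; have /andP[s0 s1] := s01.
have p1' : 1 <= p by exact: ltW.
have B0 : (0 < #|{: box N}|)%N by rewrite -(ltr_nat R) card_box.
pose y (k : box N) := hsh (vecn k) x.
pose good (k : box N) : bool := `[< cube L (y k).1 /\ cube L (ps xi (y k)).1 >].
pose dW (k : box N) := wper (ps xi (y k)) - wper (y k).
pose z k := M *m xi.1 + dW k.
pose z' k := if good k then z k else M *m xi.1.
have pairsE k : pairs delta L xi (y k) = (good k)%:R.
  rewrite /pairs /good; have [h1|h1] := pselect (cube L (y k).1); last first.
    by rewrite (indic_out h1) mul0r asboolF// => -[].
  have [h2|h2] := pselect (cube L (ps xi (y k)).1); last first.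
    by rewrite (indic_out h2) mulr0 asboolF// => -[].
  by rewrite (indic_in h1) (indic_in h2) mulr1 asboolT.
have goodE k : (~~ good k)%:R = 1 - pairs delta L xi (y k).
  by rewrite pairsE; case: (good k); rewrite ?subrr ?subr0.
have innerE k : pairs delta L xi (y k) = \1_(inner 0 L xi) (y k).
  rewrite pairsE /good indicE; congr (nat_of_bool _)%:R.
  apply/asboolP/idP => [[h1 h2]|/set_mem[h1 h2]].
    by apply/mem_set; split => i; rewrite subr0; [exact: h1|exact: h2].
  by split => i; [have := h1 i|have := h2 i]; rewrite subr0.
have badE : #|{: box N}|%:R^-1 * \sum_k (~~ good k)%:R <= badfrac N xi.
  rewrite card_box; under eq_bigr do rewrite goodE innerE.
  by apply: bad_fraction => //; rewrite lexx ler0n.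
have T0 : 0 <= theta xi by exact: theta_ge0.
set G := #|{: box N}|%:R^-1 * \sum_k f x xi (z' k).
have GE : G <= (N%:R ^+ d.-1)^-1 *
    \sum_(k : box N) pairs delta L xi (y k) * fd vcut xi (y k) +
    affine_const * (badfrac N xi * theta xi).
  rewrite /G; apply: (@le_trans _ _ (#|{: box N}|%:R^-1 * \sum_k
      (pairs delta L xi (y k) * fd vcut xi (y k) + (~~ good k)%:R * (affine_const * theta xi)))).
    apply: ler_wpM2l; first by rewrite invr_ge0.
    apply: ler_sum => k _; rewrite pairsE /z'; case: ifPn => [gk|gk].
      rewrite mul0r addr0 mul1r /dens.
      have /asboolP[h1 h2] := gk.
      rewrite /y f_vecn// /z /dW /vcut affine_incr -/(y k).
      by rewrite !wper_cube.
    by rewrite mul0r add0r mul1r affine_dens_le.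
  rewrite big_split/= -mulr_suml mulrDr -card_box lerD2l.
  rewrite [leLHS]mulrA [leRHS]mulrCA; apply: ler_wpM2r => //.
  by rewrite mulr_ge0// affine_const_ge0.
have rE : psi xi * snorm (#|{: box N}|%:R^-1 *: \sum_k (z k - z' k)) `^ p <=
    badfrac N xi `^ (p - 1) * (far xi * psi xi) *
    ((N%:R ^+ d.-1)^-1 * \sum_(k : box N) snorm (dW k) `^ p).
  have dWz k : snorm (z k - z' k) = (~~ good k)%:R * snorm (dW k).
    rewrite /z' /z; case: (good k) => /=; first by rewrite subrr snorm0 mul0r.
    by rewrite addrC addKr mul1r.
  have farE k : (~~ good k)%:R * snorm (dW k) `^ p <= far xi * snorm (dW k) `^ p.
    have [x1|x1] := pselect (1 <= xnorm xi).
      rewrite /far (indic_in (x1 : [set xi : X | 1 <= xnorm xi] xi)) mul1r.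
      by apply: ler_piMl; [exact: powR_ge0|rewrite lern1 leq_b1].
    have [gk|gk] := boolP (good k).
      by rewrite mul0r mulr_ge0 ?powR_ge0 ?indic_ge0.
    suff -> : dW k = 0 by rewrite snorm0 powR0 ?mulr0// gt_eqF// (lt_trans _ p1).
    apply/eqP; rewrite subr_eq0; apply/eqP; apply: wper_near.
    - exact: hsh_HcN.
    - move=> i; apply: (le_lt_trans (snorm_ge _ _)).
      apply: (le_lt_trans (snorm_le_xnorm xi)); rewrite ltNge.
      exact/negP.
    - exact/asboolPn.
  rewrite [leRHS](_ : _ = psi xi * (badfrac N xi `^ (p - 1) *
     ((N%:R ^+ d.-1)^-1 * \sum_(k : box N) far xi * snorm (dW k) `^ p))); last first.
    by rewrite -mulr_sumr; ring.
  apply: ler_wpM2l => //; rewrite -card_box.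
  apply: (@le_trans _ _ ((#|{: box N}|%:R^-1 * \sum_k (~~ good k)%:R * snorm (dW k)) `^ p)).
    apply: le_powR; [exact: le_trans p1'|exact: snorm_ge0|].
    rewrite snormZ ger0_norm ?invr_ge0//; apply: ler_wpM2l; first by rewrite invr_ge0.
    apply: (le_trans (snorm_sum _ _ _)).
    by apply: ler_sum => k _; rewrite dWz.
  apply: (le_trans (powR_avg_fraction p1' B0 (fun k => snorm_ge0 (dW k)) badE)).
  apply: ler_wpM2l; first exact: powR_ge0.
  by apply: ler_wpM2l; [rewrite invr_ge0|apply: ler_sum => k _; exact: farE].
have := @convex_perturb R p m (f x xi) (psi xi) (rho xi) CL CU (box N) z z' s G
  p1' (f_convex x xi) (f_ge0 x xi) (psi0 xi) (rho0 xi) CL0 CU0 (f_low x xi) (f_up x xi)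
  B0 s01 erefl.
rewrite -/perturb_const => h; rewrite /dens uavg_incr; apply: (le_trans h).
have q0 : 0 <= s `^ (1 - p) * (CU * 2 `^ p) by rewrite !mulr_ge0 ?powR_ge0.
have sC : 0 <= s * perturb_const by rewrite mulr_ge0 ?perturb_const_ge0// ltW.
have sC' : 0 <= 1 + s * perturb_const by rewrite addr_ge0.
apply: lerD; last exact: ler_wpM2l.
apply: lerD; last by apply: ler_wpM2l => //; exact: rho_le_theta.
by rewrite -[(1 + s * perturb_const) * affine_const * _]mulrA -mulrDr; exact: ler_wpM2l.
Qed.

Definition cut_dint : \bar R :=
  dint (fun xi x => cl N%:R xi x * (pairs delta L xi x * fd vcut xi x)).
Definition theta_mass : \bar R := (\int[vol]_xi (theta xi)%:E)%E.
Definition short_const : R := c0^-1 * (2 `^ p * (CL + cM `^ p)).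
Local Notation short := (short_energy p delta N%:R wper (2 * r)).

Lemma short_const_ge0 : 0 <= short_const.
Proof.
by rewrite mulr_ge0 ?invr_ge0 ?(ltW c00)// mulr_ge0 ?powR_ge0// addr_ge0 ?powR_ge0.
Qed.

Lemma jmeas_cut : jmeas (fun xi x => cl N%:R xi x * (pairs delta L xi x * fd vcut xi x)).
Proof.
apply: jmeasM; first exact: jmeas_cell.
by apply: jmeasM; [exact: jmeas_pairs|exact: (jmeas_dens delta f_borel measurable_vcut)].
Qed.

Lemma cut_ge0 xi x : 0 <= cl N%:R xi x * (pairs delta L xi x * fd vcut xi x).
Proof. by rewrite mulr_ge0 ?cell_ge0// mulr_ge0 ?pairs_ge0 ?f_ge0. Qed.

Lemma short_incr_le xi x : sbox (2 * r) xi ->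
  cl N%:R xi x * snorm (wper (ps xi x) - wper x) `^ p <=
  short_const * (cl N%:R xi x * (pairs delta L xi x * fd vcut xi x) + theta xi * cl N%:R xi x).
Proof.
move=> xis.
have p1' : 1 <= p by exact: ltW.
have p0 : 0 < p by exact: lt_trans p1.
have c0x : c0 <= psi xi by exact: psi_low.
rewrite [theta xi * _]mulrC -mulrDr [leRHS]mulrCA.
have [xH|xH] := pselect (Hc N%:R x.1); last by rewrite /cell (indic_out xH) !mul0r.
apply: ler_wpM2l; first exact: cell_ge0.
have T0 : 0 <= theta xi by exact: theta_ge0.
have F0 : 0 <= pairs delta L xi x * fd vcut xi x by rewrite mulr_ge0 ?pairs_ge0 ?f_ge0.
have [[h1 h2]|bad] := pselect (cube L x.1 /\ cube L (ps xi x).1); last first.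
  rewrite (wper_near xH _ bad) => [|i].
    rewrite subrr snorm0 powR0 ?gt_eqF//.
    by apply: mulr_ge0; [exact: short_const_ge0|exact: addr_ge0].
  by have [h _] := xis; exact: lt_le_trans (h i) r1.
rewrite /pairs (indic_in h1) (indic_in h2) !mul1r /short_const -mulrA ler_pdivlMl//.
rewrite !wper_cube//.
apply: (@le_trans _ _ (psi xi * snorm (w0 (ps xi x) - w0 x) `^ p)).
  by apply: ler_wpM2r => //; exact: powR_ge0.
set dw := w0 (ps xi x) - w0 x.
apply: (@le_trans _ _ (psi xi * (2 `^ p * (snorm (M *m xi.1 + dw) `^ p + snorm (M *m xi.1) `^ p)))).
  apply: ler_wpM2l => //.
  apply: (@le_trans _ _ ((snorm (M *m xi.1 + dw) + snorm (M *m xi.1)) `^ p)).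
    by apply: le_powR; [exact: ltW|exact: snorm_ge0|exact: snorm_le_addl].
  exact: powRD_le p1' (snorm_ge0 _) (snorm_ge0 _).
rewrite mulrCA -mulrA; apply: ler_wpM2l; first exact: powR_ge0.
have D0 : 0 <= fd vcut xi x by exact: f_ge0.
rewrite mulrDr mulrDl; apply: lerD.
  apply: (le_trans (f_low x xi (M *m xi.1 + dw))); apply: ler_wpM2l => //.
  apply: lerD; last exact: rho_le_theta.
  by rewrite /dens /vcut affine_incr.
apply: (le_trans (affine_powR_le xi)).
by apply: ler_wpM2l; [exact: powR_ge0|rewrite lerDr].
Qed.

Lemma dint_theta_cell_le P (a : X -> R) : 0 <= P -> measurable_fun setT a ->
  (forall xi, 0 <= a xi) ->
  (dint (fun xi x => a xi * cl P xi x)%R <=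
   (P ^+ d.-1 * 2)%:E * \int[vol]_xi (a xi)%:E)%E.
Proof.
move=> P0 ma a0; apply: dint_fst => //.
- exact: jmeas_cell.
- exact: cell_ge0.
- by rewrite lee_fin mulr_ge0// exprn_ge0.
- by move=> xi; exact: cell_integral_le.
Qed.

(** In the short directions [psi] is at least [c0], so that the increments of
    the extension are controlled by the energy density. *)
Lemma short_bound :
  (short <= short_const%:E * (cut_dint + (N%:R ^+ d.-1 * 2)%:E * theta_mass))%E.
Proof.
have mb := @measurable_sbox R d (2 * r).
have mH := @measurable_Hc R d.-1 N%:R.
have mW := measurable_wper.
have mC := @jmeas_cell R d delta N%:R.
have c0' := @cell_ge0 R d delta N%:R.
have mi : jmeas (fun xi x : X => cl N%:R xi x * snorm (wper (ps xi x) - wper x) `^ p).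
  by apply: jmeasM => //; rewrite /jmeas; mfun.
have i0 xi x : 0 <= cl N%:R xi x * snorm (wper (ps xi x) - wper x) `^ p.
  by rewrite mulr_ge0 ?c0' ?powR_ge0.
have -> : short = dint (fun xi x => \1_(sbox (2 * r)) xi *
    (cl N%:R xi x * snorm (wper (ps xi x) - wper x) `^ p)).
  apply: eq_integral => xi _.
  rewrite (ge0_integral_EFinZ vol (jmeas_slice xi mi) (i0 xi) (indic_ge0 _ _)).
  congr (_ * _)%E; apply: eq_integral => x _.
  by rewrite /incr /cell /slab mulrA.
have T0 : forall xi, 0 <= theta xi by exact: theta_ge0.
have mTC : jmeas (fun xi x : X => theta xi * cl N%:R xi x).
  by apply: jmeasM => //; apply: jmeas_fst; exact: measurable_theta.
have TC0 xi x : 0 <= theta xi * cl N%:R xi x by rewrite mulr_ge0 ?c0'.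
have mS : jmeas (fun xi x => cl N%:R xi x * (pairs delta L xi x * fd vcut xi x) +
    theta xi * cl N%:R xi x).
  by apply: measurable_funD; [exact: jmeas_cut|exact: mTC].
have S0 xi x : 0 <= cl N%:R xi x * (pairs delta L xi x * fd vcut xi x) +
    theta xi * cl N%:R xi x by rewrite addr_ge0// cut_ge0.
apply: (@le_trans _ _ (dint (fun xi x => short_const *
    (cl N%:R xi x * (pairs delta L xi x * fd vcut xi x) + theta xi * cl N%:R xi x))%R)).
  apply: le_dint.
  - by apply: jmeasM => //; apply: jmeas_fst; mfun.
  - by apply: jmeasM => //; exact: measurable_cst.
  - by move=> xi x; rewrite mulr_ge0 ?indic_ge0.
  - move=> xi x; have [xs|xs] := pselect (sbox (2 * r) xi).
      by rewrite (indic_in xs) mul1r; exact: short_incr_le.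
    by rewrite (indic_out xs) mul0r mulr_ge0 ?short_const_ge0.
rewrite (dintZ mS S0 short_const_ge0) (dintD jmeas_cut mTC cut_ge0 TC0).
apply: lee_wpmul2l; first by rewrite lee_fin short_const_ge0.
by apply: leeD2l; apply: dint_theta_cell_le => //; exact: measurable_theta.
Qed.

Definition far_const : R :=
  (r ^+ d.-1 * r)^-1 * ((r^-1 + 1) `^ p * (2 `^ p * 2)).

Lemma far_const_ge0 : 0 <= far_const.
Proof.
by rewrite mulr_ge0 ?invr_ge0 ?mulr_ge0 ?exprn_ge0 ?(ltW r0) ?powR_ge0.
Qed.

(** In the long directions coercivity may degenerate. There the increments are
    controlled by the short ones, and [psi] times the growth in [xi] is at most
    [theta]. *)
Lemma far_energy_le xi :
  ((far xi * psi xi)%:E * incr_energy p delta N%:R wper xi <=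
   (far_const * theta xi)%:E * short)%E.
Proof.
have G0 : (0 <= incr_energy p delta N%:R wper xi)%E by exact: incr_energy_ge0.
have S0 : (0 <= short)%E.
  apply: integral_ge0 => e _; apply: mule_ge0; first by rewrite lee_fin indic_ge0.
  exact: incr_energy_ge0.
have T0 : 0 <= theta xi by exact: theta_ge0.
have [x1|x1] := pselect (1 <= xnorm xi); last first.
  rewrite /far (indic_out (x1 : ~ [set xi : X | 1 <= xnorm xi] xi)) mul0r mul0e.
  by rewrite mule_ge0// lee_fin mulr_ge0 ?far_const_ge0.
rewrite /far (indic_in (x1 : [set xi : X | 1 <= xnorm xi] xi)) mul1r.
have rr0 : 0 < r ^+ d.-1 * r by rewrite mulr_gt0// exprn_gt0.
have h := incr_energy_growth (ltW p1) delta0 NR0 measurable_wper hperiodic_wper r0 dr x1.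
have h' : (incr_energy p delta N%:R wper xi <= (far_const * xnorm xi `^ p)%:E * short)%E.
  have ri0 : (0 <= ((r ^+ d.-1 * r)^-1)%:E)%E by rewrite lee_fin invr_ge0 ltW.
  have := lee_wpmul2l ri0 h.
  rewrite [X in (X <= _)%E -> _]muleA -EFinM mulVf ?gt_eqF// mul1e.
  by move=> /le_trans; apply; rewrite muleA -EFinM /far_const -!mulrA.
apply: (le_trans (lee_wpmul2l _ h')); first by rewrite lee_fin.
rewrite muleA -EFinM; apply: lee_wpmul2r => //; rewrite lee_fin mulrCA.
by apply: ler_wpM2l; [exact: far_const_ge0|exact: psi_le_theta].
Qed.

Definition far_weight (xi : X) : R := badfrac N xi `^ (p - 1) * (far xi * psi xi).
Definition incr_sum (xi x : X) : R :=
  \sum_(k : box N) snorm (wper (ps xi (hsh (vecn k) x)) - wper (hsh (vecn k) x)) `^ p.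

Lemma far_weight_ge0 xi : 0 <= far_weight xi.
Proof. by rewrite mulr_ge0 ?powR_ge0// mulr_ge0 ?indic_ge0. Qed.

Lemma measurable_far_weight : measurable_fun setT far_weight.
Proof.
have mf : measurable [set xi : X | 1 <= xnorm xi].
  rewrite -[X in measurable X]setTI; have := @measurable_xnorm R d.
  move=> /(_ measurableT `[1, +oo[%classic (measurable_itv _)); congr measurable.
  by congr (_ `&` _); apply/seteqP; split => xi /=; rewrite in_itv/= andbT.
have mb := @measurable_badfrac R d N.
by rewrite /far_weight /far; mfun.
Qed.

Lemma incr_sum_ge0 xi x : 0 <= incr_sum xi x.
Proof. by apply: sumr_ge0 => k _; exact: powR_ge0. Qed.

Lemma jmeas_incr_sum : jmeas incr_sum.
Proof. by have mW := measurable_wper; rewrite /jmeas /incr_sum; mfun. Qed.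

Lemma dint_far_le :
  (dint (fun xi x => far_weight xi * (cl 1 xi x * incr_sum xi x))%R <=
   (far_const%:E * short) * \int[vol]_xi (badfrac N xi `^ (p - 1) * theta xi)%:E)%E.
Proof.
have mW := measurable_wper.
have S0 : (0 <= short)%E.
  apply: integral_ge0 => e _; apply: mule_ge0; first by rewrite lee_fin indic_ge0.
  exact: incr_energy_ge0.
have K0 := far_const_ge0.
have T0 : forall xi, 0 <= theta xi by exact: theta_ge0.
have mT := measurable_theta; have mb := @measurable_badfrac R d N.
have mE : jmeas (fun xi x : X => cl 1 xi x * incr_sum xi x).
  by apply: jmeasM; [exact: jmeas_cell|exact: jmeas_incr_sum].
have E0 xi x : 0 <= cl 1 xi x * incr_sum xi x by rewrite mulr_ge0 ?cell_ge0 ?incr_sum_ge0.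
rewrite -ge0_integralZl//; last 3 first.
- by mfun.
- by move=> xi _; rewrite lee_fin mulr_ge0 ?powR_ge0.
- by rewrite mule_ge0// lee_fin.
apply: ge0_le_integral => //.
- by move=> xi _; apply: integral_EFin_ge0 => x; rewrite mulr_ge0 ?far_weight_ge0.
- apply: (@measurable_integral2 R _ _ _ _ vol
    (fun z : X * X => (far_weight z.1 * (cl 1 z.1 z.2 * incr_sum z.1 z.2))%:E)).
    apply/measurable_EFinP; apply: measurable_funM => //.
    exact: (measurableT_comp measurable_far_weight measurable_fst).
  by move=> z; rewrite lee_fin mulr_ge0 ?far_weight_ge0.
- by apply: emeasurable_funM; [exact: measurable_cst|mfun].
move=> xi _.
rewrite (ge0_integral_EFinZ vol (jmeas_slice xi mE) (E0 xi) (far_weight_ge0 xi)).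
have -> : (\int[vol]_x (cl 1 xi x * incr_sum xi x)%:E =
    incr_energy p delta N%:R wper xi)%E.
  have mi : measurable_fun setT (fun x : X => incr p delta wper xi x).
    apply: (@measurable_incr2 R d m p delta wper mW _ _ (fun=> xi) id).
      exact: measurable_cst.
    exact: measurable_id.
  rewrite /incr_energy (integral_unit_box_sum N mi (incr_ge0 p delta wper xi)).
  apply: eq_integral => x _; rewrite /cell -mulrA /incr_sum; congr (_ * _)%:E.
  by rewrite mulr_sumr; apply: eq_bigr.
rewrite /far_weight EFinM -muleA.
apply: (@le_trans _ _ ((badfrac N xi `^ (p - 1))%:E * ((far_const * theta xi)%:E * short))%E).
  by apply: lee_wpmul2l; [rewrite lee_fin powR_ge0|exact: far_energy_le].
by rewrite muleA -EFinM [leRHS]muleAC -EFinM mulrCA.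
Qed.

(** [avg_dens_le] integrated over the cell and the directions. *)
Lemma avg_energy_le s : 0 < s < 1 ->
  (dint (fun xi x => cl 1 xi x * fd uavg xi x)%R <=
    (1 + s * perturb_const)%:E * (((N%:R ^+ d.-1)^-1)%:E * cut_dint) +
    ((1 + s * perturb_const) * affine_const)%:E * (2%:E * \int[vol]_xi (badfrac N xi * theta xi)%:E) +
    (s * perturb_const)%:E * (2%:E * theta_mass) +
    (s `^ (1 - p) * (CU * 2 `^ p))%:E * (((N%:R ^+ d.-1)^-1)%:E * ((far_const%:E * short) *
       \int[vol]_xi (badfrac N xi `^ (p - 1) * theta xi)%:E)))%E.
Proof.
move=> s01; have /andP[s0 s1] := s01.
pose nv : R := (N%:R ^+ d.-1)^-1.
have nv0 : 0 <= nv by rewrite invr_ge0 ltW.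
have T0 : forall xi, 0 <= theta xi by exact: theta_ge0.
have mT := measurable_theta; have mb := @measurable_badfrac R d N.
have mC := @jmeas_cell R d delta 1; have c0' := @cell_ge0 R d delta 1.
have mDv := jmeas_dens delta f_borel measurable_vcut.
have mDu := jmeas_dens delta f_borel measurable_uavg.
have mP := @jmeas_pairs R d delta L.
have b0 xi : 0 <= badfrac N xi by have /andP[] := badfrac01 N xi.
pose F xi x := pairs delta L xi x * fd vcut xi x.
have mF : jmeas F by exact: jmeasM.
have F0 xi x : 0 <= F xi x by rewrite mulr_ge0 ?pairs_ge0 ?f_ge0.
pose A xi x := cl 1 xi x * \sum_(k : box N) F xi (hsh (vecn k) x).
have mA : jmeas A.
  apply: jmeasM => //; rewrite /jmeas; apply: measurable_fsum => k.
  have mk : measurable_fun setT (fun z : X * X => (z.1, hsh (vecn k) z.2)) by mfun.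
  exact: (measurableT_comp mF mk).
have A0 xi x : 0 <= A xi x by rewrite mulr_ge0// sumr_ge0.
have dA : dint A = cut_dint by rewrite /A -(dint_box_sum N mF F0).
pose B xi x := badfrac N xi * theta xi * cl 1 xi x.
have mB' : measurable_fun setT (fun xi => badfrac N xi * theta xi) by mfun.
have mB : jmeas B by apply: jmeasM => //; apply: jmeas_fst; exact: mB'.
have B0' xi : 0 <= badfrac N xi * theta xi by apply: mulr_ge0; [exact: b0|exact: T0].
have B0 xi x : 0 <= B xi x by apply: mulr_ge0; [exact: B0'|exact: c0'].
have dB : (dint B <= 2%:E * \int[vol]_xi (badfrac N xi * theta xi)%:E)%E.
  by have := dint_theta_cell_le ler01 mB' B0'; rewrite expr1n mul1r.
pose C xi x := theta xi * cl 1 xi x.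
have mCc : jmeas C by apply: jmeasM => //; apply: jmeas_fst; exact: mT.
have Cc0 xi x : 0 <= C xi x by apply: mulr_ge0; [exact: T0|exact: c0'].
have dC : (dint C <= 2%:E * theta_mass)%E.
  by have := dint_theta_cell_le ler01 mT T0; rewrite expr1n mul1r.
pose E xi x := far_weight xi * (cl 1 xi x * incr_sum xi x).
have mE : jmeas E.
  apply: jmeasM; first by apply: jmeas_fst; exact: measurable_far_weight.
  by apply: jmeasM => //; exact: jmeas_incr_sum.
have E0 xi x : 0 <= E xi x.
  by rewrite mulr_ge0 ?far_weight_ge0// mulr_ge0 ?incr_sum_ge0.
have dE := dint_far_le.
have sC : 0 <= s * perturb_const by rewrite mulr_ge0 ?perturb_const_ge0// ltW.
have sC' : 0 <= 1 + s * perturb_const by rewrite addr_ge0.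
have sC3 : 0 <= (1 + s * perturb_const) * affine_const by rewrite mulr_ge0 ?affine_const_ge0.
have q0 : 0 <= s `^ (1 - p) * (CU * 2 `^ p) by rewrite !mulr_ge0 ?powR_ge0.
set q := s `^ (1 - p) * (CU * 2 `^ p) in q0 *.
have mZ (c : R) G : jmeas G -> jmeas (fun xi x : X => c * G xi x).
  by move=> mG; apply: jmeasM => //; exact: measurable_cst.
have Z0 (c : R) (G : X -> X -> R) : 0 <= c -> (forall xi x, 0 <= G xi x) ->
    forall xi x, 0 <= c * G xi x.
  by move=> ? ? xi x; rewrite mulr_ge0.
have mD G H : jmeas G -> jmeas H -> jmeas (fun xi x : X => G xi x + H xi x).
  exact: measurable_funD.
have P0 (G H : X -> X -> R) : (forall xi x, 0 <= G xi x) -> (forall xi x, 0 <= H xi x) ->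
    forall xi x, 0 <= G xi x + H xi x.
  by move=> ? ? xi x; rewrite addr_ge0.
have m1 := mZ (1 + s * perturb_const) _ (mZ nv _ mA); have p1' := Z0 _ _ sC' (Z0 _ _ nv0 A0).
have m2 := mZ ((1 + s * perturb_const) * affine_const) _ mB; have p2' := Z0 _ _ sC3 B0.
have m3 := mZ (s * perturb_const) _ mCc; have p3' := Z0 _ _ sC Cc0.
have m4 := mZ q _ (mZ nv _ mE); have p4' := Z0 _ _ q0 (Z0 _ _ nv0 E0).
have m12 := mD _ _ m1 m2; have p12 := P0 _ _ p1' p2'.
have m123 := mD _ _ m12 m3; have p123 := P0 _ _ p12 p3'.
apply: (@le_trans _ _ (dint (fun xi x => (1 + s * perturb_const) * (nv * A xi x) +
   (1 + s * perturb_const) * affine_const * B xi x + s * perturb_const * C xi x + q * (nv * E xi x))%R)).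
  apply: le_dint.
  - exact: jmeasM.
  - exact: mD.
  - by move=> xi x; rewrite mulr_ge0 ?f_ge0.
  - move=> xi x; have [xH|xH] := pselect (Hc 1 x.1); last first.
      rewrite {1}/cell (indic_out xH) !mul0r.
      by apply: addr_ge0; [exact: p123|exact: p4'].
    have h := avg_dens_le xi s01 xH.
    apply: (le_trans (ler_wpM2l (c0' xi x) h)); rewrite /A /B /C /E /F -/nv -/q.
    rewrite le_eqVlt; apply/orP; left; apply/eqP.
    rewrite -/(incr_sum xi x) -/(far_weight xi).
    by move: (\sum_(k : box N) _) (incr_sum xi x) (far_weight xi) (badfrac N xi) (theta xi) (cl 1 xi x) => *; ring.
rewrite (dintD m123 m4 p123 p4') (dintD m12 m3 p12 p3') (dintD m1 m2 p1' p2').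
rewrite (dintZ (mZ nv _ mA) (Z0 _ _ nv0 A0) sC') (dintZ mA A0 nv0) dA.
rewrite (dintZ mB B0 sC3) (dintZ mCc Cc0 sC).
rewrite (dintZ (mZ nv _ mE) (Z0 _ _ nv0 E0) q0) (dintZ mE E0 nv0).
apply: leeD; last first.
  apply: lee_wpmul2l; first by rewrite lee_fin.
  by apply: lee_wpmul2l; [rewrite lee_fin|exact: dE].
apply: leeD; last by apply: lee_wpmul2l; [rewrite lee_fin|exact: dC].
by apply: leeD => //; apply: lee_wpmul2l; [rewrite lee_fin|exact: dB].
Qed.

End averaging.

Lemma cut_energy N L v : L <= N%:R -> measurable_fun setT v -> D1 p M L v ->
  energy f delta (int1 delta L) v = (kappa%:E * cut_dint N L v)%E.
Proof.
move=> LN mv vD; have mc := measurable_vcut L mv.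
rewrite (energy_ae delta f_ge0 f_borel (@measurable_int1 R d delta L) mv mc (vcut_ae vD)).
exact: energy_int1E.
Qed.

(** First [s] is chosen, to make the terms proportional to the energy and to the
    mass of [theta] small, then [N], to make the two integrals of the weights
    small. The errors are proportional to the energy, whence the bound [B]. *)
Lemma lower_bound (B eps : R) : 0 <= B -> 0 < eps ->
  \forall N \near \oo, forall L, N%:R - 1 < L -> L <= N%:R -> forall v, D1 p M L v ->
  (((N%:R ^+ d.-1)^-1)%:E * energy f delta (int1 delta L) v <= B%:E)%E ->
  (energy f delta (per_dom delta) (uavg N L v) <=
   ((N%:R ^+ d.-1)^-1)%:E * energy f delta (int1 delta L) v + eps%:E)%E.
Proof.
move=> B0 eps0.
have T0 : forall xi, 0 <= theta xi by exact: theta_ge0.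
have mT := measurable_theta.
have k1 : 1 <= kappa by rewrite le_max lexx orbT.
have k0 : 0 < kappa by exact: lt_le_trans ltr01 k1.
have TH0 : (0 <= theta_mass)%E by exact: integral_EFin_ge0.
have THfin : theta_mass \is a fin_num by rewrite ge0_fin_numE.
pose t := fine theta_mass.
have tE : theta_mass = t%:E by rewrite fineK.
have t0 : 0 <= t by exact: fine_ge0.
have C10 := perturb_const_ge0; have C30 := affine_const_ge0; have C50 := short_const_ge0; have K40 := far_const_ge0.
pose K := kappa * (perturb_const * B + 2 * perturb_const * t).
have K0 : 0 <= K.
  apply: mulr_ge0; first exact: ltW.
  by apply: addr_ge0; [exact: mulr_ge0|apply: mulr_ge0 => //; exact: mulr_ge0].
pose s := Num.min 2^-1 (eps / (2 * (K + 1))).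
have K1 : 0 < 2 * (K + 1) by rewrite mulr_gt0// ltr_wpDl.
have s0 : 0 < s by rewrite lt_min invr_gt0 ltr0n/= divr_gt0.
have s1 : s < 1.
  by rewrite gt_min; apply/orP; left; rewrite invf_lt1 ?ltr1n// ltr0n.
have sK : s * K <= eps / 2.
  apply: (@le_trans _ _ (eps / (2 * (K + 1)) * K)).
    by apply: ler_wpM2r => //; rewrite ge_min lexx orbT.
  exact: scaled_half_le.
pose q := s `^ (1 - p) * (CU * 2 `^ p).
have q0 : 0 <= q by rewrite !mulr_ge0 ?powR_ge0.
pose Z := short_const * (B + 2 * t).
have Z0 : 0 <= Z by rewrite mulr_ge0// addr_ge0// mulr_ge0.
pose Q := kappa * ((1 + s * perturb_const) * affine_const * 2 + q * (far_const * Z)).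
have sC' : 0 <= 1 + s * perturb_const by rewrite addr_ge0// mulr_ge0// ltW.
have Q0 : 0 <= Q.
  apply: mulr_ge0; first exact: ltW.
  apply: addr_ge0; first by apply: mulr_ge0 => //; exact: mulr_ge0.
  by apply: mulr_ge0 => //; exact: mulr_ge0.
have Q1 : 0 < 2 * (Q + 1) by rewrite mulr_gt0// ltr_wpDl.
pose eta := eps / (2 * (Q + 1)).
have eta0 : 0 < eta by rewrite divr_gt0.
have etaQ : eta * Q <= eps / 2 by exact: scaled_half_le.
have p10 : 0 < p - 1 by rewrite subr_gt0.
have mb N : measurable_fun setT (fun xi : X => badfrac N xi `^ (p - 1)).
  by have mbf := @measurable_badfrac R d N; mfun.
have b01 N (xi : X) : 0 <= badfrac N xi `^ (p - 1) <= 1.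
  have /andP[h1 h2] := badfrac01 N xi; rewrite powR_ge0/=.
  apply: (@le_trans _ _ (1 `^ (p - 1))); last by rewrite powR1.
  by apply: le_powR => //; exact: ltW.
have small1 := integral_weight_small mT T0 theta_fin (@measurable_badfrac R d)
  (@badfrac01 R d) (@badfrac_cvg0 R d) eta0.
have small2 := integral_weight_small mT T0 theta_fin mb b01
  (fun xi => badfrac_powR_cvg0 xi p10) eta0.
near=> N => L NL LN v vD EB.
have N0 : (0 < N)%N by near: N; exact: nbhs_infty_gt.
have Nn0 : 0 < N%:R ^+ d.-1 :> R by rewrite exprn_gt0// ltr0n.
have I1 : (\int[vol]_xi (badfrac N xi * theta xi)%:E <= eta%:E)%E.
  by near: N; exact: small1.
have I2 : (\int[vol]_xi (badfrac N xi `^ (p - 1) * theta xi)%:E <= eta%:E)%E.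
  by near: N; exact: small2.
have mv : measurable_fun setT v by case: vD => -[].
have mu := measurable_uavg N L mv.
have DE := cut_energy LN mv vD.
pose nv : R := (N%:R ^+ d.-1)^-1.
have nv0 : 0 <= nv by rewrite invr_ge0 ltW.
have D0 : (0 <= nv%:E * cut_dint N L v)%E.
  by apply: mule_ge0; [rewrite lee_fin|apply: dint_ge0 => xi x; exact: cut_ge0].
have EkD : (((N%:R ^+ d.-1)^-1)%:E * energy f delta (int1 delta L) v =
    kappa%:E * (nv%:E * cut_dint N L v))%E by rewrite DE muleCA.
rewrite EkD in EB *.
have DB : (nv%:E * cut_dint N L v <= B%:E)%E.
  apply: le_trans EB; rewrite -[leLHS]mul1e; apply: lee_wpmul2r => //.
have Dfin : (nv%:E * cut_dint N L v)%E \is a fin_num.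
  by rewrite ge0_fin_numE//; apply: le_lt_trans DB _; rewrite ltry.
pose x := fine (nv%:E * cut_dint N L v)%E.
have xE : (nv%:E * cut_dint N L v = x%:E)%E by rewrite fineK.
have x0 : 0 <= x by exact: fine_ge0.
have xB : x <= B by rewrite -lee_fin -xE.
have Sh : (nv%:E * short_energy p delta N%:R (wper N L v) (2 * r) <= Z%:E)%E.
  apply: (@le_trans _ _ (nv%:E * (short_const%:E * (cut_dint N L v + (N%:R ^+ d.-1 * 2)%:E * theta_mass)))%E).
    by apply: lee_wpmul2l; [rewrite lee_fin|exact: short_bound].
  rewrite muleCA /Z [leRHS]EFinM; apply: lee_wpmul2l; first by rewrite lee_fin.
  rewrite ge0_muleDr; last 2 first.
  - by apply: dint_ge0 => xi y; exact: cut_ge0.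
  - by rewrite mule_ge0// lee_fin mulr_ge0// ltW.
  rewrite xE tE -!EFinM lee_fin lerD// /nv mulrA mulrA mulVf ?gt_eqF// mul1r//.
have s01 : 0 < s < 1 by rewrite s0 s1.
rewrite (energy_perE delta f_ge0 f_borel mu).
apply: (@le_trans _ _ (kappa%:E * ((1 + s * perturb_const) * x + (1 + s * perturb_const) * affine_const * (2 * eta) +
    s * perturb_const * (2 * t) + q * (far_const * Z * eta))%:E)%E).
  apply: lee_wpmul2l; first by rewrite lee_fin ltW.
  apply: (le_trans (avg_energy_le N0 NL LN mv s01)).
  rewrite -/nv -/q xE tE [leRHS]EFinD; apply: leeD.
    rewrite [leRHS]EFinD; apply: leeD; first (rewrite [leRHS]EFinD; apply: leeD).
  - by rewrite EFinM.
  - rewrite [leRHS]EFinM; apply: lee_wpmul2l; first by rewrite lee_fin mulr_ge0.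
    by rewrite [leRHS]EFinM; apply: lee_wpmul2l.
  - by rewrite !EFinM.
  - rewrite [leRHS]EFinM; apply: lee_wpmul2l; first by rewrite lee_fin.
    have -> : (nv%:E * (far_const%:E * short_energy p delta N%:R (wper N L v) (2 * r) *
        \int[vol]_xi (badfrac N xi `^ (p - 1) * theta xi)%:E) =
      far_const%:E * (nv%:E * short_energy p delta N%:R (wper N L v) (2 * r)) *
        \int[vol]_xi (badfrac N xi `^ (p - 1) * theta xi)%:E)%E.
      by rewrite muleA [X in (X * _ = _)%E]muleCA.
    rewrite !EFinM; apply: lee_pmul => //.
    - apply: mule_ge0; [by rewrite lee_fin|apply: mule_ge0; first by rewrite lee_fin].
      apply: integral_ge0 => e _; apply: mule_ge0; first by rewrite lee_fin indic_ge0.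
      exact: incr_energy_ge0.
    - by apply: integral_EFin_ge0 => xi; rewrite mulr_ge0 ?powR_ge0.
    - by apply: lee_wpmul2l; [rewrite lee_fin|exact: Sh].
rewrite xE -!EFinM -EFinD lee_fin.
have h1 : s * (kappa * (perturb_const * x + 2 * perturb_const * t)) <= s * K.
  apply: ler_wpM2l; first exact: ltW.
  apply: ler_wpM2l; first exact: ltW.
  by rewrite lerD2r; exact: ler_wpM2l.
have h2 : kappa * ((1 + s * perturb_const) * x + (1 + s * perturb_const) * affine_const * (2 * eta) +
    s * perturb_const * (2 * t) + q * (far_const * Z * eta)) =
    kappa * x + s * (kappa * (perturb_const * x + 2 * perturb_const * t)) + eta * Q.
  by rewrite /Q; ring.
by rewrite h2; lra.
Unshelve. all: by end_near. Qed.

(** A box is covered by finitely many periods of the extension. *)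
Lemma wper_cbox N L v (A : R) : (0 < N)%N -> L <= N%:R -> D1 p M L v -> 0 < A ->
  (\int[vol]_x (\1_(cbox A) x * snorm (wper N L v x) `^ p)%:E < +oo)%E.
Proof.
move=> N0 LN [vL _] A0.
have [mv _] := vL.
have mc := measurable_vcut L mv; have mW := measurable_wper N L mv.
have mw := measurable_w0 L mv.
have p1' : 1 <= p by exact: ltW.
have NR0 : 0 < N%:R :> R by rewrite ltr0n.
pose q := (2 * (Num.truncn (A / N%:R)).+1)%N.
pose b : 'cV[R]_d.-1 := \col_i (- ((Num.truncn (A / N%:R)).+1%:R * N%:R)).
pose F (x : X) := \1_[set t : R | `|t| <= A] x.2 * snorm (wper N L v x) `^ p.
have mA : measurable [set t : R | `|t| <= A].
  have -> : [set t : R | `|t| <= A] = `[- A, A]%classic.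
    by apply/seteqP; split => t /=; rewrite in_itv/= -ler_norml.
  exact: measurable_itv.
have mF : measurable_fun setT F by rewrite /F; mfun.
have F0 x : 0 <= F x by rewrite mulr_ge0 ?indic_ge0 ?powR_ge0.
have PF : hperiodic N%:R F by move=> k x; rewrite /F hperiodic_wper.
have mM : measurable_fun setT (fun x : X => M *m x.1) by mfun.
have mB := @measurable_cbox R d (Num.max A N%:R).
have mHN := @measurable_Hc R d.-1 N%:R.
have w0_cbox : (\int[vol]_x (\1_(cbox (Num.max A N%:R)) x * snorm (w0 L v x) `^ p)%:E < +oo)%E.
  apply: (cbox_le_add p1' mw mv mM _ (Lploc_cbox p1' _ vL) (cbox_affine p1' M _)).
  apply: aeW => x; rewrite /w0 snormZ ger0_norm ?indic_ge0//.
  apply: (@le_trans _ _ (snorm (v x - M *m x.1))).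
    by apply: ler_piMl; [exact: snorm_ge0|exact: indic_le1].
  by apply: le_trans (snormD _ _) _; rewrite snormN.
have FW : (\int[vol]_x (\1_(Hc N%:R) x.1 * F x)%:E < +oo)%E.
  apply: le_lt_trans w0_cbox; apply: ge0_le_integral_EFin.
  - by apply: measurable_funM; [mfun|exact: mF].
  - by apply: measurable_funM; [mfun|apply: measurable_powRT; exact: measurable_snorm].
  - by move=> x; rewrite mulr_ge0 ?indic_ge0.
  - move=> x; rewrite /F mulrA.
    have [xH|xH] := pselect (Hc N%:R x.1); last first.
      by rewrite (indic_out xH) !mul0r mulr_ge0 ?indic_ge0 ?powR_ge0.
    rewrite /wper /= (red_id NR0 xH); apply: ler_wpM2r; first exact: powR_ge0.
    rewrite (indic_in xH) mul1r; apply: le_indic => xA; split=> [i|].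
      by have /andP[h1 h2] := xH i; rewrite ger0_norm// le_max (ltW h2) orbT.
    by rewrite le_max [`|_| <= _]xA.
have mH := @measurable_Hc R d.-1 (q%:R * N%:R).
have mb' := @measurable_cbox R d A.
apply: (@le_lt_trans _ _ (\int[vol]_x (\1_(Hc (q%:R * N%:R)) x.1 * F (x + (b, 0)%R)%R)%:E)%E).
  rewrite -(integral_EFin_shift (b, 0) (g := fun x : X => \1_(cbox A) x * snorm (wper N L v x) `^ p)).
  - apply: ge0_le_integral_EFin.
    + have ma := measurable_addx (b, 0 : R); have := measurable_powRT p (measurable_snorm mW) => m1.
      apply: (measurable_funM (f := fun x : X => \1_(cbox A) (x + (b, 0)) : R)
        (g := fun x : X => snorm (wper N L v (x + (b, 0))) `^ p)).
        exact: (measurable_indicT mb' ma).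
      exact: (measurableT_comp m1 ma).
    + by apply: measurable_funM; [mfun|exact: (measurableT_comp mF (measurable_addx _))].
    + by move=> x; rewrite mulr_ge0 ?indic_ge0 ?powR_ge0.
    + move=> x; rewrite /F mulrA; apply: ler_wpM2r; first exact: powR_ge0.
      have [xA|xA] := pselect (cbox A (x + (b, 0))); last first.
        by rewrite (indic_out xA) mulr_ge0 ?indic_ge0.
      have [h1 h2] := xA.
      rewrite (indic_in xA) !indic_in ?mulr1// => i.
      have tA : A < (Num.truncn (A / N%:R)).+1%:R * N%:R by rewrite -ltr_pdivrMr// truncnS_gt.
      have := h1 i; rewrite add_fst /b !mxE ler_norml => /andP[h3 h4].
      by rewrite /q natrM; apply/andP; split; lra.
  - by mfun.
  - by move=> x; rewrite mulr_ge0 ?indic_ge0 ?powR_ge0.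
have mFb : measurable_fun setT (fun x : X => F (x + (b, 0))).
  exact: (measurableT_comp mF (measurable_addx _)).
rewrite (integral_box_sum q NR0 mFb (fun x => F0 _)).
have shiftE (k : {ffun 'I_d.-1 -> 'I_q}) :
    (\int[vol]_x (\1_(Hc N%:R) x.1 * F (hsh (N%:R *: vecn k) x + (b, 0)))%:E =
     \int[vol]_x (\1_(Hc N%:R) x.1 * F x)%:E)%E.
  transitivity (\int[vol]_x (\1_(Hc N%:R) x.1 * F (x + (b, 0)))%:E)%E; last first.
    exact: (integral_periodic_shift (b, 0) NR0 mF F0 PF).
  apply: eq_integral => x _.
  have -> : hsh (N%:R *: vecn k) x + (b, 0) =
      hsh (N%:R *: map_mx intr (\col_i (k i : nat)%:Z)) (x + (b, 0)).
    rewrite !hshE addrAC; congr (_ + _ + (_, _)).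
    by apply/matrixP => i j; rewrite !mxE.
  by rewrite PF.
under eq_integral do rewrite mulr_sumr.
rewrite ge0_integral_EFin_sum; last 2 first.
- move=> k; apply: measurable_funM; first by mfun.
  exact: (measurableT_comp mFb (measurable_hsh _)).
- by move=> k x; apply: mulr_ge0; [exact: indic_ge0|exact: F0].
by apply: lte_sum_pinfty => k _; rewrite shiftE; exact: FW.
Qed.

Lemma cbox_hsh_vecn (A : R) N (k : box N) (x : X) :
  cbox A x -> cbox (A + N%:R) (hsh (vecn k) x).
Proof.
case=> h1 h2; split=> [i|]; last by apply: (le_trans h2); rewrite lerDl.
have -> : (hsh (vecn k) x).1 i ord0 = x.1 i ord0 + (k i)%:R by rewrite mxE [X in _ + X]mxE.
apply: (le_trans (ler_normD _ _)); apply: lerD; first exact: h1.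
by rewrite normr_nat ler_nat ltnW.
Qed.

Lemma uavg_Dper N L v : (0 < N)%N -> L <= N%:R -> D1 p M L v ->
  Dper p M (uavg N L v).
Proof.
move=> N0 LN vD; have mv : measurable_fun setT v by case: vD => -[].
have mW := measurable_wper N L mv; have ma := measurable_wavg N L mv.
have mu := measurable_uavg N L mv.
have p1' : 1 <= p by exact: ltW.
have p0 : 0 <= p by exact: le_trans p1'.
split; last first.
  move=> k y; apply: aeW => x.
  have key (t : X) : uavg N L v t - M *m t.1 = wavg N L v t.
    by rewrite /uavg addrAC subrr add0r.
  apply: etrans (key (y x)) _; apply: etrans _ (esym (key x)).
  by apply: wavg_hsh.
apply: (cbox_Lploc p1' mu) => A A0.
have mA := @measurable_cbox R d A; have mAN := @measurable_cbox R d (A + N%:R).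
have AN0 : 0 < A + N%:R by rewrite ltr_wpDr.
have mM : measurable_fun setT (fun x : X => M *m x.1) by mfun.
apply: (cbox_le_add p1' mu mM ma _ (cbox_affine p1' M A)).
  by apply: aeW => x; exact: snormD.
pose G (k : box N) (x : X) : R := \1_(cbox A) x * snorm (wper N L v (hsh (vecn k) x)) `^ p.
have mG k : measurable_fun setT (G k).
  apply: measurable_funM; first exact: measurable_indicT.
  by apply: measurable_powRT; apply: measurable_snorm; exact: measurableT_comp mW (measurable_hsh _).
have G0 k x : 0 <= G k x by rewrite mulr_ge0 ?indic_ge0 ?powR_ge0.
have nv1 : (N%:R ^+ d.-1)^-1 <= 1 :> R.
  by rewrite invf_le1 ?exprn_gt0 ?ltr0n// exprn_ege1// ler1n.
have nv0 : 0 <= (N%:R ^+ d.-1)^-1 :> R by rewrite invr_ge0 exprn_ge0.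
apply: (@le_lt_trans _ _ (\int[vol]_x (\sum_(k : box N) G k x)%:E)%E).
  apply: ge0_le_integral_EFin.
  - by apply: measurable_funM; [mfun|apply: measurable_powRT; exact: measurable_snorm].
  - exact: measurable_fsum.
  - by move=> x; rewrite mulr_ge0 ?indic_ge0 ?powR_ge0.
  - move=> x; rewrite /G -mulr_sumr; apply: ler_wpM2l; first exact: indic_ge0.
    have B0 : (0 < #|{: box N}|)%N by rewrite -(ltr_nat R) card_box exprn_gt0// ltr0n.
    apply: (@le_trans _ _ ((#|{: box N}|%:R^-1 *
        \sum_(k : box N) snorm (wper N L v (hsh (vecn k) x))) `^ p)).
      apply: le_powR => //; first exact: snorm_ge0.
      rewrite /wavg snormZ card_box ger0_norm//; apply: ler_wpM2l => //.
      exact: snorm_sum.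
    apply: (le_trans (powR_avg p1' B0 (fun k => snorm_ge0 _))).
    by rewrite card_box ler_piMl//; apply: sumr_ge0 => k _; exact: powR_ge0.
rewrite (ge0_integral_EFin_sum vol _ mG G0); apply: lte_sum_pinfty => k _.
pose H (x : X) : R := \1_(cbox (A + N%:R)) x * snorm (wper N L v x) `^ p.
have mH : measurable_fun setT H by rewrite /H; mfun.
have H0 x : 0 <= H x by rewrite mulr_ge0 ?indic_ge0 ?powR_ge0.
apply: le_lt_trans (wper_cbox N0 LN vD AN0).
pose a : X := (vecn k, 0); have E := integral_EFin_shift a mH H0.
apply: (@le_trans _ _ (\int[vol]_x (H (x + a))%:E)%E); last first.
  by rewrite le_eqVlt; apply/orP; left; apply/eqP; exact: E.
apply: ge0_le_integral_EFin; [exact: mG| |exact: G0|].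
  exact: (measurableT_comp mH (measurable_addx _)).
move=> x; rewrite /G /H /a -hshE; apply: ler_wpM2r; first exact: powR_ge0.
have [xA|xA] := pselect (cbox A x); last by rewrite (indic_out xA) indic_ge0.
have xN : cbox (A + N%:R) (hsh (vecn k) x) by exact: cbox_hsh_vecn.
by rewrite (indic_in xN) indic_le1.
Qed.

(** * The cell formula *)

Hypothesis n0 : (0 < d.-1)%N.

Local Notation Eper := (energy f delta (per_dom delta)).
Local Notation Ebox L := (energy f delta (int1 delta L)).

Lemma energy_ge0 D v : (0 <= energy f delta D v)%E.
Proof.
apply: mule_ge0; first by rewrite lee_fin le_max ler01 orbT.
apply: integral_ge0 => xi _; apply: integral_ge0 => x _.
by rewrite lee_fin.
Qed.

(** [truncated_energy_le] for the everywhere periodic representative. *)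
Lemma upper_bound u e : Dper p M u -> (Eper u < +oo)%E -> 0 < e ->
  \forall N \near \oo, forall L, N%:R - 1 < L -> L <= N%:R ->
    exists2 v, D1 p M L v &
      (((N%:R ^+ d.-1)^-1)%:E * Ebox L v <= Eper u + e%:E)%E.
Proof.
move=> uD Eu e0; have p1' : 1 <= p by exact: ltW.
pose w := per_corr M u; have mw : measurable_fun setT w by exact: measurable_per_corr uD.
have mu : measurable_fun setT u by case: uD => -[].
have mu' : measurable_fun setT (fun x : X => M *m x.1 + w x) by mfun.
have EE := energy_ae delta f_ge0 f_borel (@measurable_per_dom R d delta) mu mu'
  (per_corr_ae uD).
have ufin : (dint (fun xi x : X => cl 1 xi x * fd (fun x : X => (M *m x.1 + w x)%R) xi x)%R < +oo)%E.
  rewrite EE (energy_perE delta f_ge0 f_borel mu') in Eu.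
  apply: le_lt_trans Eu; apply: lee_pemull.
    by apply: dint_ge0 => xi x; rewrite mulr_ge0 ?cell_ge0 ?f_ge0.
  by rewrite lee_fin le_max lexx orbT.
have := truncated_energy_le mw (@hperiodic_per_corr R d m M u)
  (per_corr_cell p1' uD) ufin e0.
apply: filterS => N h L NL LN.
exists (fun x => M *m x.1 + cutoff L x.1 *: w x); last by rewrite EE; exact: h.
exact: (truncated_D1 mw (fun A _ => per_corr_cbox p1' uD A)).
Qed.

Lemma affine_Dper : Dper p M (fun x : X => M *m x.1).
Proof.
split; last by move=> k y; apply: aeW => x; rewrite !subrr.
apply: cbox_Lploc; [exact: ltW|by mfun|move=> A _].
by apply: cbox_affine; exact: ltW.
Qed.

Lemma affine_energy_fin : (Eper (fun x : X => M *m x.1) < +oo)%E.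
Proof.
have mM : measurable_fun setT (fun x : X => M *m x.1) by mfun.
rewrite (energy_perE delta f_ge0 f_borel mM).
have C30 := affine_const_ge0; set C := affine_const in C30.
have T0 xi : 0 <= theta xi by exact: theta_ge0.
have mT : measurable_fun setT theta by exact: measurable_theta.
have T1 xi : 0 <= C * theta xi by exact: mulr_ge0.
have mT1 : measurable_fun setT (fun xi => C * theta xi).
  by apply: measurable_funM => //; exact: measurable_cst.
apply: lte_mul_pinfty => //; first by rewrite lee_fin le_max ler01 orbT.
apply: (@le_lt_trans _ _ (dint (fun xi x : X => (C * theta xi) * cl 1 xi x))%R).
  apply: le_dint.
  - by apply: jmeasM; [exact: jmeas_cell|exact: (jmeas_dens delta f_borel mM)].
  - by apply: jmeasM; [apply: jmeas_fst; exact: mT1|exact: jmeas_cell].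
  - by move=> xi x; rewrite mulr_ge0 ?cell_ge0 ?f_ge0.
  - move=> xi x; rewrite mulrC; apply: ler_wpM2r; first exact: cell_ge0.
    rewrite /dens /pshift /= mulmxDr addrAC subrr add0r.
    exact: affine_dens_le.
apply: le_lt_trans (dint_theta_cell_le ler01 mT1 T1) _.
rewrite (ge0_integral_EFinZ vol mT T0 C30).
rewrite expr1n mul1r; apply: lte_mul_pinfty; rewrite ?lee_fin//.
by apply: lte_mul_pinfty; rewrite ?lee_fin.
Qed.

Local Notation Pi := (ereal_inf [set Eper u | u in Dper p M]%classic).

Lemma cell_value_fin : Pi \is a fin_num.
Proof.
rewrite ge0_fin_numE; last first.
  by apply: le_ereal_inf_tmp => _ [u _ <-]; exact: energy_ge0.
apply: le_lt_trans affine_energy_fin; apply: ereal_inf_lbound.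
by exists (fun x => M *m x.1) => //; exact: affine_Dper.
Qed.

(** A nearly optimal periodic function is truncated. The normalizations by the
    volumes of the cubes of sides [N] and [L] differ by a factor close to 1. *)
Lemma approx_upper e : 0 < e ->
  \forall L \near +oo, (fhom_approx f delta p M L <= Pi + e%:E)%E.
Proof.
move=> e0; have e3 : 0 < e / 3 by rewrite divr_gt0// ltr0n.
have [_ [u uD <-] uP] := lb_ereal_inf_adherent e3 cell_value_fin.
pose a := fine Pi; have aE : Pi = a%:E by rewrite fineK// cell_value_fin.
have Eu : (Eper u < +oo)%E by apply: lt_le_trans uP _; exact: leey.
have h := near_block (upper_bound uD Eu e3).
have a0 : 0 <= a.
  apply: fine_ge0; apply: le_ereal_inf_tmp => _ [v _ <-]; exact: energy_ge0.
pose b := a + e / 3 + e / 3; have b0 : 0 < b by rewrite /b; lra.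
near=> L.
have L1 : 1 <= L by near: L; apply: nbhs_pinfty_ge; exact: num_real.
have L0 : 0 < L by exact: lt_le_trans ltr01 L1.
have Lb : b * 3 ^+ d.-1 * 3 / e <= L by near: L; apply: nbhs_pinfty_ge; exact: num_real.
have [N [NL LN [v vD vE]]] : exists N : nat, [/\ N%:R - 1 < L, L <= N%:R &
    exists2 v, D1 p M L v & (((N%:R ^+ d.-1)^-1)%:E * Ebox L v <= Eper u + (e / 3)%:E)%E].
  by near: L; exact: h.
have NR0 : 0 < N%:R :> R by exact: lt_le_trans LN.
have Ln0 : 0 < L ^+ d.-1 by rewrite exprn_gt0.
have Nn0 : 0 < N%:R ^+ d.-1 :> R by rewrite exprn_gt0.
apply: (@le_trans _ _ ((L ^- d.-1)%:E * Ebox L v)%E).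
  apply: lee_wpmul2l; first by rewrite lee_fin invr_ge0 ltW.
  by apply: ereal_inf_lbound; exists v.
have vb : (((N%:R ^+ d.-1)^-1)%:E * Ebox L v <= b%:E)%E.
  apply: (le_trans vE); rewrite /b EFinD; apply: leeD => //.
  by rewrite EFinD -aE; exact: ltW.
have -> : L ^- d.-1 = (N%:R / L) ^+ d.-1 * (N%:R ^+ d.-1)^-1.
  by rewrite expr_div_n mulrAC divff ?mul1r// gt_eqF.
rewrite EFinM -muleA.
apply: (@le_trans _ _ (((N%:R / L) ^+ d.-1)%:E * b%:E)%E).
  by apply: lee_wpmul2l => //; rewrite lee_fin exprn_ge0// divr_ge0 ?ltW.
rewrite aE -EFinM -EFinD lee_fin.
have Li : L^-1 <= 1 by rewrite invf_le1.
have Li0 : 0 <= L^-1 by rewrite invr_ge0 ltW.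
have NL' : N%:R / L <= 1 + L^-1.
  by rewrite ler_pdivrMr// mulrDl mul1r mulVf ?gt_eqF//; move: NL; lra.
apply: (@le_trans _ _ ((1 + 3 ^+ d.-1 * L^-1) * b)).
  apply: ler_wpM2r; first exact: ltW.
  apply: le_trans (exprDl_le d.-1 Li0 Li).
  apply: lerXn2r => //; first by rewrite nnegrE divr_ge0 ?ltW.
  by rewrite nnegrE addr_ge0.
have : b * 3 ^+ d.-1 * L^-1 <= e / 3.
  rewrite ler_pdivrMr//; move: Lb; rewrite ler_pdivrMr//.
  by move: (b * 3 ^+ d.-1) => c; lra.
rewrite /b; move: (3 ^+ d.-1) => c; lra.
Unshelve. all: by end_near. Qed.

(** Functions of large energy are harmless; the others are averaged into periodic
    ones by [lower_bound]. *)
Lemma approx_lower e : 0 < e ->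
  \forall L \near +oo, (Pi - e%:E <= fhom_approx f delta p M L)%E.
Proof.
move=> e0.
pose a := fine Pi; have aE : Pi = a%:E by rewrite fineK// cell_value_fin.
have a0 : 0 <= a.
  apply: fine_ge0; apply: le_ereal_inf_tmp => _ [v _ <-]; exact: energy_ge0.
have h := near_block (lower_bound a0 e0).
near=> L.
have L0 : 0 < L by near: L; apply: nbhs_pinfty_gt; exact: num_real.
have [N [NL LN hN]] : exists N : nat, [/\ N%:R - 1 < L, L <= N%:R &
    forall v, D1 p M L v -> (((N%:R ^+ d.-1)^-1)%:E * Ebox L v <= a%:E)%E ->
      (Eper (uavg N L v) <= ((N%:R ^+ d.-1)^-1)%:E * Ebox L v + e%:E)%E].
  by near: L; exact: h.
have NR0 : 0 < N%:R :> R by exact: lt_le_trans LN.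
have Ln0 : 0 < L ^+ d.-1 by rewrite exprn_gt0.
have Nn0 : 0 < N%:R ^+ d.-1 :> R by rewrite exprn_gt0.
have Li0 : (0 <= (L ^- d.-1)%:E)%E by rewrite lee_fin invr_ge0 ltW.
suff low v : D1 p M L v -> (Pi - e%:E <= (L ^- d.-1)%:E * Ebox L v)%E.
  rewrite /fhom_approx lee_pdivlMl//.
  apply: le_ereal_inf_tmp => _ [v vD <-].
  by rewrite -lee_pdivlMl//; exact: low.
move=> vD.
have le : (((N%:R ^+ d.-1)^-1)%:E * Ebox L v <= (L ^- d.-1)%:E * Ebox L v)%E.
  apply: lee_wpmul2r; first exact: energy_ge0.
  by rewrite lee_fin lef_pV2 ?posrE// lerXn2r// nnegrE ltW.
have [small|big] := leP (((N%:R ^+ d.-1)^-1)%:E * Ebox L v)%E a%:E.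
  rewrite leeBlDr//; apply: (@le_trans _ _ (Eper (uavg N L v))).
    apply: ereal_inf_lbound; exists (uavg N L v) => //.
    by apply: uavg_Dper => //; rewrite -(ltr_nat R).
  by apply: (le_trans (hN v vD small)); apply: leeD.
apply: (@le_trans _ _ a%:E); first by rewrite aE -EFinB lee_fin gerBl ltW.
by apply: le_trans le; exact: ltW.
Unshelve. all: by end_near. Qed.

Lemma cell_formula : fhom_approx f delta p M L @[L --> +oo] --> Pi.
Proof.
pose a := fine Pi; have aE : Pi = a%:E by rewrite fineK// cell_value_fin.
have both e : 0 < e -> \forall L \near +oo,
    (Pi - e%:E <= fhom_approx f delta p M L <= Pi + e%:E)%E.
  move=> e0; near=> L; apply/andP; split.
    by near: L; exact: approx_lower.
  by near: L; exact: approx_upper.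
rewrite aE in both *.
have fin L : (a%:E - 1%:E <= fhom_approx f delta p M L <= a%:E + 1%:E)%E ->
    fhom_approx f delta p M L \is a fin_num.
  move=> /andP[h1 h2]; rewrite fin_numElt (lt_le_trans _ h1) ?(le_lt_trans h2)//.
    by rewrite -EFinD ltry.
  by rewrite -EFinB ltNyr.
apply/fine_cvgP; split; first exact: filterS (both 1 ltr01).
apply/cvgrPdist_le => e e0; near=> L.
have finL : fhom_approx f delta p M L \is a fin_num.
  by apply: fin; near: L; exact: both.
have : (a%:E - e%:E <= fhom_approx f delta p M L <= a%:E + e%:E)%E.
  by near: L; exact: both.
by rewrite -(fineK finL) -EFinB -EFinD !lee_fin distrC ler_distl.
Unshelve. all: by end_near. Qed.

End homogenization.

Lemma measurable_enormd {R : realType} {d : nat} :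
  measurable_fun setT (enormd : Rd R d -> R).
Proof.
have ms : measurable_fun setT (@Num.sqrt R).
  by apply: continuous_measurable_fun; exact: sqrt_continuous.
apply: (measurableT_comp ms).
apply: measurable_funD; last first.
  by apply: measurable_funX; exact: measurable_snd.
apply: measurable_fsum => i; apply: measurable_funX.
by apply: measurable_cV_coor; exact: measurable_fst.
Qed.

Lemma powR_scale_le {R : realType} (p a b k : R) : 0 <= p -> 0 <= k -> 0 <= a ->
  0 <= b -> a <= k * b -> a `^ p <= k `^ p * b `^ p.
Proof. by move=> p0 k0 a0 b0 ab; rewrite -powRM//; exact: le_powR. Qed.

Local Open Scope ereal_scope.

Theorem theorem5p2 (R : realType) (d m : nat) (p : R)
  (hd : (2 <= d)%N) (hm : (1 <= m)%N) (hp : (1 < p)%R)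
  (f : Rd R d -> Rd R d -> 'cV[R]_m -> R)
  (f_ge0 : forall x xi z, (0 <= f x xi z)%R)
  (f_borel : measurable_fun setT
     (fun t : Rd R d * Rd R d * 'cV[R]_m => f t.1.1 t.1.2 t.2))
  (f_periodic : forall (k : 'cV[int]_d.-1) (x xi : Rd R d) (z : 'cV[R]_m),
     f (x.1 + map_mx intr k, x.2)%R xi z = f x xi z)
  (c1 c2 : R) (hc1 : (0 < c1)%R) (hc12 : (c1 < c2)%R)
  (psi rho : Rd R d -> R)
  (psi_meas : measurable_fun setT psi) (rho_meas : measurable_fun setT rho)
  (psi_ge0 : forall xi, (0 <= psi xi)%R) (rho_ge0 : forall xi, (0 <= rho xi)%R)
  (f_lower : forall x xi z,
     (c1 * (psi xi * enorm z `^ p - rho xi) <= f x xi z)%R)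
  (f_upper : forall x xi z,
     (f x xi z <= c2 * (psi xi * enorm z `^ p + rho xi))%R)
  (r0 c0 : R) (hr0 : (0 < r0)%R) (hc0 : (0 < c0)%R)
  (psi_lower : forall xi, cyl r0 xi -> (c0 <= psi xi)%R)
  (psi_rho_int :
     \int[vol]_xi (psi xi * enormd xi `^ p + rho xi)%:E < +oo)
  (psi_rho_slice :
     ereal_sup [set \int[leb d.-1]_y
         (psi (y, t) * enormd (y, t) `^ p + rho (y, t))%:E
       | t in [set t : R | `|t| < 2]%R] < +oo)
  (psi_rho_tail : forall eta : R, (0 < eta)%R -> exists2 r : R, (0 < r)%R &
     ereal_sup [set \int[leb d.-1]_(y in ~` eball r)
         (psi (y, t) * enormd (y, t) `^ p + rho (y, t))%:E
       | t in [set t : R | `|t| < 2]%R] < eta%:E)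
  (delta : R) (hdelta : (0 < delta)%R)
  (f_convex : forall x xi : Rd R d, convex_function setT (f x xi))
  (M : 'M[R]_(m, d.-1)) :
  cvg (fhom_approx f delta p M L @[L --> +oo%R]) /\
  fhom f delta p M =
    ereal_inf [set energy f delta (fun xi => cube 1 `*` Idelta delta xi.2) u
              | u in Dper p M].
Proof.
have p1 : (1 <= p)%R by exact: ltW.
have p0 : (0 <= p)%R by exact: le_trans p1.
have c10 : (0 <= c1)%R by exact: ltW.
have c20 : (0 <= c2)%R by exact: ltW (lt_trans hc1 hc12).
have n0 : (0 < d.-1)%N by rewrite -subn1 subn_gt0.
pose CL : R := (m%:R `^ p * (c1^-1 + 1))%R.
have CL0 : (0 <= CL)%R by rewrite mulr_ge0 ?powR_ge0// addr_ge0 ?invr_ge0.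
have f_low x xi z : (psi xi * snorm z `^ p <= CL * (f x xi z + rho xi))%R.
  have h1 : (snorm z `^ p <= m%:R `^ p * enorm z `^ p)%R.
    apply: powR_scale_le => //; [exact: snorm_ge0|exact: enorm_ge0|].
    exact: snorm_le_enorm.
  apply: (le_trans (ler_wpM2l (psi_ge0 xi) h1)).
  rewrite mulrCA /CL -mulrA; apply: ler_wpM2l; first exact: powR_ge0.
  have h2 : (psi xi * enorm z `^ p <= c1^-1 * f x xi z + rho xi)%R.
    rewrite -lerBlDr ler_pdivlMl//; exact: f_lower.
  apply: (le_trans h2); rewrite mulrDl mul1r mulrDr.
  have h3 : (0 <= c1^-1 * rho xi)%R by rewrite mulr_ge0 ?invr_ge0.
  have := f_ge0 x xi z; have := rho_ge0 xi; lra.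
have f_up x xi z : (f x xi z <= c2 * (psi xi * snorm z `^ p + rho xi))%R.
  apply: (le_trans (f_upper x xi z)); apply: ler_wpM2l => //.
  rewrite lerD2r; apply: ler_wpM2l => //.
  by apply: le_powR => //; [exact: enorm_ge0|exact: enorm_le_snorm].
pose k : R := ((d.-1 + 1)%:R `^ p)%R.
have k1 : (1 <= k)%R.
  have <- : (1 `^ p = 1 :> R)%R by rewrite powR1.
  by apply: le_powR => //; rewrite ler1n addn1.
have me := @measurable_enormd R d; have mx := @measurable_xnorm R d.
have mg : measurable_fun setT (fun xi => psi xi * enormd xi `^ p + rho xi)%R.
  by mfun.
have g0 xi : (0 <= psi xi * enormd xi `^ p + rho xi)%R.
  by rewrite addr_ge0// mulr_ge0 ?powR_ge0.
have theta_fin : \int[vol]_xi (theta p psi rho xi)%:E < +oo.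
  apply: (@le_lt_trans _ _ (\int[vol]_xi (k * (psi xi * enormd xi `^ p + rho xi))%:E)).
    apply: ge0_le_integral_EFin.
    - exact: measurable_theta.
    - by apply: measurable_funM => //; exact: measurable_cst.
    - by move=> xi; exact: theta_ge0.
    - move=> xi; rewrite mulrDr /theta; apply: lerD; last exact: ler_peMl.
      rewrite mulrCA; apply: ler_wpM2l => //.
      apply: powR_scale_le => //; [exact: xnorm_ge0|exact: sqrtr_ge0|].
      exact: xnorm_le_enormd.
  have k0 : (0 <= k)%R by exact: powR_ge0.
  rewrite (ge0_integral_EFinZ vol mg g0 k0).
  by apply: lte_mul_pinfty; rewrite ?lee_fin.
pose cM : R := (\sum_i \sum_j `|M i j|)%R.
have cM0 : (0 <= cM)%R by apply: sumr_ge0 => i _; apply: sumr_ge0.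
have cMP y : (snorm (M *m y) <= cM * snorm y)%R by exact: snorm_mulmx.
(* [s] is large enough for the directions of [sbox (2 / s)] to lie in the
   cylinder where [psi] is bounded below *)
pose s : R := (2 * delta + 4 + (2 * d.-1%:R + 2) / r0)%R.
have dn0 : (0 <= d.-1%:R :> R)%R by [].
have q0 : (0 < (2 * d.-1%:R + 2) / r0)%R by rewrite divr_gt0// ltr_wpDl// mulr_ge0.
have s0 : (0 < s)%R by rewrite /s; lra.
pose r : R := s^-1%R.
have r_gt0 : (0 < r)%R by rewrite invr_gt0.
have rs : (r * s = 1)%R by rewrite mulVf// gt_eqF.
have dr : (delta * r <= 1)%R.
  rewrite -[leRHS]rs mulrC; apply: ler_wpM2l; first exact: ltW.
  rewrite /s; lra.
have r1 : (2 * r <= 1)%R.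
  rewrite -[leRHS]rs mulrC; apply: ler_wpM2l; first exact: ltW.
  rewrite /s; lra.
have rr0 : ((d.-1%:R + 1) * (2 * r) < r0)%R.
  have -> : ((d.-1%:R + 1) * (2 * r) = r * (2 * d.-1%:R + 2))%R by ring.
  rewrite -[X in (r * X)%R](divfK (lt0r_neq0 hr0)) mulrA gtr_pMl//.
  by rewrite -[ltRHS]rs ltr_pM2l// /s; lra.
have psi_low xi : sbox (2 * r) xi -> (c0 <= psi xi)%R.
  have r2 : (0 <= 2 * r)%R by rewrite mulr_ge0// ltW.
  case=> h1 h2; apply: psi_lower; split.
    apply: (le_lt_trans (enorm_le_snorm _)); apply: le_lt_trans rr0.
    apply: (@le_trans _ _ (\sum_(i < d.-1) (2 * r))%R).
      by apply: ler_sum => i _; exact: ltW.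
    rewrite sumr_const card_ord -[leLHS]mulr_natl; apply: ler_wpM2r => //.
    by rewrite lerDl.
  suff : xi.2 \in `](- r0)%R, r0[ by [].
  rewrite in_itv/= -ltr_norml; apply: (lt_trans h2); apply: le_lt_trans rr0.
  by rewrite ler_peMl ?lerDr.
have lim := cell_formula hp hdelta f_ge0 f_borel f_periodic psi_meas rho_meas
  psi_ge0 rho_ge0 CL0 c20 f_low f_up theta_fin cM0 cMP f_convex hc0 r_gt0 dr r1 psi_low n0.
split; first exact: cvgP lim.
exact: cvg_lim lim.
Qed.
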